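(* Let $n\geq 2$ and let $\Omega$ be a bounded domain in $\mathbb{R}^n$ with $C^{6+\epsilon}$ boundary. Suppose that the overdetermined problem $$\Delta^3 u=-1 \ \text{in } \Omega,\qquad u=\frac{\partial u}{\partial \nu}=\Delta u=0 \ \text{on } \partial\Omega,\qquad \frac{\partial (\Delta u)}{\partial \nu}= c \ \text{on } \partial\Omega,$$ where $c$ is a constant, has a solution $u\in C^6(\overline{\Omega})$. When $n\geq 3$, assume in addition that $$\int_{\Omega} (\Delta^2u)^2\gamma\, dx\leq \frac{2(n+2)c^2|\Omega|}{n+6},$$ where $|\Omega|$ is the volume of $\Omega$ and $\gamma$ is the torsion function of $\Omega$, i.e. the solution of $\Delta\gamma=-1$ in $\Omega$, $\gamma=0$ on $\partial\Omega$. Then $\Omega$ is a ball of radius $\left(|c|n(n+2)(n+4)\right)^{1/3}$, and $$u(x) = -\frac{1}{48n(n+2)(n+4)}r^6 +\left(\frac{c^2}{n(n+2)(n+4)}\right)^{1/3}\frac{r^4}{16} -\left(c^4n(n+2)(n+4)\right)^{1/3}\frac{r^2}{16}+\frac{c^2n(n+2)(n+4)}{48},$$ where $r$ denotes the distance from $x$ to the center of $\Omega$.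
   Context: $\nu$ denotes the outward unit normal of $\partial\Omega$. *)

(* Defs.v *)
From HB Require Import structures.
From mathcomp Require Import all_boot all_order all_algebra.
From mathcomp Require Import all_classical all_reals all_analysis.
Set Implicit Arguments. Unset Strict Implicit. Unset Printing Implicit Defensive.
Import Order.TTheory GRing.Theory Num.Theory.
Import numFieldNormedType.Exports.
Local Open Scope classical_set_scope.
Local Open Scope ring_scope.

Section Defs.
Variables (R : realType) (n : nat).
Notation V := 'rV[R]_n.

(* Euclidean norm on R^n (the library norm on matrices is the sup norm) *)
Definition enorm (x : V) : R := Num.sqrt (\sum_(i < n) x ord0 i ^+ 2).

Definition eball (x0 : V) (r : R) : set V := [set x | enorm (x - x0) < r].

Definition ebasis (i : 'I_n) : V := delta_mx ord0 i.

Definition pd (s : seq 'I_n) (f : V -> R) : V -> R :=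
  foldr (fun i g => fun x => derive g x (ebasis i)) f s.

Definition grad (f : V -> R) (x : V) : V := \row_(i < n) pd [:: i] f x.

Definition lap (f : V -> R) : V -> R := fun x => \sum_(i < n) pd [:: i; i] f x.

Definition edot (x y : V) : R := \sum_(i < n) x ord0 i * y ord0 i.

(* topological boundary of an open set *)
Definition bdry (O : set V) : set V := closure O `\` O.

Definition bounded_domain (O : set V) : Prop :=
  O !=set0 /\ open O /\ connected O /\ exists M : R, forall x, O x -> enorm x <= M.

Definition Ck_on (k : nat) (O : set V) (f : V -> R) : Prop :=
  (forall s : seq 'I_n, (size s < k)%N -> forall i, forall x, O x ->
      derivable (pd s f) x (ebasis i)) /\
  (forall s : seq 'I_n, (size s <= k)%N -> forall x, O x -> {for x, continuous (pd s f)}).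

Definition Ck_closure (k : nat) (O : set V) (f : V -> R) : Prop :=
  Ck_on k O f /\ {within closure O, continuous f} /\
  (forall s : seq 'I_n, (size s <= k)%N -> exists g : V -> R,
      {within closure O, continuous g} /\ (forall x, O x -> pd s f x = g x)).

Definition Ckalpha_on (k : nat) (alpha : R) (O : set V) (f : V -> R) : Prop :=
  Ck_on k O f /\
  forall s : seq 'I_n, size s = k -> exists C : R, forall x y, O x -> O y ->
     `|pd s f x - pd s f y| <= C * powR (enorm (x - y)) alpha.

(* phi is a local defining function of O near x0, of class C^{k,alpha}, on the
   ball eball x0 r: phi is C^{k,alpha} there with nonvanishing gradient, and
   O coincides there with {phi < 0} (so the boundary is {phi = 0}) *)
Definition local_defining_fun (k : nat) (alpha : R) (O : set V) (x0 : V) (r : R)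
    (phi : V -> R) : Prop :=
  0 < r /\ Ckalpha_on k alpha (eball x0 r) phi /\
  (forall x, eball x0 r x -> grad phi x != 0) /\
  (forall x, eball x0 r x -> (O x <-> phi x < 0)).

Definition Ckalpha_boundary (k : nat) (alpha : R) (O : set V) : Prop :=
  forall x0, bdry O x0 -> exists r phi, local_defining_fun k alpha O x0 r phi.

Definition outward_unit_normal (O : set V) (nu : V -> V) : Prop :=
  forall x0, bdry O x0 -> exists (r : R) (phi : V -> R),
    0 < r /\ Ck_on 1 (eball x0 r) phi /\
    (forall x, eball x0 r x -> grad phi x != 0) /\
    (forall x, eball x0 r x -> (O x <-> phi x < 0)) /\
    nu x0 = (enorm (grad phi x0))^-1 *: grad phi x0.

Definition torsion_function (O : set V) (gamma : V -> R) : Prop :=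
  Ck_on 2 O gamma /\ {within closure O, continuous gamma} /\
  (forall x, O x -> lap gamma x = -1) /\ (forall x, bdry O x -> gamma x = 0).

End Defs.

(* Lebesgue integral over R^n of a function with values in \bar R,
   as the iterated integral over the coordinates (Tonelli; only used for
   nonnegative measurable integrands) *)
Fixpoint iint (R : realType) (k : nat) (f : seq R -> \bar R) : \bar R :=
  match k with
  | 0 => f [::]
  | k'.+1 => (\int[@lebesgue_measure R]_t iint k' (fun s => f (t :: s)))%E
  end.

Definition rv_integral (R : realType) (n : nat) (F : 'rV[R]_n -> \bar R) : \bar R :=
  iint n (fun s => F (\row_(i < n) nth 0 s i)).

Definition volume (R : realType) (n : nat) (O : set 'rV[R]_n) : \bar R :=
  rv_integral (fun x => (\1_O x)%:E).

(* Main.v *)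
(** Write v = lap u, w = lap v. The boundary conditions make all derivatives of u of order at
    most 2 vanish on the boundary, while the third derivatives are c nu_i nu_j nu_k there. Hence
    P = |D^3 u|^2 - D^2 u : D^2 v + Du . Dw / 2 + al |Dv|^2 + be v w + be u is constant on the
    boundary, and for suitable al and be its Laplacian is 2 |T0|^2 - kap w^2, where T0 is the
    trace-free part of D^4 u and kap is a nonnegative multiple of n - 2. A Pohozaev identity,
    (n + 6) int u = n c^2 |Omega|, gives the integral of P. For n = 2 the maximum principle forces
    P to be constant. For n >= 3 integrating (P - P|bdry) against the torsion function turns the
    hypothesis on the integral of w^2 gamma into int gamma |T0|^2 <= 0. In both cases T0 = 0,
    which determines D^4 u from the Hessian of v; differentiating and tracing, w is a quadratic
    polynomial with Hessian - Id / n, centred at some x0. The rotational derivatives of u about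
    x0 are biharmonic with zero Cauchy data, so u is radial, hence a cubic polynomial of
    |x - x0|^2; the boundary conditions give it a triple root, and Omega is a ball. *)
Require Import Defs.
From HB Require Import structures.
From mathcomp Require Import all_boot all_order all_algebra.
From mathcomp Require Import all_classical all_reals all_analysis.
Import Order.TTheory GRing.Theory Num.Theory.
Import numFieldNormedType.Exports.
Local Open Scope classical_set_scope.
Local Open Scope ring_scope.
From mathcomp Require Import measurable_realfun ring lra zify.
Set Implicit Arguments. Unset Strict Implicit. Unset Printing Implicit Defensive.

(** * Iterated integrals of bounded functions with bounded support *)

(** No surface integral occurs: every integration by parts has a factor that tends to 0 at the
    boundary, so the divergence theorem is needed only for functions extended by zero, and iterated
    one-dimensional integrals suffice. Two losses of regularity shape the rest. First, [w] is only
    C^2, while the Laplacian of [Du . Dw] formally contains [Du . D(lap w)], which is 0; [P]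
    therefore has its Laplacian in a weak sense, on subdomains whose closure lies in the domain, and
    this term is removed by difference quotients. Secondly, the gradient of the torsion function is
    not controlled near the boundary; Green's formula for it and [P] is a limit of identities on its
    superlevel sets. The constants are forced. In [lap P] the terms [D^3 u : D^3 v],
    [D^2 u : D^2 w], [Dv . Dw] and [v] have to cancel, and [|D^2 v|^2] needs the coefficient that it
    has in [2 |T0|^2]. The bound of the hypothesis, multiplied by [kap], is exactly the integral of
    [P] minus its boundary value. *)

Section OneDimensional.
Variable R : realType.
Notation mu := (@lebesgue_measure R).

(** The constants are common to a whole sequence of functions, so that [C] times the indicator of
    [[- B, B]] is one integrable majorant for dominated convergence. *)
Definition boxed (C B : R) (g : R -> R) :=
  [/\ measurable_fun setT g, forall t, `|g t| <= C & forall t, B < `|t| -> g t = 0].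

Lemma integrable_box (B : R) : mu.-integrable setT (EFin \o \1_(`[- B, B]%classic)).
Proof. exact: integrable_indic_itv. Qed.

Lemma integrable_boxM (C B : R) :
  mu.-integrable setT (fun t => (C * \1_(`[- B, B]%classic) t)%:E).
Proof.
have := @integrableZl _ _ _ mu setT measurableT C _ (integrable_box B).
by apply: eq_integrable => // t _ /=; rewrite EFinM.
Qed.

Lemma boxed_le (C B : R) (g : R -> R) (t : R) :
  boxed C B g -> `|g t| <= C * \1_(`[- B, B]%classic) t.
Proof.
move=> [_ gC g0]; have [tB|Bt] := leP `|t| B.
  by rewrite indicE mem_set ?mulr1//= in_itv/= -ler_norml.
by rewrite g0// normr0 mulr_ge0// (le_trans _ (gC t)).
Qed.

Lemma boxed_integrable (C B : R) (g : R -> R) :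
  boxed C B g -> mu.-integrable setT (EFin \o g).
Proof.
move=> bg; apply: (le_integrable _ _ _ (integrable_boxM C B)) => //.
  by apply/measurable_EFinP; case: bg.
move=> t _ /=; rewrite lee_fin; apply: (le_trans (boxed_le t bg)).
exact: ler_norm.
Qed.

Lemma boxed_EFin (C B : R) (g : R -> R) : boxed C B g ->
  (\int[mu]_t (g t)%:E)%E = (\int[mu]_t g t)%:E.
Proof.
move=> bg; rewrite /Rintegral fineK//.
exact: integrable_fin_num (boxed_integrable bg).
Qed.

Lemma boxed_bound (C B : R) (g : R -> R) : 0 <= B -> boxed C B g ->
  `|\int[mu]_t g t| <= C * (2 * B).
Proof.
move=> B0 bg; apply: (le_trans (le_normr_Rintegral measurableT (boxed_integrable bg))).
have -> : C * (2 * B) = \int[mu]_t (C * \1_(`[- B, B]%classic) t).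
  rewrite RintegralZl//; last exact: integrable_box.
  congr (_ * _); rewrite /Rintegral integral_indic//= setIT.
  rewrite lebesgue_measure_itv/= lte_fin; case: ltP => h /=; last lra.
  by rewrite opprK; ring.
apply: le_Rintegral => //.
- apply: (le_integrable _ _ _ (integrable_boxM C B)) => //.
    by apply/measurable_EFinP; apply: measurableT_comp => //; case: bg.
  move=> t _ /=; rewrite lee_fin normr_id; apply: (le_trans (boxed_le t bg)).
  exact: ler_norm.
- exact: integrable_boxM.
- by move=> t _; exact: boxed_le.
Qed.

Lemma boxed_cvg (C B : R) (f : nat -> R -> R) (g : R -> R) :
  (forall i, boxed C B (f i)) -> (forall t, f ^~ t @ \oo --> g t) -> boxed C B g.
Proof.
move=> bf fg; split.
- apply: (@measurable_fun_cvg _ _ _ _ f) => [m|t _]; first by case: (bf m).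
  exact: fg.
- move=> t; have h : (fun i => `|f i t|) @ \oo --> `|g t|.
    by apply: cvg_norm; exact: fg.
  rewrite -(cvg_lim (@Rhausdorff R) h); apply: limr_le.
    by apply/cvg_ex; exists `|g t|.
  by near=> i; case: (bf i).
- move=> t Bt; apply: (cvg_unique (@Rhausdorff R) (fg t)).
  rewrite (_ : f ^~ t = fun=> 0); first exact: cvg_cst.
  by apply/funext => i; case: (bf i) => _ _; exact.
Unshelve. all: by end_near. Qed.

Lemma boxed_dct (C B : R) (f : nat -> R -> R) (g : R -> R) :
  (forall i, boxed C B (f i)) -> (forall t, f ^~ t @ \oo --> g t) ->
  (fun i => \int[mu]_t f i t) @ \oo --> \int[mu]_t g t.
Proof.
move=> bf fg; have bg := boxed_cvg bf fg.
have [] := @dominated_convergence _ _ R mu setT measurableT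
  (fun i t => (f i t)%:E) (fun t => (g t)%:E)
  (fun t => (C * \1_(`[- B, B]%classic) t)%:E).
- by move=> i; apply/measurable_EFinP; case: (bf i).
- by apply/measurable_EFinP; case: bg.
- by apply: aeW => t _; apply: cvg_EFin; [exact: nearW|exact: fg].
- exact: integrable_boxM.
- by apply: aeW => t i _; rewrite /= lee_fin; exact: boxed_le.
move=> _ _; rewrite (boxed_EFin bg).
by move/fine_cvgP => [].
Qed.

Lemma boxed_intD (C B C' : R) (f g : R -> R) : boxed C B f -> boxed C' B g ->
  \int[mu]_t (f t + g t) = \int[mu]_t f t + \int[mu]_t g t.
Proof. by move=> bf bg; rewrite RintegralD//; apply: boxed_integrable; eassumption. Qed.

Lemma boxed_intZ (a C B : R) (f : R -> R) : boxed C B f ->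
  \int[mu]_t (a * f t) = a * \int[mu]_t f t.
Proof. by move=> bf; rewrite RintegralZl//; apply: boxed_integrable bf. Qed.

Lemma boxed_int_le (C C' B : R) (f g : R -> R) : boxed C B f -> boxed C' B g ->
  (forall t, f t <= g t) -> \int[mu]_t f t <= \int[mu]_t g t.
Proof.
by move=> bf bg fg; apply: le_Rintegral => //; apply: boxed_integrable; eassumption.
Qed.

(** Lebesgue measure is determined by its values on half-open intervals, so translation invariance
    has to be checked only there. *)
Lemma shift_measure (h : R) (A : set R) : measurable A ->
  pushforward mu (fun t : R => t + h : measurableTypeR R) A = mu A.
Proof.
have mh : measurable_fun setT (fun t : R => t + h : measurableTypeR R).
  exact: measurable_funD.
move=> mA; apply/esym.
have mh' := isMeasurableFun.Build _ _ _ _ _ mh.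
apply: lebesgue_measure_unique => //= _ [[a b]] _ <-.
rewrite /pushforward.
have -> : (fun t : R => t + h) @^-1` `]a, b] = `]a - h, b - h]%classic.
  by apply/seteqP; split => t /=; rewrite !in_itv/=; lra.
rewrite !lebesgue_measure_itv/= !lte_fin.
have -> : (a - h < b - h) = (a < b) by rewrite ltrD2r.
by case: ifP => // _; rewrite -!EFinD; congr EFin; ring.
Qed.

Lemma boxed_shift (C B h : R) (f : R -> R) : boxed C B f ->
  boxed C (B + `|h|) (fun t => f (t + h)).
Proof.
move=> [mf f1 f2]; split.
- by apply: (measurableT_comp mf); exact: measurable_funD.
- by move=> t; exact: f1.
- move=> t Bt; apply: f2; have := ler_normB (t + h) h.
  by rewrite addrK; lra.
Qed.

Lemma boxed_int_shift (C B h : R) (f : R -> R) : boxed C B f ->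
  \int[mu]_t f (t + h) = \int[mu]_t f t.
Proof.
move=> bf.
pose phi : measurableTypeR R -> measurableTypeR R := fun t => t + h.
have mh : measurable_fun setT phi by exact: measurable_funD.
rewrite /Rintegral; congr fine.
have := @integral_pushforward _ _ _ _ R phi mh mu setT (EFin \o f).
rewrite preimage_setT => /= <- //.
- by apply: eq_measure_integral => //= A mA _; exact: shift_measure.
- by apply/measurable_EFinP; case: bf.
- exact: (boxed_integrable (boxed_shift h bf)).
Qed.

Lemma boxed_int_box (C B e a r : R) (f : R -> R) : boxed C B f ->
  (forall t, 0 <= f t) -> (forall t, `|t - a| < r -> e <= f t) -> 0 <= e -> 0 <= r ->
  e * (2 * r) <= \int[mu]_t f t.
Proof.
move=> bf f0 fe e0 r0.
have -> : e * (2 * r) = \int[mu]_t (e * \1_(`]a - r, a + r[%classic) t).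
  rewrite RintegralZl//; last exact: integrable_indic_itv.
  congr (_ * _); rewrite /Rintegral integral_indic//= setIT.
  rewrite lebesgue_measure_itv/= lte_fin; case: ltP => h /=; last lra.
  ring.
apply: le_Rintegral => //.
- have := @integrableZl _ _ _ mu setT measurableT e _ (integrable_indic_itv (a - r) (a + r) false true).
  by apply: eq_integrable => // t _ /=; rewrite EFinM.
- exact: boxed_integrable bf.
- move=> t _; rewrite indicE; case: (boolP (t \in _)) => /=.
    by rewrite inE/= in_itv/= mulr1 => /andP[h1 h2]; apply: fe; rewrite ltr_norml; apply/andP; lra.
  by rewrite mulr0.
Qed.

(** Dominated convergence gives continuity of a partial integral along sequences; this turns it into
    continuity, hence measurability. *)
Lemma seq_continuous_at (f : R -> R) (t : R) :
  (forall s : nat -> R, s @ \oo --> t -> (fun i => f (s i)) @ \oo --> f t) ->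
  {for t, continuous f}.
Proof.
move=> h; apply/cvgrPdist_lt => e e0; apply: contrapT => hn.
have {}hn (m : nat) : exists x, `|t - x| < m.+1%:R^-1 /\ e <= `|f t - f x|.
  apply: contrapT => hm; apply: hn.
  exists m.+1%:R^-1 => /=; first by rewrite invr_gt0.
  move=> x /= xt; rewrite ltNge; apply/negP => ex; apply: hm; exists x; split=> //.
pose s m := xget 0 [set x | `|t - x| < m.+1%:R^-1 /\ e <= `|f t - f x|].
have hs m : `|t - s m| < m.+1%:R^-1 /\ e <= `|f t - f (s m)|.
  by rewrite /s; case: xgetP => [x _ //|nx]; have [x /nx] := hn m.
have st : s @ \oo --> t.
  apply/cvgrPdist_lt => d d0.
  near=> m; apply: (lt_trans (hs m).1).
  near: m; exact: near_infty_natSinv_lt (PosNum d0).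
have /cvgrPdist_lt/(_ _ e0) := h _ st.
move=> [m _ /(_ m (leqnn m))] /=; rewrite ltNge (hs m).2//.
Unshelve. all: by end_near. Qed.

End OneDimensional.

(** * Iterated integrals over lists of coordinates *)

Section IteratedIntegral.
Variable R : realType.
Notation mu := (@lebesgue_measure R).
Implicit Types (f g : seq R -> R) (s : seq R) (k : nat).

(** Real-valued counterpart of [iint]; [iint_itint] identifies the two on [good] functions. *)
Fixpoint itint k f : R :=
  match k with
  | 0 => f [::]
  | k'.+1 => \int[mu]_t itint k' (fun s => f (t :: s))
  end.

(* The iterated integrals are handled level by level, without product measures: every
   partial integral is required to be measurable, bounded and supported in a box. *)
Fixpoint good (c B : R) k f : Prop :=
  match k with
  | 0 => `|f [::]| <= c
  | k'.+1 => [/\ forall t, good c B k' (fun s => f (t :: s)),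
      forall t s, size s = k' -> B < `|t| -> f (t :: s) = 0 &
      measurable_fun setT (fun t => itint k' (fun s => f (t :: s)))]
  end.

Lemma eq_itint k f g : (forall s, size s = k -> f s = g s) -> itint k f = itint k g.
Proof.
elim: k f g => [|k IH] f g fg /=; first exact: fg.
by apply: eq_Rintegral => t _; apply: IH => s sk; apply: fg; rewrite /= sk.
Qed.

Lemma eq_good c B k f g : (forall s, size s = k -> f s = g s) -> good c B k f -> good c B k g.
Proof.
elim: k f g => [|k IH] f g fg /=; first by rewrite fg.
move=> [h1 h2 h3]; split.
- by move=> t; apply: IH (h1 t) => s sk; apply: fg; rewrite /= sk.
- by move=> t s sk Bt; rewrite -fg/= ?sk// h2.
- apply: eq_measurable_fun h3 => t _; apply: eq_itint => s sk.
  by apply: fg; rewrite /= sk.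
Qed.

Lemma itint0 k : itint k (fun=> 0) = 0.
Proof. by elim: k => [//|k IH] /=; rewrite Rintegral_cst// ?mul0r// IH mul0r. Qed.

Lemma good_bound c B k f : 0 <= B -> good c B k f -> `|itint k f| <= c * (2 * B) ^+ k.
Proof.
move=> B0; elim: k f => [|k IH] f /=; first by rewrite mulr1.
move=> [h1 h2 h3]; rewrite exprSr [c * _]mulrA.
apply: boxed_bound => //.
split=> // [t|t Bt]; first exact: (IH _ (h1 t)).
by rewrite (@eq_itint k _ (fun=> 0)) ?itint0// => s sk; exact: h2.
Qed.

Lemma good_boxed c B k f : 0 <= B -> good c B k.+1 f ->
  boxed (c * (2 * B) ^+ k) B (fun t => itint k (fun s => f (t :: s))).
Proof.
move=> B0 [h1 h2 h3]; split=> // [t|t Bt]; first exact: (good_bound B0 (h1 t)).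
by rewrite (@eq_itint k _ (fun=> 0)) ?itint0// => s sk; exact: h2.
Qed.

Lemma good_dct c B k (f : nat -> seq R -> R) g : 0 <= B ->
  (forall i, good c B k (f i)) ->
  (forall s, size s = k -> f ^~ s @ \oo --> g s) ->
  good c B k g /\ (fun i => itint k (f i)) @ \oo --> itint k g.
Proof.
move=> B0; elim: k f g => [|k IH] f g gf fg.
  split; last exact: fg.
  have h : (fun i => `|f i [::]|) @ \oo --> `|g [::]| by apply: cvg_norm; exact: fg.
  rewrite /= -(cvg_lim (@Rhausdorff R) h); apply: limr_le.
    by apply/cvg_ex; exists `|g [::]|.
  by apply: nearW => i; have := gf i.
have {}IH t : good c B k (fun s => g (t :: s)) /\
  (fun i => itint k (fun s => f i (t :: s))) @ \oo --> itint k (fun s => g (t :: s)).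
  apply: (IH (fun i s => f i (t :: s)) (fun s => g (t :: s))) => [i|s sk].
    by have [h _ _] := gf i; exact: h.
  by apply: fg; rewrite /= sk.
have bf i := good_boxed B0 (gf i).
have fg' t := (IH t).2.
split; last exact: boxed_dct bf fg'.
split => [t|t s sk Bt|]; first by case: (IH t).
- have h : f ^~ (t :: s) @ \oo --> g (t :: s) by apply: fg; rewrite /= sk.
  apply: (cvg_unique (@Rhausdorff R) h).
  rewrite (_ : f ^~ _ = fun=> 0); first exact: cvg_cst.
  by apply/funext => i; have [_ h' _] := gf i; exact: h'.
- by case: (boxed_cvg bf fg').
Qed.

Lemma goodD c c' B k f g : 0 <= B -> good c B k f -> good c' B k g ->
  good (c + c') B k (fun s => f s + g s) /\
  itint k (fun s => f s + g s) = itint k f + itint k g.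
Proof.
move=> B0; elim: k f g => [|k IH] f g.
  by move=> /= h1 h2; split=> //; apply: (le_trans (ler_normD _ _)); rewrite lerD.
move=> gf gg; have bf := good_boxed B0 gf; have bg := good_boxed B0 gg.
move: gf gg => [f1 f2 f3] [g1 g2 g3].
have IHt t := IH _ _ (f1 t) (g1 t).
have e : (fun t => itint k (fun s => f (t :: s) + g (t :: s))) =
   (fun t => itint k (fun s => f (t :: s)) + itint k (fun s => g (t :: s))).
  by apply/funext => t; case: (IHt t).
split; last by rewrite /= e (boxed_intD bf bg).
split=> [t|t s sk Bt|]; first by case: (IHt t).
- by rewrite f2// g2// addr0.
- by rewrite e; exact: measurable_funD.
Qed.

Lemma goodZ a c B k f : 0 <= B -> good c B k f ->
  good (`|a| * c) B k (fun s => a * f s) /\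
  itint k (fun s => a * f s) = a * itint k f.
Proof.
move=> B0; elim: k f => [|k IH] f.
  by move=> /= h1; split=> //; rewrite normrM ler_wpM2l.
move=> gf; have bf := good_boxed B0 gf.
move: gf => [f1 f2 f3].
have IHt t := IH _ (f1 t).
have e : (fun t => itint k (fun s => a * f (t :: s))) =
   (fun t => a * itint k (fun s => f (t :: s))).
  by apply/funext => t; case: (IHt t).
split; last by rewrite /= e (boxed_intZ _ bf).
split=> [t|t s sk Bt|]; first by case: (IHt t).
- by rewrite f2// mulr0.
- by rewrite e; exact: measurable_funM.
Qed.

Lemma good_le c c' B k f g : 0 <= B -> good c B k f -> good c' B k g ->
  (forall s, size s = k -> f s <= g s) -> itint k f <= itint k g.
Proof.
move=> B0; elim: k f g => [|k IH] f g gf gg fg; first exact: fg.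
apply: (boxed_int_le (good_boxed B0 gf) (good_boxed B0 gg)) => t.
move: gf gg => [f1 _ _] [g1 _ _].
by apply: IH (f1 t) (g1 t) _ => s sk; apply: fg; rewrite /= sk.
Qed.

Lemma good_weaken c c' B B' k f : c <= c' -> B <= B' -> good c B k f -> good c' B' k f.
Proof.
move=> cc BB; elim: k f => [|k IH] f /=; first by move=> h; exact: le_trans cc.
move=> [h1 h2 h3]; split=> // [t|t s sk Bt]; first exact: IH.
by apply: h2 => //; exact: le_lt_trans Bt.
Qed.

Fixpoint shift_at i (h : R) s : seq R :=
  match s, i with
  | [::], _ => [::]
  | t :: s', 0 => (t + h) :: s'
  | t :: s', i'.+1 => t :: shift_at i' h s'
  end.

Lemma size_shift_at i h s : size (shift_at i h s) = size s.
Proof. by elim: s i => [|t s IH] [|i] //=; rewrite IH. Qed.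

Lemma nth_shift_at i h s j : (i < size s)%N ->
  nth 0 (shift_at i h s) j = nth 0 s j + (if j == i then h else 0).
Proof.
elim: s i j => [|t s IH] [|i] [|j] //=; rewrite ?addr0// ltnS => iS.
by rewrite IH.
Qed.

Lemma good_shift i h c B k f : 0 <= B -> good c B k f ->
  good c (B + `|h|) k (fun s => f (shift_at i h s)) /\
  itint k (fun s => f (shift_at i h s)) = itint k f.
Proof.
move=> B0; elim: k i f => [|k IH] i f gf; first by case: i.
have bf := good_boxed B0 gf; move: gf => [f1 f2 f3].
case: i => [|i].
  split; last exact: (boxed_int_shift h bf).
  have [g1 g2 g3] := boxed_shift h bf; split => //=.
  - move=> t; apply: (@good_weaken c c B (B + `|h|) k) (f1 (t + h)) => //.
    by rewrite lerDl.
  - move=> t s sk Bt; apply: f2 => //; have := ler_normB (t + h) h.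
    by rewrite addrK; lra.
have IHt t := IH i _ (f1 t).
have e : (fun t => itint k (fun s => f (t :: shift_at i h s))) =
   (fun t => itint k (fun s => f (t :: s))).
  by apply/funext => t; case: (IHt t).
split; last by rewrite /= e.
split => [t|t s sk Bt|] /=; first by case: (IHt t).
- by apply: f2; rewrite ?size_shift_at//; have := normr_ge0 h; lra.
- by rewrite e.
Qed.

Lemma good_box_lb c B k f e r (a : seq R) : 0 <= B -> good c B k f -> 0 <= e -> 0 <= r ->
  (forall s, size s = k -> 0 <= f s) ->
  (forall s, size s = k -> (forall j, (j < k)%N -> `|nth 0 s j - nth 0 a j| < r) -> e <= f s) ->
  e * (2 * r) ^+ k <= itint k f.
Proof.
move=> B0; elim: k f a => [|k IH] f a gf e0 r0 f0 fe /=.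
  by rewrite mulr1; apply: fe.
have bf := good_boxed B0 gf; move: gf => [f1 f2 f3].
rewrite exprSr [e * _]mulrA; apply: (boxed_int_box (a := nth 0 a 0) bf) => //.
- move=> t; rewrite -(itint0 k).
  apply: (@good_le 0 c B k _ _ B0 _ (f1 t)).
    elim: (k) => [|m IHm] /=; first by rewrite normr0.
    by split=> //; rewrite itint0.
  by move=> s sk; apply: f0; rewrite /= sk.
- move=> t tr; apply: (IH _ (behead a) (f1 t)) => //.
    by move=> s sk; apply: f0; rewrite /= sk.
  move=> s sk h; apply: fe => [|[|j] jk]; rewrite /= ?sk//.
  by rewrite -nth_behead; apply: h.
- by rewrite mulr_ge0// exprn_ge0// mulr_ge0.
Qed.

Lemma iint_itint c B k f : 0 <= B -> good c B k f ->
  iint k (fun s => (f s)%:E) = (itint k f)%:E.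
Proof.
move=> B0; elim: k f => [|k IH] f gf //=.
have bf := good_boxed B0 gf; move: gf => [f1 f2 f3].
under eq_integral => t _ do rewrite (IH _ (f1 t)).
exact: boxed_EFin bf.
Qed.

Definition scont k f := forall (S : nat -> seq R) (s : seq R),
  (forall i, size (S i) = k) -> size s = k ->
  (forall j, (j < k)%N -> (fun i => nth 0 (S i) j) @ \oo --> nth 0 s j) ->
  (fun i => f (S i)) @ \oo --> f s.

(** Induction on the number of variables: the slices are [good], and dominated convergence for them
    makes the inner integral continuous in the outer variable, which provides the measurability
    required at this level. *)
Lemma good_scont c B k f : 0 <= B -> scont k f ->
  (forall s, size s = k -> `|f s| <= c) ->
  (forall s j, size s = k -> (j < k)%N -> B < `|nth 0 s j| -> f s = 0) -> good c B k f.
Proof.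
move=> B0; elim: k f => [|k IH] f cf fc f0 /=; first exact: fc.
have sl t : good c B k (fun s => f (t :: s)).
  apply: IH => [S s Sk sk h|s sk|s j sk jk h].
  - apply: (cf (fun i => t :: S i)) => [i||[|j] jk] /=; rewrite ?Sk ?sk//.
      exact: cvg_cst.
    exact: h.
  - by apply: fc; rewrite /= sk.
  - by apply: (f0 _ j.+1) => //=; rewrite sk.
split => //.
  by move=> t s sk Bt; apply: (f0 _ 0%N); rewrite //= sk.
apply: continuous_measurable_fun => t; apply: seq_continuous_at => S St.
apply: (@good_dct c B k (fun i s => f (S i :: s)) (fun s => f (t :: s)) B0 _ _).2 => //.
move=> s sk; apply: (cf (fun i => S i :: s)) => [i||[|j] jk] /=; rewrite ?sk//.
exact: cvg_cst.
Qed.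

End IteratedIntegral.

(** * Integrals over row vectors, and integrands cut off to an open set *)

Section IntegralOnRows.
Variables (R : realType) (n : nat).
Notation V := 'rV[R]_n.
Implicit Types (F G : V -> R) (O : set V) (x y : V).

Lemma max_ubl (a b : R) : a <= Num.max a b.
Proof. by rewrite le_max lexx. Qed.

Lemma max_ubr (a b : R) : b <= Num.max a b.
Proof. by rewrite le_max lexx orbT. Qed.

Lemma coord_norm_le x i : `|x ord0 i| <= `|x|.
Proof.
have -> : `|x| = mx_norm x by [].
have -> : `|x ord0 i| = (`|x ord0 i|%:nng)%:num by [].
rewrite mx_normE num_le.
exact: (le_bigmax _ (fun ij : 'I_1 * 'I_n => `|x ij.1 ij.2|%:nng) (ord0, i)).
Qed.

Lemma row_norm_le x e : 0 <= e -> (forall i, `|x ord0 i| <= e) -> `|x| <= e.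
Proof.
move=> e0 h; have -> : `|x| = mx_norm x by [].
have -> : e = (NngNum e0)%:num by [].
rewrite mx_normE num_le; apply/bigmax_leP; split.
  by rewrite -num_le.
by move=> [i j] _; rewrite -num_le/= ord1; exact: h.
Qed.

Definition rowseq (s : seq R) : V := \row_i nth 0 s i.

Definition Int F : R := itint n (F \o rowseq).

Definition gd c B F := 0 <= B /\ good c B n (F \o rowseq).

Lemma rowseq_surj x : exists2 s, size s = n & x = rowseq s.
Proof.
exists [seq x ord0 i | i <- enum 'I_n]; first by rewrite size_map size_enum_ord.
apply/rowP => i; rewrite mxE (nth_map i) ?nth_ord_enum//.
by rewrite size_enum_ord.
Qed.

Lemma gd_weaken (c c' B B' : R) F : c <= c' -> B <= B' -> gd c B F -> gd c' B' F.
Proof. by move=> cc BB [B0 gF]; split; [exact: le_trans BB|exact: good_weaken gF]. Qed.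

Lemma eq_gd c B F G : (forall x, F x = G x) -> gd c B F -> gd c B G.
Proof. by move=> FG; have -> : F = G by apply/funext. Qed.

Lemma eq_Int F G : (forall x, F x = G x) -> Int F = Int G.
Proof. by move=> FG; have -> : F = G by apply/funext. Qed.

Lemma gdD c c' B B' F G : gd c B F -> gd c' B' G ->
  exists c'' B'', gd c'' B'' (fun x => F x + G x).
Proof.
move=> gF gG; exists (c + c'), (Num.max B B').
have [B0 gF'] := @gd_weaken _ c _ (Num.max B B') _ (lexx _) ((max_ubl _ _)) gF.
have [_ gG'] := @gd_weaken _ c' _ (Num.max B B') _ (lexx _) (max_ubr _ _) gG.
by split=> //; case: (goodD B0 gF' gG').
Qed.

Lemma IntD c c' B B' F G : gd c B F -> gd c' B' G ->
  Int (fun x => F x + G x) = Int F + Int G.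
Proof.
move=> gF gG.
have [B0 gF'] := @gd_weaken _ c _ (Num.max B B') _ (lexx _) ((max_ubl _ _)) gF.
have [_ gG'] := @gd_weaken _ c' _ (Num.max B B') _ (lexx _) (max_ubr _ _) gG.
by case: (goodD B0 gF' gG').
Qed.

Lemma gdZ a c B F : gd c B F -> gd (`|a| * c) B (fun x => a * F x).
Proof. by move=> [B0 gF]; split=> //; case: (goodZ a B0 gF). Qed.

Lemma IntZ a c B F : gd c B F -> Int (fun x => a * F x) = a * Int F.
Proof. by move=> [B0 gF]; case: (goodZ a B0 gF). Qed.

Lemma Int0 : Int (fun=> 0) = 0. Proof. exact: itint0. Qed.

Lemma Int_le c c' B B' F G : gd c B F -> gd c' B' G ->
  (forall x, F x <= G x) -> Int F <= Int G.
Proof.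
move=> gF gG FG.
have [B0 gF'] := @gd_weaken _ c _ (Num.max B B') _ (lexx _) ((max_ubl _ _)) gF.
have [_ gG'] := @gd_weaken _ c' _ (Num.max B B') _ (lexx _) (max_ubr _ _) gG.
by apply: (good_le B0 gF' gG') => s _; exact: FG.
Qed.

Lemma Int_dct c B (F : nat -> V -> R) G :
  (forall i, gd c B (F i)) -> (forall x, F ^~ x @ \oo --> G x) ->
  gd c B G /\ (fun i => Int (F i)) @ \oo --> Int G.
Proof.
move=> gF FG; have [B0 _] := gF 0%N.
have [||h1 h2] := @good_dct R c B n (fun i => F i \o rowseq) (G \o rowseq) B0.
- by move=> i; case: (gF i).
- by move=> s _; exact: FG.
- by split.
Qed.

Lemma rowseq_shift i h s : size s = n ->
  rowseq (shift_at (i : 'I_n) h s) = rowseq s + h *: ebasis R i.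
Proof.
move=> sn; apply/rowP => j; rewrite !mxE nth_shift_at ?sn// eqxx/=.
congr (_ + _); rewrite (_ : (j == i :> nat) = (j == i))//.
by case: eqP => _; rewrite ?mulr1 ?mulr0.
Qed.

Lemma gd_shift (i : 'I_n) h c B F : gd c B F ->
  gd c (B + `|h|) (fun x => F (x + h *: ebasis R i)) /\
  Int (fun x => F (x + h *: ebasis R i)) = Int F.
Proof.
move=> [B0 gF]; have [g1 g2] := good_shift i h B0 gF.
split; last by rewrite /Int -g2; apply: eq_itint => s sn /=; rewrite rowseq_shift.
split; first by rewrite addr_ge0.
by apply: eq_good g1 => s sn /=; rewrite rowseq_shift.
Qed.

Lemma Int_pos c B F x0 r e : gd c B F -> 0 < e -> 0 < r -> (forall x, 0 <= F x) ->
  (forall x, `|x - x0| < r -> e <= F x) -> 0 < Int F.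
Proof.
move=> [B0 gF] e0 r0 F0 Fe; have [a an xa] := rowseq_surj x0.
apply: lt_le_trans (@good_box_lb R c B n _ e (r / 2) a B0 gF _ _ _ _).
- by rewrite mulr_gt0// exprn_gt0// mulr_gt0// divr_gt0.
- exact: ltW.
- by rewrite divr_ge0// ltW.
- by move=> s _; exact: F0.
- move=> s sn h; apply: Fe.
  apply: (@le_lt_trans _ _ (r / 2)); last lra.
  apply: row_norm_le => [|i]; first by lra.
  by rewrite xa !mxE ltW// h.
Qed.

Lemma rv_integral_Int c B F : gd c B F ->
  rv_integral (fun x => (F x)%:E) = (Int F)%:E.
Proof. by move=> [B0 gF]; rewrite /rv_integral (iint_itint B0 gF). Qed.

Lemma cvg_row (S : nat -> V) x :
  (forall i, (fun m => S m ord0 i) @ \oo --> x ord0 i) -> S @ \oo --> x.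
Proof.
move=> h; apply/cvgrPdist_le => e e0.
have H : \forall m \near \oo, forall i : 'I_n, `|x ord0 i - S m ord0 i| <= e.
  by apply: filter_forall => i; move/cvgrPdist_le : (h i); apply.
near=> m; apply: row_norm_le; first exact: ltW.
by near: m; apply: filterS H => m hm i; rewrite !mxE.
Unshelve. all: by end_near. Qed.

Lemma gd_continuous (c B : R) F : 0 <= B -> continuous F -> (forall x, `|F x| <= c) ->
  (forall x i, B < `|x ord0 i| -> F x = 0) -> gd c B F.
Proof.
move=> B0 cF Fc F0; split=> //; apply: good_scont => // [S s Sn sn h|s sn|s j sn jn h].
- apply: (@cvg_comp _ _ _ (fun i => rowseq (S i)) F _ (nbhs (rowseq s))); last exact: cF.
  apply: cvg_row => i; rewrite mxE.
  have -> : (fun m => rowseq (S m) ord0 i) = (fun m => nth 0 (S m) i).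
    by apply/funext => m; rewrite mxE.
  exact: h.
- exact: Fc.
- by apply: (F0 _ (Ordinal jn)); rewrite mxE.
Qed.

Definition bset O := exists2 B, 0 <= B & forall x, O x -> `|x| <= B.

(** Sup-norm distance to the complement: 1-Lipschitz, zero off [O] and positive on an open [O] with
    nonempty complement, hence a source of continuous cutoff functions. *)
Definition cdist O x : R := inf [set `|x - y| | y in ~` O].

Lemma cdist_lip O x y : ~` O !=set0 -> cdist O x <= cdist O y + `|x - y|.
Proof.
move=> [z Oz]; rewrite -lerBlDr; apply: lb_le_inf; first by exists `|y - z|, z.
move=> _ [t Ot <-]; rewrite lerBlDr.
apply: (@le_trans _ _ `|x - t|).
  apply: ge_inf; last by exists t.
  by exists 0 => _ [u _ <-].
have -> : x - t = (x - y) + (y - t) by rewrite addrA subrK.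
by rewrite addrC ler_normD.
Qed.

Lemma cdist_out O x : ~ O x -> cdist O x = 0.
Proof.
move=> Ox; apply/eqP; rewrite eq_le; apply/andP; split.
  apply: ge_inf; first by exists 0 => _ [u _ <-].
  by exists x => //; rewrite subrr normr0.
by apply: lb_le_inf; [exists `|x - x|, x|move=> _ [u _ <-]].
Qed.

Lemma cdist_in O x : ~` O !=set0 -> open O -> O x -> 0 < cdist O x.
Proof.
move=> [z Oz] oO Ox; move: oO; rewrite openE => /(_ x Ox) /nbhs_ballP[e e0 he].
apply: (@lt_le_trans _ _ e) => //; apply: lb_le_inf; first by exists `|x - z|, z.
move=> _ [u Ou <-]; rewrite leNgt; apply/negP => xu; apply: Ou; apply: he.
by rewrite -ball_normE.
Qed.

Lemma near_norm x e : 0 < e -> \forall y \near x, `|x - y| < e.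
Proof. by move=> e0; have := nbhsx_ballx x e e0; rewrite -ball_normE. Qed.

Lemma cvg_rowP F x l :
  (F @ x --> l) <-> (forall e, 0 < e -> \forall y \near x, `|l - F y| <= e).
Proof. exact: (@cvgrPdist_le _ _ _ (nbhs x) (nbhs_filter x)). Qed.

Lemma continuous_near F G x : (\forall y \near x, F y = G y) ->
  {for x, continuous F} -> {for x, continuous G}.
Proof.
move=> h /cvg_rowP cF; apply/cvg_rowP => e e0.
have FG := nbhs_singleton h.
by apply: filterS2 h (cF e e0) => y <-; rewrite FG.
Qed.

Lemma cdist_continuous O : ~` O !=set0 -> continuous (cdist O).
Proof.
move=> nO x; apply/cvg_rowP => e e0.
apply: filterS (near_norm x e0) => y xy.
rewrite ler_norml; have := cdist_lip y x nO; have := cdist_lip x y nO.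
by rewrite (distrC y x) => ? ?; apply/andP; split; lra.
Qed.

Lemma bset_compl O : (0 < n)%N -> bset O -> ~` O !=set0.
Proof.
move=> n0 [B B0 OB]; exists (const_mx (B + 1)) => /OB.
have := coord_norm_le (const_mx (B + 1)) (Ordinal n0); rewrite mxE => h1 h2.
by have := ler_norm (B + 1); lra.
Qed.

(* The indicator of an open set is the limit of the continuous functions
   min(1, m * distance to the complement). *)
Lemma gd_ind O F (c B : R) : (0 < n)%N -> open O -> 0 <= B -> 0 <= c ->
  (forall x, O x -> `|x| <= B) ->
  (forall x, O x -> {for x, continuous F}) -> (forall x, O x -> `|F x| <= c) ->
  gd c B (fun x => \1_O x * F x).
Proof.
move=> n0 oO B0 c0 OB cF Fc.
have nO : ~` O !=set0 by apply: bset_compl => //; exists B.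
pose chi (m : nat) x := Num.min 1 (m%:R * cdist O x).
have chi01 m x : 0 <= chi m x <= 1.
  rewrite /chi ge_min lexx/= andbT le_min ler01/= mulr_ge0//.
  by case: (EM (O x)) => [/(cdist_in nO oO)/ltW|/cdist_out ->].
have chic m : continuous (chi m).
  move=> x; apply: (@continuous_min R V (fun=> 1) (fun y => m%:R * cdist O y)).
    exact: cst_continuous.
  by apply: continuousM; [exact: cst_continuous|exact: cdist_continuous].
have chi0 m x : ~ O x -> chi m x = 0.
  by move=> Ox; rewrite /chi cdist_out// mulr0 min_r.
apply: (@Int_dct c B (fun m x => chi m x * (\1_O x * F x)) _ _ _).1 => [m|x].
  apply: gd_continuous => // [x|x|x i Bx].
  - case: (EM (O x)) => Ox.
      have nx : nbhs x O by move: oO; rewrite openE; exact.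
      apply: (@continuous_near (fun y => chi m y * F y)).
        by apply: filterS nx => y Oy; rewrite indicE mem_set// mul1r.
      by apply: continuousM; [exact: chic|exact: cF].
    (* Nothing is known of [F] off [O]. Near a point outside [O] the cutoff is at most [e / (c + 1)]
       and [F] is at most [c] in absolute value on [O], so the product is still continuous. *)
    apply/cvg_rowP => e e0; rewrite chi0// mul0r.
    have h : \forall y \near x, `|chi m x - chi m y| <= e / (c + 1).
      by move: (chic m x) => /cvg_rowP; apply; rewrite divr_gt0//; lra.
    apply: filterS h => y; rewrite chi0// !sub0r !normrN => h.
    rewrite !normrM; case: (EM (O y)) => Oy; last first.
      by rewrite indicE memNset// normr0 mul0r mulr0 ltW.
    rewrite indicE mem_set// normr1 mul1r.
    apply: (@le_trans _ _ (e / (c + 1) * c)); first by apply: ler_pM => //; exact: Fc.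
    rewrite mulrAC ler_pdivrMr; last by lra.
    by rewrite ler_wpM2l//; [exact: ltW|lra].
  - have /andP[h0 h1] := chi01 m x.
    rewrite !normrM (ger0_norm h0); case: (EM (O x)) => Ox; last first.
      by rewrite indicE memNset// normr0 mul0r mulr0.
    rewrite indicE mem_set// normr1 mul1r.
    by have := ler_pM h0 (normr_ge0 _) h1 (Fc _ Ox); rewrite mul1r.
  - rewrite indicE memNset ?mul0r ?mulr0// => /OB.
    by have := coord_norm_le x i; lra.
case: (EM (O x)) => Ox; last first.
  rewrite indicE memNset// mul0r (_ : (fun _ => _) = fun=> 0); first exact: cvg_cst.
  by apply/funext => m; rewrite mulr0.
have d0 := cdist_in nO oO Ox.
rewrite -[X in _ --> X]mul1r; apply: cvgM; last exact: cvg_cst.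
apply/cvgrPdist_le => e e0; near=> m.
have h : 1 <= m%:R * cdist O x.
  rewrite -ler_pdivrMr// ltW//; near: m; exact: nbhs_infty_gtr.
by rewrite /chi min_l// subrr normr0 ltW.
Unshelve. all: by end_near. Qed.

End IntegralOnRows.

(** Directional derivatives become one-variable derivatives along a line, where the mean value
    theorem applies. *)
Lemma is_derive_line (R : realType) n (F : 'rV[R]_n -> R) (x v : 'rV[R]_n) (t d : R) :
  is_derive (x + t *: v) v F d <-> is_derive t 1 (fun s => F (x + s *: v)) d.
Proof.
have e : (fun h : R => h^-1 *: ((F \o shift (x + t *: v)) (h *: v) - F (x + t *: v))) =
  (fun h : R => h^-1 *: (((fun s => F (x + s *: v)) \o shift t) (h *: 1) - F (x + t *: v))).
  apply/funext => h /=; congr (_ *: (F _ - _)).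
  by rewrite addrCA -scalerDl/= [_ *: 1]mulr1.
by split=> -[h1 h2]; split;
  first [move: h1; rewrite /derivable e; exact | rewrite -h2 /derive e; exact: erefl].
Qed.

(** * Integration over a domain and the divergence lemma *)

Section Lipschitz.
Variable R : realType.
Implicit Types (f : R -> R) (a b M : R).

Lemma mvt_norm f M a b : a <= b -> {within `[a, b], continuous f} ->
  (forall t, a < t < b -> derivable f t 1 /\ `|'D_1 f t| <= M) ->
  `|f b - f a| <= M * (b - a).
Proof.
rewrite le_eqVlt => /orP[/eqP -> _ _|ab]; first by rewrite !subrr normr0 mulr0.
move=> cf df.
have [||c + ->] := @MVT R f (fun t => 'D_1 f t) a b ab => //.
- by move=> t; rewrite in_itv/= => /df[h _]; exact: derivableP.
- rewrite in_itv/= => /df[_ h]; rewrite normrM (@gtr0_norm _ (b - a)) ?subr_gt0//.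
  by rewrite ler_wpM2r// subr_ge0 ltW.
Qed.

(* Differentiability is only asked where f does not vanish: f will be a function on an
   open set extended by zero, restricted to a line. *)
Lemma lip_from_zero f M z b : 0 <= M -> continuous f ->
  (forall t, z <= t <= b -> f t != 0 -> derivable f t 1 /\ `|'D_1 f t| <= M) ->
  z <= b -> f z = 0 -> `|f b| <= M * (b - z).
Proof.
move=> M0 cf df zb fz.
have [->|fb] := eqVneq (f b) 0; first by rewrite normr0 mulr_ge0// subr_ge0.
(* The supremum of [A] is the last zero before [b]. Beyond it [f] does not vanish, so the mean value
   theorem applies from there to [b]. *)
pose A := [set t | z <= t <= b /\ f t = 0].
have hA : has_sup A.
  split; first by exists z; split=> //; rewrite lexx.
  by exists b => t [/andP[]].
have zA : z <= sup A by apply: ub_le_sup; [case: hA|split=> //; rewrite lexx].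
have Ab : sup A <= b by apply: ge_sup; [case: hA|move=> t [/andP[]]].
have f0 : f (sup A) = 0.
  apply: contrapT => /eqP fn.
  have [e e0 he] : \forall t \near sup A, f t != 0.
    have := (@cvgr_neq0 _ _ _ _ (nbhs_filter (sup A)) f _ (cf (sup A)) fn).
    exact.
  have [t At tA] := sup_adherent e0 hA.
  have ts : t <= sup A by apply: ub_le_sup => //; case: hA.
  case: At => _ ft; have := he t; rewrite /= ft eqxx => h; suff : false by [].
  apply: h.
  by rewrite ger0_norm ?subr_ge0//; lra.
have -> : f b = f b - f (sup A) by rewrite f0 subr0.
apply: (@le_trans _ _ (M * (b - sup A))); last by rewrite ler_wpM2l//; lra.
apply: mvt_norm => //; first exact: continuous_subspaceT.
move=> t /andP[t1 t2]; apply: df; first by apply/andP; split; lra.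
apply/eqP => ft.
have : t <= sup A by apply: ub_le_sup; [case: hA|split=> //; lra].
lra.
Qed.

(** Either [f] has a zero [z] between [a] and [b], and the bounds [M * (b - z)] and [M * (z - a)]
    add up, or [f] is differentiable on the whole interval. *)
Lemma lip_with_zeros f M a b : 0 <= M -> continuous f ->
  (forall t, f t != 0 -> derivable f t 1 /\ `|'D_1 f t| <= M) ->
  a <= b -> `|f b - f a| <= M * (b - a).
Proof.
move=> M0 cf df ab.
have [[z [/andP[az zb] fz]]|nz] := EM (exists z, a <= z <= b /\ f z = 0); last first.
  apply: mvt_norm => //; first exact: continuous_subspaceT.
  move=> t /andP[t1 t2]; apply: df; apply/eqP => ft; apply: nz; exists t.
  by split=> //; lra.
have h1 : `|f b| <= M * (b - z) by apply: lip_from_zero => // t _; exact: df.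
have h2 : `|f a| <= M * (z - a).
  pose g t := f (- t).
  have cg : continuous g.
    by move=> t; apply: continuous_comp; [exact: opp_continuous|exact: cf].
  have -> : f a = g (- a) by rewrite /g opprK.
  rewrite (_ : z - a = - a - - z); last by ring.
  apply: lip_from_zero => //; last by rewrite /g opprK.
    move=> t _ gt; have [d1 d2] := df _ gt.
    have h : is_derive t 1 g ('D_1 f (- t) * (-1)).
      apply: (@is_derive1_comp R f -%R).
      exact: derivableP.
    by split; [exact: ex_derive|rewrite derive_val mulrN1 normrN].
  by lra.
have := ler_normB (f b) (f a).
have -> : M * (b - a) = M * (b - z) + M * (z - a) by ring.
lra.
Qed.

End Lipschitz.

(* Locked, so that conversion never unfolds integrals. *)
HB.lock Definition IO (R : realType) (n : nat) (O : set 'rV[R]_n) (F : 'rV[R]_n -> R) : R :=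
  Int (fun x => \1_O x * F x).

Section Domain.
Variables (R : realType) (n : nat).
Notation V := 'rV[R]_n.
Implicit Types (F G : V -> R) (O : set V) (x y : V).

Lemma IOE O F : IO O F = Int (fun x => \1_O x * F x).
Proof. by rewrite IO.unlock. Qed.

(** On a bounded open set these are integrands for which [IO] is linear and monotone; they form an
    algebra. *)
Definition bc O F := (forall x, O x -> {for x, continuous F}) /\
  exists2 c : R, 0 <= c & forall x, O x -> `|F x| <= c.

Definition odom O := [/\ (0 < n)%N, open O & bset O].

Lemma bc_cst O (a : R) : bc O (fun=> a).
Proof. by split; [move=> x _; exact: cst_continuous|exists `|a|]. Qed.

Lemma bcD O F G : bc O F -> bc O G -> bc O (fun x => F x + G x).
Proof.
move=> [F1 [c c0 Fc]] [G1 [d d0 Gd]]; split.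
  by move=> x Ox; apply: continuousD; [exact: F1|exact: G1].
exists (c + d); first exact: addr_ge0.
by move=> x Ox; apply: (le_trans (ler_normD _ _)); rewrite lerD ?Fc ?Gd.
Qed.

Lemma bcM O F G : bc O F -> bc O G -> bc O (fun x => F x * G x).
Proof.
move=> [F1 [c c0 Fc]] [G1 [d d0 Gd]]; split.
  by move=> x Ox; apply: continuousM; [exact: F1|exact: G1].
exists (c * d); first exact: mulr_ge0.
by move=> x Ox; rewrite normrM ler_pM ?Fc ?Gd.
Qed.

Lemma bcZ O (a : R) F : bc O F -> bc O (fun x => a * F x).
Proof. by move=> bF; apply: bcM => //; exact: bc_cst. Qed.

Lemma bcN O F : bc O F -> bc O (fun x => - F x).
Proof.
move=> /(bcZ (-1)); congr bc; apply/funext => x; rewrite mulN1r//.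
Qed.

Lemma bcB O F G : bc O F -> bc O G -> bc O (fun x => F x - G x).
Proof. by move=> bF bG; apply: bcD => //; exact: bcN. Qed.

Lemma bc_sum O (I : Type) (r : seq I) (F : I -> V -> R) :
  (forall i, bc O (F i)) -> bc O (fun x => \sum_(i <- r) F i x).
Proof.
move=> bF; elim: r => [|i r IH].
  by rewrite (_ : (fun _ => _) = fun=> 0); [exact: bc_cst|apply/funext => x; rewrite big_nil].
rewrite (_ : (fun _ => _) = (fun x => F i x + \sum_(i <- r) F i x)); first exact: bcD.
by apply/funext => x; rewrite big_cons.
Qed.

Lemma bc_sub O O' F : O' `<=` O -> bc O F -> bc O' F.
Proof.
move=> OO [F1 [c c0 Fc]]; split; first by move=> x /OO; exact: F1.
by exists c => // x /OO; exact: Fc.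
Qed.

Lemma bc_gd O F : odom O -> bc O F -> exists c B, gd c B (fun x => \1_O x * F x).
Proof.
move=> [n0 oO [B B0 OB]] [F1 [c c0 Fc]]; exists c, B.
exact: gd_ind.
Qed.

Lemma IO_eq O F G : (forall x, O x -> F x = G x) -> IO O F = IO O G.
Proof.
move=> FG; rewrite !IOE; apply: eq_Int => x; case: (EM (O x)) => Ox; first by rewrite FG.
by rewrite indicE memNset// !mul0r.
Qed.

Lemma IO_D O F G : odom O -> bc O F -> bc O G ->
  IO O (fun x => F x + G x) = IO O F + IO O G.
Proof.
move=> oO /(bc_gd oO)[c [B gF]] /(bc_gd oO)[c' [B' gG]].
by rewrite !IOE -(IntD gF gG); apply: eq_Int => x; rewrite mulrDr.
Qed.

Lemma IO_Z O (a : R) F : odom O -> bc O F ->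
  IO O (fun x => a * F x) = a * IO O F.
Proof.
move=> oO /(bc_gd oO)[c [B gF]].
by rewrite !IOE -(IntZ _ gF); apply: eq_Int => x; rewrite mulrCA.
Qed.

Lemma IO_N O F : odom O -> bc O F -> IO O (fun x => - F x) = - IO O F.
Proof.
move=> oO bF; rewrite -mulN1r -IO_Z//; apply: IO_eq => x _; rewrite mulN1r//.
Qed.

Lemma IO_B O F G : odom O -> bc O F -> bc O G ->
  IO O (fun x => F x - G x) = IO O F - IO O G.
Proof. by move=> oO bF bG; rewrite IO_D ?IO_N//; exact: bcN. Qed.

Lemma IO_0 O : IO O (fun=> 0) = 0.
Proof. by rewrite !IOE -[RHS](@Int0 R n); apply: eq_Int => x; rewrite mulr0. Qed.

Lemma IO_sum O (I : Type) (r : seq I) (F : I -> V -> R) : odom O ->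
  (forall i, bc O (F i)) ->
  IO O (fun x => \sum_(i <- r) F i x) = \sum_(i <- r) IO O (F i).
Proof.
move=> oO bF; elim: r => [|i r IH].
  by rewrite big_nil -[RHS](IO_0 O); apply: IO_eq => x _; rewrite big_nil.
rewrite big_cons -IH -IO_D//; last exact: bc_sum.
by apply: IO_eq => x _; rewrite big_cons.
Qed.

Lemma IO_le O F G : odom O -> bc O F -> bc O G ->
  (forall x, O x -> F x <= G x) -> IO O F <= IO O G.
Proof.
move=> oO /(bc_gd oO)[c [B gF]] /(bc_gd oO)[c' [B' gG]] FG; rewrite !IOE.
apply: (Int_le gF gG) => x; rewrite indicE; case: (boolP (x \in O)) => Ox.
  by rewrite !mul1r FG//; rewrite inE in Ox.
by rewrite !mul0r.
Qed.

Lemma IO_ge0 O F : odom O -> bc O F -> (forall x, O x -> 0 <= F x) -> 0 <= IO O F.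
Proof. by move=> oO bF F0; rewrite -(IO_0 O); apply: IO_le => //; exact: bc_cst. Qed.

Lemma IO_eq0 O F : odom O -> bc O F -> (forall x, O x -> 0 <= F x) -> IO O F = 0 ->
  forall x, O x -> F x = 0.
Proof.
move=> oO bF F0 IF x Ox; apply: contrapT => /eqP Fx.
have Fx0 : 0 < F x by rewrite lt_def Fx F0.
have [c [B gF]] := bc_gd oO bF.
have [n0 opO _] := oO.
have nO : nbhs x O by move: opO; rewrite openE; exact.
have cF : nbhs x [set y | `|F x - F y| <= F x / 2].
  by case: bF => /(_ x Ox)/cvg_rowP h _; apply: h; rewrite divr_gt0.
have [r r0 hr] : nbhs_ball x (O `&` [set y | `|F x - F y| <= F x / 2]).
  by apply/nbhs_ballP; exact: filterI.
suff : 0 < IO O F by rewrite IF ltxx.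
rewrite IOE.
apply: (Int_pos gF (x0 := x) (r := r) (e := F x / 2)) => //.
- by rewrite divr_gt0.
- move=> y; rewrite indicE; case: (boolP (y \in O)) => Oy; last by rewrite mul0r.
  by rewrite mul1r F0//; rewrite inE in Oy.
- move=> y yx; have [] := hr y; first by rewrite -ball_normE /= distrC.
  move=> Oy /=; rewrite indicE mem_set// mul1r.
  by rewrite ler_norml => /andP[]; lra.
Qed.

End Domain.

Section Divergence.
Variables (R : realType) (n : nat).
Notation V := 'rV[R]_n.
Implicit Types (F G : V -> R) (O : set V) (x y : V).

Definition vanish O F := forall x, bdry O x -> F @ within O (nbhs x) --> (0 : R).

Lemma vanishP O F x : (F @ within O (nbhs x) --> (0 : R)) <->
  (forall e, 0 < e -> \forall y \near x, O y -> `|F y| <= e).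
Proof.
have FF : Filter (within O (nbhs x)) by apply: within_filter; exact: nbhs_filter.
split=> [/(@cvgrPdist_le _ _ _ _ FF) h e e0|h].
  apply: (@filterS _ (nbhs x) _ (fun y => O y -> `|0 - F y| <= e) _ _ (h e e0)).
  by move=> y; rewrite sub0r normrN.
apply/(@cvgrPdist_le _ _ _ _ FF) => e e0.
apply: (@filterS _ (nbhs x) _ (fun y => O y -> `|F y| <= e) _ _ (h e e0)).
by move=> y; rewrite /= sub0r normrN.
Qed.

Lemma indic_continuous O F : open O -> (forall x, O x -> {for x, continuous F}) ->
  vanish O F -> continuous (fun x => \1_O x * F x).
Proof.
move=> oO cF vF x; case: (EM (O x)) => Ox.
  have nO : nbhs x O by move: oO; rewrite openE; exact.
  apply: (@continuous_near R n F _ x); last exact: cF.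
  by apply: filterS nO => y Oy; rewrite indicE mem_set// mul1r.
apply/cvg_rowP => e e0; rewrite indicE (memNset Ox) mul0r.
case: (EM (closure O x)) => cOx; last first.
  have : nbhs x (~` closure O).
    by have := closed_openC (@closed_closure _ O); rewrite openE; apply.
  apply: filterS => y cOy; rewrite indicE memNset ?mul0r ?subrr ?normr0 ?ltW//.
  by move=> Oy; apply: cOy; exact: subset_closure.
have /vanishP vx := vF x (conj cOx Ox).
apply: filterS (vx e e0) => y; rewrite sub0r normrN indicE.
case: (boolP (y \in O)) => Oy; last by rewrite mul0r normr0 => _; exact: ltW.
by rewrite mul1r; apply; rewrite inE in Oy.
Qed.

Lemma cont_shift (w : V) : continuous (fun y : V => y + w).
Proof. by move=> y; apply: continuousD; [exact: cvg_id|exact: cst_continuous]. Qed.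

Lemma ind1 O x : O x -> \1_O x = 1 :> R.
Proof. by move=> Ox; rewrite indicE mem_set. Qed.

Lemma ind0 O x : ~ O x -> \1_O x = 0 :> R.
Proof. by move=> Ox; rewrite indicE memNset. Qed.

Lemma cvg_line (v x : V) (s : nat -> R) :
  s @ \oo --> 0 -> (fun m => x + s m *: v) @ \oo --> x.
Proof.
move=> s0; have : (fun m => x + s m *: v) @ \oo --> x + 0 *: v.
  by apply: cvgD; [exact: cvg_cst|exact: cvgZr_tmp].
by rewrite scale0r addr0.
Qed.

(* The extension of F by zero is Lipschitz along lines, so that its difference quotients
   are dominated, and their integrals vanish by translation invariance. *)
Lemma derive_zero_int O (k : 'I_n) F G : odom O ->
  (forall x, O x -> is_derive x (ebasis R k) F (G x)) ->
  (forall x, O x -> {for x, continuous F}) -> vanish O F ->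
  (exists2 M, 0 <= M & forall x, O x -> `|G x| <= M) -> IO O G = 0.
Proof.
move=> [n0 oO [B B0 OB]] dF cF vF [M M0 GM].
set e := ebasis R k; pose T x := \1_O x * F x.
have cT : continuous T by exact: indic_continuous.
have nO x : O x -> nbhs x O by move: x; move: oO; rewrite openE.
have T0 x : ~ O x -> T x = 0 by move=> Ox; rewrite /T indicE memNset// mul0r.
have dT x : O x -> is_derive x e T (G x).
  move=> Ox; apply: (near_eq_is_derive _ (dF x Ox)).
  by apply: filterS (nO x Ox) => y Oy; rewrite /T indicE mem_set// mul1r.
have cline x : continuous (fun t : R => x + t *: e).
  by move=> t; apply: cvgD; [exact: cvg_cst|apply: cvgZr_tmp; exact: cvg_id].
have lip x a b : a <= b -> `|T (x + b *: e) - T (x + a *: e)| <= M * (b - a).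
  move=> ab; apply: (@lip_with_zeros R (fun t => T (x + t *: e))) => //.
    by move=> t; apply: (@continuous_comp _ _ _ (fun t : R => x + t *: e) T); [exact: cline|exact: cT].
  move=> t Tt; have Ot : O (x + t *: e).
    by apply: contrapT => /T0 /eqP; rewrite (negbTE Tt).
  have /is_derive_line h := dT _ Ot.
  by split; [exact: ex_derive|rewrite derive_val; exact: GM].
(* A translation by [2 * B + 1] leaves [O], which turns the Lipschitz bound along lines into a bound
   on [F] itself. *)
have outO x : O x -> ~ O (x + (2 * B + 1) *: e).
  move=> /OB xB /OB; have := coord_norm_le (x + (2 * B + 1) *: e) k.
  have := coord_norm_le x k; rewrite !mxE !eqxx mulr1.
  have := ler_norm (x ord0 k + (2 * B + 1)); have := ler_norm (- x ord0 k).
  by rewrite normrN; lra.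
have FB x : O x -> `|F x| <= M * (2 * B + 1).
  move=> Ox; have := lip x 0 (2 * B + 1); rewrite scale0r addr0 subr0 (T0 _ (outO _ Ox)).
  rewrite sub0r normrN /T indicE mem_set// mul1r; apply; lra.
have gT : gd (M * (2 * B + 1)) B T.
  by apply: gd_ind => //; rewrite mulr_ge0//; lra.
pose h (m : nat) : R := m.+1%:R^-1.
have h0 m : 0 < h m by rewrite invr_gt0.
have hc : h @ \oo --> 0 by exact: cvg_harmonic.
have h1 m : h m <= 1 by rewrite invf_le1// ler1n.
pose q m x := (h m)^-1 * (T (x + h m *: e) - T x).
have qM m x : `|q m x| <= M.
  rewrite normrM (gtr0_norm (_ : 0 < _)) ?invr_gt0// ler_pdivrMl//.
  have := lip x 0 (h m) (ltW (h0 m)); rewrite scale0r addr0 subr0 mulrC//.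
have cq m : continuous (q m).
  move=> x; suff : {for x, continuous (fun y => (h m)^-1 * (T (y + h m *: e) - T y))} by [].
  apply: continuousM; first exact: cst_continuous.
  apply: continuousB; last exact: cT.
  apply: (@continuous_comp _ _ _ (fun y : V => y + h m *: e) T); last exact: cT.
  exact: cont_shift.
have g1 : gd 1 B (fun x => \1_O x).
  apply: (@eq_gd _ _ _ _ (fun x => \1_O x * 1)); first by move=> x; rewrite mulr1.
  by apply: gd_ind => //; [move=> x _; exact: cst_continuous|move=> x _; rewrite normr1].
have gTs m := gd_shift k (h m) gT.
have g1s m := gd_shift k (h m) g1.
pose D m x : R := \1_O x * \1_O (x + h m *: e).
have gDm m : gd 1 B (D m).
  pose O' := O `&` ((fun y : V => y + h m *: e) @^-1` O).
  apply: (@eq_gd _ _ _ _ (fun x => \1_O' x * 1)).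
    move=> x; rewrite mulr1 /D; case: (EM (O x)) => a; last first.
      by rewrite (ind0 a) mul0r ind0// => -[].
    case: (EM (O (x + h m *: e))) => b; first by rewrite !ind1 ?mulr1.
    by rewrite (ind0 b) mulr0 ind0// => -[].
  apply: gd_ind => //.
  - apply: openI => //; apply: open_comp => // y _.
    exact: cont_shift.
  - by move=> x [Ox _]; exact: OB.
  - by move=> x _; exact: cst_continuous.
  - by move=> x _; rewrite normr1.
have [_ KI] : gd 1 B (fun x => \1_O x) /\ (fun m => Int (D m)) @ \oo --> Int (fun x => \1_O x).
  apply: Int_dct gDm _ => x; rewrite /D; case: (EM (O x)) => Ox; last first.
    rewrite ind0// (_ : (fun _ => _) = fun=> 0); first exact: cvg_cst.
    by apply/funext => m; rewrite mul0r.
  rewrite ind1//; apply: (@cvg_trans _ ((fun=> 1) @ \oo)); last exact: cvg_cst.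
  apply: near_eq_cvg.
  have H : \forall m \near \oo, O (x + h m *: e) := @cvg_line e x h hc O (nO x Ox).
  by apply: filterS H => m Om; rewrite ind1// mulr1.
have gq m : gd M B (fun x => \1_O x * q m x).
  by apply: gd_ind => // x _; exact: cq.
have [_ AI] : gd M B (fun x => \1_O x * G x) /\
    (fun m => IO O (q m)) @ \oo --> IO O G.
  rewrite IOE (_ : (fun m => IO O (q m)) = (fun m => Int (fun x => \1_O x * q m x))); last first.
    by apply/funext => m; rewrite IOE.
  apply: Int_dct gq _ => x; case: (EM (O x)) => Ox; last first.
    rewrite ind0// mul0r (_ : (fun _ => _) = fun=> 0); first exact: cvg_cst.
    by apply/funext => m; rewrite mul0r.
  rewrite ind1// mul1r (_ : (fun _ => _) = q^~ x); last by apply/funext => m; rewrite mul1r.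
  have [dd <-] := dT x Ox.
  have /cvgr_dnbhsP/(_ h) H := dd.
  have -> : q^~ x = (fun m => (h m)^-1 *: ((T \o shift x) (h m *: e) - T x)).
    by apply/funext => m; rewrite /q /= [_ + x]addrC.
  by apply: H; split=> // m; rewrite gt_eqF.
have Iq m : Int (q m) = 0 /\ exists c' B', gd c' B' (q m).
  have gN := gdZ (-1) gT.
  have [c1 [B1 gs]] := gdD (gTs m).1 gN.
  have gs' := gdZ (h m)^-1 gs.
  have eq x : (h m)^-1 * (T (x + h m *: e) + -1 * T x) = q m x by rewrite mulN1r.
  split; last by eexists; eexists; exact: (eq_gd eq gs').
  rewrite -(eq_Int eq) (IntZ _ gs) (IntD (gTs m).1 gN) (gTs m).2 (IntZ _ gT).
  by rewrite mulN1r subrr mulr0.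
(* The integral of [q m] over the whole space is 0, while its pointwise limit is known in [O] only.
   Off [O] the quotient is nonzero only where the translated point lies in [O], a set of measure
   [|O|] minus the overlap of [O] with its translate; this tends to 0, so the measure of the
   boundary never enters. *)
have bound m : `|IO O (q m)| <= M * (Int (fun x => \1_O x) - Int (D m)).
  have [q0 [c1 [B1 gqm]]] := Iq m.
  have gN := gdZ (-1) (gq m).
  have [c2 [B2 gr]] := gdD gqm gN.
  have IqE : IO O (q m) = - Int (fun x => q m x + -1 * (\1_O x * q m x)).
    by rewrite IOE (IntD gqm gN) q0 add0r (IntZ _ (gq m)) mulN1r opprK.
  have gDN := gdZ (-1) (gDm m).
  have [c3 [B3 gS]] := gdD (g1s m).1 gDN.
  have IS : M * (Int (fun x => \1_O x) - Int (D m)) =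
      Int (fun x => M * (\1_O (x + h m *: e) + -1 * D m x)).
    by rewrite (IntZ _ gS) (IntD (g1s m).1 gDN) (g1s m).2 (IntZ _ (gDm m)) mulN1r.
  have gMS := gdZ M gS.
  have rS x : `|q m x + -1 * (\1_O x * q m x)| <= M * (\1_O (x + h m *: e) + -1 * D m x).
    rewrite /D mulN1r mulN1r; case: (EM (O x)) => Ox.
      by rewrite !(ind1 Ox) !mul1r !subrr mulr0 normr0.
    rewrite (ind0 Ox) !mul0r !subr0.
    case: (EM (O (x + h m *: e))) => Oh; first by rewrite (ind1 Oh) mulr1.
    by rewrite /q !T0// subrr mulr0 normr0 (ind0 Oh) mulr0.
  rewrite IqE normrN IS ler_norml; apply/andP; split; last first.
    by apply: (Int_le gr gMS) => x; exact: le_trans (ler_norm _) (rS x).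
  rewrite lerNl -[leLHS]mulN1r -(IntZ _ gr); apply: (Int_le (gdZ _ gr) gMS) => x.
  by rewrite mulN1r; apply: le_trans (rS x); rewrite -normrN; exact: ler_norm.
have I0 : (fun m => IO O (q m)) @ \oo --> 0.
  apply/cvgr0Pnorm_le => eps eps0.
  have : (fun m => M * (Int (fun x => \1_O x) - Int (D m))) @ \oo --> 0.
    have -> : 0 = M * (Int (fun x => \1_O x) - Int (fun x => \1_O x)) by rewrite subrr mulr0.
    by apply: cvgM; [exact: cvg_cst|apply: cvgB; [exact: cvg_cst|exact: KI]].
  move=> /cvgr0Pnorm_le/(_ _ eps0); apply: filterS => m hm.
  by apply: le_trans (bound m) _; apply: le_trans hm; exact: ler_norm.
exact: (cvg_unique (@Rhausdorff R) AI I0).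
Qed.

End Divergence.

(** * Differential calculus and boundary limits *)

Section Calculus.
Variables (R : realType) (n : nat).
Notation V := 'rV[R]_n.
Notation eb := (ebasis R).
Implicit Types (F G f g : V -> R) (O : set V) (x y : V) (i j : 'I_n).

Definition l1 (v : V) : R := \sum_i `|v ord0 i|.
Definition dotc (c : 'I_n -> R) (v : V) : R := \sum_i c i * v ord0 i.

Lemma dotcB (c : 'I_n -> R) (v w : V) : dotc c (v - w) = dotc c v - dotc c w.
Proof. by rewrite /dotc -sumrB; apply: eq_bigr => i _; rewrite !mxE mulrBr. Qed.

Lemma dotcZ (c : 'I_n -> R) a (v : V) : dotc c (a *: v) = a * dotc c v.
Proof. by rewrite /dotc mulr_sumr; apply: eq_bigr => i _; rewrite !mxE mulrCA. Qed.

Lemma dotcD (c : 'I_n -> R) (v w : V) : dotc c (v + w) = dotc c v + dotc c w.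
Proof. by rewrite /dotc -big_split; apply: eq_bigr => i _; rewrite !mxE mulrDr. Qed.

Lemma l1_ge0 v : 0 <= l1 v.
Proof. by apply: sumr_ge0 => i _. Qed.

Lemma l1Z a v : l1 (a *: v) = `|a| * l1 v.
Proof. by rewrite /l1 mulr_sumr; apply: eq_bigr => i _; rewrite mxE normrM. Qed.

Lemma l1D v w : l1 (v + w) <= l1 v + l1 w.
Proof. by rewrite /l1 -big_split/=; apply: ler_sum => i _; rewrite mxE ler_normD. Qed.

Lemma dotc_le (c : 'I_n -> R) (e : R) v : (forall i, `|c i| <= e) -> `|dotc c v| <= e * l1 v.
Proof.
move=> ce; apply: (le_trans (ler_norm_sum _ _ _)).
rewrite /l1 mulr_sumr; apply: ler_sum => i _.
by rewrite normrM ler_wpM2r.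
Qed.

Lemma row_norm_lt x (e : R) : 0 < e -> (forall i, `|x ord0 i| < e) -> `|x| < e.
Proof.
move=> e0 h.
have [m hm hm'] : exists2 m : R, m < e & forall i, `|x ord0 i| <= m /\ 0 <= m.
  suff [m m1 [m2 m3]] : exists2 m : R, m < e & 0 <= m /\ forall i, i \in enum 'I_n -> `|x ord0 i| <= m.
    by exists m => // i; split=> //; apply: m3; rewrite mem_enum.
  elim: (enum 'I_n) => [|i s [m m1 [m2 m3]]]; first by exists 0.
  exists (Num.max m `|x ord0 i|); first by rewrite gt_max m1 h.
  split; first by rewrite le_max m2.
  move=> j; rewrite in_cons => /orP[/eqP ->|/m3 jm]; first by rewrite le_max lexx orbT.
  by rewrite le_max jm.
case: (posnP n) => [n0|n0].
  by apply: le_lt_trans e0; apply: row_norm_le => // -[i hi]; exfalso; rewrite n0 in hi.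
apply: le_lt_trans hm; apply: row_norm_le => [|i]; last by case: (hm' i).
by case: (hm' (Ordinal n0)).
Qed.

(* The coordinate path from z to y stays in every sup-norm ball containing both. *)
Lemma box_mean_value f (Df : 'I_n -> V -> R) x (d e : R) (c : 'I_n -> R) (y z : V) :
  0 < d ->
  (forall w, `|x - w| < d -> forall i, is_derive w (eb i) f (Df i w)) ->
  (forall w, `|x - w| < d -> forall i, `|Df i w - c i| <= e) ->
  `|x - y| < d -> `|x - z| < d ->
  `|f y - f z - dotc c (y - z)| <= e * l1 (y - z).
Proof.
move=> d0 df ce xy xz.
pose p (m : nat) : V := \row_i (if (i < m)%N then y ord0 i else z ord0 i).
have p0 : p 0%N = z by apply/rowP => i; rewrite mxE.
have pn : p n = y by apply/rowP => i; rewrite mxE ltn_ord.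
have -> : f y - f z = \sum_(i < n) (f (p i.+1) - f (p i)).
  rewrite -{1}pn -{1}p0.
  have := @telescope_sumr R 0 n (fun m => f (p m)) (leq0n _).
  by rewrite big_mkord => ->.
rewrite /dotc -sumrB; apply: (le_trans (ler_norm_sum _ _ _)).
rewrite /l1 mulr_sumr; apply: ler_sum => i _.
set h := (y - z) ord0 i.
have pS : p i.+1 = p i + h *: eb i.
  apply/rowP => j; rewrite !mxE eqxx/= eq_sym ltnS leq_eqVlt.
  case: (ltngtP (j : nat) i) => ji /=.
  - by rewrite (_ : (i == j) = false) ?mulr0 ?addr0//; apply/eqP => E; rewrite E ltnn in ji.
  - by rewrite (_ : (i == j) = false) ?mulr0 ?addr0//; apply/eqP => E; rewrite E ltnn in ji.
  - rewrite (_ : i == j) ?mulr1; last by apply/eqP/val_inj.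
    have -> : j = i by apply/val_inj.
    by rewrite /h !mxE addrC subrK.
have inb (t : R) : 0 <= t <= 1 -> `|x - (p i + (t * h) *: eb i)| < d.
  move=> /andP[t0 t1]; apply: row_norm_lt => // j.
  have hy := le_lt_trans (coord_norm_le (x - y) j) xy.
  have hz := le_lt_trans (coord_norm_le (x - z) j) xz.
  rewrite !mxE eqxx/= in hy hz *.
  have [ij|ij] := eqVneq j i; last by rewrite mulr0 addr0; case: ifP.
  rewrite ij ltnn mulr1 /h !mxE; rewrite ij in hy hz.
  move: hy hz; rewrite !ltr_norml => /andP[y1 y2] /andP[z1 z2].
  set X := x ord0 i in y1 y2 z1 z2 *; set Y := y ord0 i in y1 y2 z1 z2 *.
  set Z := z ord0 i in y1 y2 z1 z2 *.
  have -> : X - (Z + t * (Y - Z)) = (1 - t) * (X - Z) + t * (X - Y) by ring.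
  move: t0; rewrite le_eqVlt => /orP[/eqP <-|t0]; first by apply/andP; split; lra.
  have a1 : 0 <= (1 - t) * (d - (X - Z)) by apply: mulr_ge0; lra.
  have a2 : 0 <= (1 - t) * (d + (X - Z)) by apply: mulr_ge0; lra.
  have b1 : 0 < t * (d - (X - Y)) by apply: mulr_gt0; lra.
  have b2 : 0 < t * (d + (X - Y)) by apply: mulr_gt0; lra.
  by apply/andP; split; lra.
rewrite pS; set q := p i.
pose g t := f (q + (t * h) *: eb i) - t * (c i * h).
have -> : f (q + h *: eb i) - f q - c i * h = g 1 - g 0.
  by rewrite /g !mul1r !mul0r scale0r addr0 subr0; ring.
have -> : e * `|h| = (e * `|h|) * (1 - 0) by ring.
have dg (t : R) : 0 <= t <= 1 ->
    is_derive t 1 g ((Df i (q + (t * h) *: eb i) - c i) * h).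
  move=> t01; have /is_derive_line h1 := df _ (inb t t01) i.
  have h2 : is_derive t 1 (fun s : R => s * h) h.
    have : is_derive t 1 (fun s : R => h *: s) (h *: 1) by exact: is_deriveZ.
    by rewrite [h *: 1]mulr1; congr is_derive; apply/funext => s; rewrite [_ *: _]mulrC.
  have h3 : is_derive t 1 (fun s : R => f (q + (s * h) *: eb i)) (Df i (q + (t * h) *: eb i) * h).
    exact: (@is_derive1_comp R (fun s => f (q + s *: eb i)) (fun s => s * h)).
  have h4 : is_derive t 1 (fun s : R => s * (c i * h)) (c i * h).
    have : is_derive t 1 (fun s : R => (c i * h) *: s) ((c i * h) *: 1) by exact: is_deriveZ.
    by rewrite [_ *: 1]mulr1; congr is_derive; apply/funext => s; rewrite [_ *: _]mulrC.
  by rewrite mulrBl; exact: is_deriveB.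
apply: mvt_norm => //.
  apply: derivable_within_continuous => t; rewrite in_itv/= => t01.
  by have h1 := dg _ t01; exact: ex_derive.
move=> t /andP[t0 t1]; have t01 : 0 <= t <= 1 by rewrite !ltW.
have dgt := dg t t01.
split; first exact: ex_derive.
by rewrite derive_val normrM ler_wpM2r//; apply: ce; exact: inb.
Qed.

Lemma C1_dir O f (Df : 'I_n -> V -> R) x v : open O -> O x ->
  (forall y, O y -> forall i, is_derive y (eb i) f (Df i y)) ->
  (forall i, {for x, continuous (Df i)}) ->
  is_derive x v f (dotc (fun i => Df i x) v).
Proof.
move=> oO Ox df cf.
suff H : (fun h : R => h^-1 *: ((f \o shift x) (h *: v) - f x)) @ 0^' -->
    dotc (fun i => Df i x) v.
  by split; [apply/cvg_ex; eexists; exact: H|exact: (cvg_lim (@Rhausdorff R) H)].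
apply/cvgrPdist_le => e e0.
pose e' := e / (l1 v + 1).
have l0 := l1_ge0 v.
have e'0 : 0 < e' by rewrite divr_gt0//; lra.
have nO : nbhs x O by move: oO; rewrite openE; exact.
have hD : \forall y \near x, forall i, `|Df i x - Df i y| <= e'.
  by apply: (@filter_forall _ _ (fun i y => `|Df i x - Df i y| <= e') (nbhs x) (nbhs_filter x)) => i; move: (cf i) => /cvg_rowP/(_ _ e'0).
have [d /= d0 hd] : nbhs_ball x (O `&` [set y | forall i, `|Df i x - Df i y| <= e']).
  by apply/nbhs_ballP; exact: filterI.
have bd w : `|x - w| < d -> O w /\ forall i, `|Df i x - Df i w| <= e'.
  by move=> xw; apply: hd; rewrite -ball_normE.
have h0 : \forall h \near 0^', h != 0 :> R /\ `|h| < d / (`|v| + 1).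
  near=> h; split; first by near: h; exact: nbhs_dnbhs_neq.
  near: h; apply: dnbhs0_lt; rewrite divr_gt0//.
apply: filterS h0 => h [hn hd'] /=.
have v0 : 0 < `|v| + 1 by exact: ltr_wpDl.
have xh : `|x - (h *: v + x)| < d.
  rewrite opprD addrCA subrr addr0 normrN normrZ.
  move: hd'; rewrite ltr_pdivlMr// => hd'.
  by apply: le_lt_trans hd'; rewrite ler_wpM2l//; lra.
have := @box_mean_value f Df x d e' (fun i => Df i x) (h *: v + x) x d0.
rewrite addrK dotcZ l1Z => H.
have {}H : `|f (h *: v + x) - f x - h * dotc (Df^~ x) v| <= e' * (`|h| * l1 v).
  apply: H => //; last by rewrite subrr normr0.
  - by move=> w /bd[Ow _] i; exact: df.
  - by move=> w /bd[_ Dw] i; rewrite distrC.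
have -> : dotc (Df^~ x) v - h^-1 *: (f (h *: v + x) - f x) =
   - (h^-1 * (f (h *: v + x) - f x - h * dotc (Df^~ x) v)).
  by rewrite mulrBr mulKf// opprB.
rewrite normrN normrM normfV.
rewrite ler_pdivrMl ?normr_gt0//; apply: (le_trans H).
rewrite mulrCA ler_wpM2l//.
rewrite /e' mulrAC ler_pdivrMr; last lra.
by rewrite ler_wpM2l//; lra.
Unshelve. all: by end_near. Qed.

End Calculus.

(** * Derivation rules and the symmetry of mixed derivatives *)

Section DeriveRules.
Variables (R : realType) (n : nat).
Notation V := 'rV[R]_n.
Notation eb := (ebasis R).
Implicit Types (F G f g : V -> R) (O : set V) (x y v : V) (i j : 'I_n) (a b h t : R).

Lemma isdC x v a : is_derive x v (fun=> a) 0.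
Proof. exact: is_derive_cst. Qed.

Lemma isdD F G x v a b : is_derive x v F a -> is_derive x v G b ->
  is_derive x v (fun y => F y + G y) (a + b).
Proof. exact: is_deriveD. Qed.

Lemma isdN F x v a : is_derive x v F a -> is_derive x v (fun y => - F y) (- a).
Proof. exact: is_deriveN. Qed.

Lemma isdB F G x v a b : is_derive x v F a -> is_derive x v G b ->
  is_derive x v (fun y => F y - G y) (a - b).
Proof. exact: is_deriveB. Qed.

Lemma isdM F G x v a b : is_derive x v F a -> is_derive x v G b ->
  is_derive x v (fun y => F y * G y) (a * G x + F x * b).
Proof.
move=> dF dG; have := is_deriveM dF dG; congr is_derive.
by rewrite addrC [a * _]mulrC.
Qed.

Lemma isdZ F x v a b : is_derive x v F b -> is_derive x v (fun y => a * F y) (a * b).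
Proof. by move=> dF; have := isdM (isdC x v a) dF; rewrite mul0r add0r. Qed.

Lemma isd_sum (I : Type) (r : seq I) (F : I -> V -> R) (d : I -> R) x v :
  (forall l, is_derive x v (F l) (d l)) ->
  is_derive x v (fun y => \sum_(l <- r) F l y) (\sum_(l <- r) d l).
Proof.
move=> dF; elim: r => [|l r IH].
  rewrite big_nil (_ : (fun _ => _) = fun=> 0); first exact: isdC.
  by apply/funext => y; rewrite big_nil.
rewrite big_cons (_ : (fun _ => _) = (fun y => F l y + \sum_(l <- r) F l y)).
  exact: isdD.
by apply/funext => y; rewrite big_cons.
Qed.

Lemma isd_coord x i j : is_derive x (eb i) (fun y => y ord0 j) (i == j)%:R.
Proof.
have H : is_derive x (eb i) (id : V -> V) (eb i) by exact: is_derive_id.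
have [h1 h2] := H.
have H' : is_derive (0 : R) 1 (fun t : R => (x + t *: eb i) ord0 j) (i == j)%:R.
  rewrite (_ : (fun _ => _) = (fun t : R => x ord0 j + (i == j)%:R * t)).
    have : is_derive (0 : R) 1 (fun t : R => (i == j)%:R *: t) ((i == j)%:R *: 1).
      exact: is_deriveZ.
    rewrite [_ *: 1]mulr1 => H3.
    have := is_deriveD (is_derive_cst (x ord0 j) (0 : R) 1) H3.
    by rewrite add0r.
  apply/funext => t; rewrite !mxE eqxx/= eq_sym mulrC//.
by have := (is_derive_line (fun y => y ord0 j) x (eb i) 0 _).2 H'; rewrite scale0r addr0.
Qed.

Lemma isd_shift F x v w a : is_derive (x + w) v F a -> is_derive x v (fun y => F (y + w)) a.
Proof.
have e : (fun h : R => h^-1 *: (((fun y => F (y + w)) \o shift x) (h *: v) - F (x + w))) =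
  (fun h : R => h^-1 *: ((F \o shift (x + w)) (h *: v) - F (x + w))).
  by apply/funext => h /=; rewrite addrA.
by move=> [h1 h2]; split; rewrite -?h2 /derivable /derive ?e// -?e.
Qed.

Lemma mvt_line F v y (D : V -> R) c M h : 0 <= h ->
  (forall t, 0 <= t <= h -> is_derive (y + t *: v) v F (D (y + t *: v)) /\
     `|D (y + t *: v) - c| <= M) ->
  `|F (y + h *: v) - F y - h * c| <= M * h.
Proof.
move=> h0 dF.
pose g t := F (y + t *: v) - t * c.
have dg t : 0 <= t <= h -> is_derive t 1 g (D (y + t *: v) - c).
  move=> /dF[/is_derive_line h1 _]; apply: is_deriveB => //.
  have : is_derive t 1 (fun s : R => c *: s) (c *: 1) by exact: is_deriveZ.
  by rewrite [_ *: 1]mulr1; congr is_derive; apply/funext => s; rewrite [_ *: _]mulrC.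
have -> : F (y + h *: v) - F y - h * c = g h - g 0.
  by rewrite /g scale0r addr0; ring.
rewrite -[X in M * X]subr0; apply: mvt_norm => //.
  apply: derivable_within_continuous => t; rewrite in_itv/= => th.
  by have h1 := dg _ th; exact: ex_derive.
move=> t /andP[t0 th]; have tt : 0 <= t <= h by rewrite !ltW.
have dgt := dg t tt.
split; first exact: ex_derive.
by rewrite derive_val; case: (dF _ tt).
Qed.

Lemma norm_eb i h : `|h *: eb i| <= `|h|.
Proof.
apply: row_norm_le => // j; rewrite !mxE eqxx/= normrM ler_piMr//.
by case: eqP => _; rewrite ?normr1 ?normr0.
Qed.

Lemma second_diff f (Di Dji : V -> R) i j x (d e c h : R) : 0 <= h -> 2 * h < d ->
  (forall w, `|x - w| < d -> is_derive w (eb i) f (Di w) /\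
     is_derive w (eb j) Di (Dji w) /\ `|Dji w - c| <= e) ->
  `|f (x + h *: eb i + h *: eb j) - f (x + h *: eb i) - f (x + h *: eb j) + f x - h * (h * c)|
    <= e * h * h.
Proof.
move=> h0 hd H.
pose F z := f (z + h *: eb j) - f z.
have -> : f (x + h *: eb i + h *: eb j) - f (x + h *: eb i) - f (x + h *: eb j) + f x - h * (h * c)
  = F (x + h *: eb i) - F x - h * (h * c) by rewrite /F; ring.
have inb s t : 0 <= s <= h -> 0 <= t <= h -> `|x - (x + s *: eb i + t *: eb j)| < d.
  move=> /andP[s0 sh] /andP[t0 th]; rewrite -addrA opprD addrA subrr add0r normrN.
  apply: le_lt_trans hd; apply: (le_trans (ler_normD _ _)).
  have := norm_eb i s; have := norm_eb j t; rewrite !ger0_norm//; lra.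
apply: (@mvt_line F (eb i) x (fun z => Di (z + h *: eb j) - Di z)) => // s sh.
split.
  have hh : (0 : R) <= h <= h by apply/andP; split.
  apply: isdB; first by apply: isd_shift; case: (H _ (inb s h sh hh)).
  have h00 : (0 : R) <= 0 <= h by apply/andP; split.
  by have [+ _] := H _ (inb s 0 sh h00); rewrite scale0r addr0.
apply: (@mvt_line Di (eb j) (x + s *: eb i) Dji) => // t th.
by case: (H _ (inb s t sh th)) => _ [].
Qed.

(** The second difference over a square of side [h] is symmetric in [i] and [j], and by
    [second_diff] it is within [e / 2 * h * h] of [h * h] times either mixed derivative. *)
Lemma schwarz f (Di Dj Dij Dji : V -> R) O i j x : open O -> O x ->
  (forall y, O y -> is_derive y (eb i) f (Di y) /\ is_derive y (eb j) f (Dj y) /\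
     is_derive y (eb j) Di (Dji y) /\ is_derive y (eb i) Dj (Dij y)) ->
  {for x, continuous Dij} -> {for x, continuous Dji} -> Dij x = Dji x.
Proof.
move=> oO Ox H cij cji; apply/eqP; rewrite -subr_eq0 -normr_le0.
apply/ler_addgt0Pl => e e0; rewrite addr0.
have e2 : 0 < e / 2 by rewrite divr_gt0.
have nO : nbhs x O by move: oO; rewrite openE; exact.
have [d /= d0 hd] : nbhs_ball x (O `&` ([set y | `|Dij x - Dij y| <= e / 2] `&`
   [set y | `|Dji x - Dji y| <= e / 2])).
  apply/nbhs_ballP; move/cvg_rowP : cij => /(_ _ e2) c1.
  by move/cvg_rowP : cji => /(_ _ e2) c2; exact: (filterI nO (filterI c1 c2)).
have bd w : `|x - w| < d -> [/\ O w, `|Dij w - Dij x| <= e / 2 & `|Dji w - Dji x| <= e / 2].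
  move=> xw; rewrite [X in X <= _]distrC [`|Dji w - _|]distrC.
  by have := hd w; rewrite -ball_normE => /(_ xw)[? []].
pose h := d / 3.
have h0 : 0 < h by rewrite divr_gt0.
have hd2 : 2 * h < d by rewrite /h; lra.
have h1 : `|f (x + h *: eb i + h *: eb j) - f (x + h *: eb i) - f (x + h *: eb j) + f x - h * (h * Dji x)|
    <= e / 2 * h * h.
  apply: (@second_diff f Di Dji i j x d) => //; first exact: ltW.
  by move=> w /bd[Ow _ ?]; have [? [? []]] := H w Ow.
have h2 : `|f (x + h *: eb j + h *: eb i) - f (x + h *: eb j) - f (x + h *: eb i) + f x - h * (h * Dij x)|
    <= e / 2 * h * h.
  apply: (@second_diff f Dj Dij j i x d) => //; first exact: ltW.
  by move=> w /bd[Ow ? _]; have [? [? []]] := H w Ow.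
move: h1 h2; rewrite [x + h *: eb j + _]addrAC.
set A := f (x + h *: eb i + h *: eb j); set B := f (x + h *: eb i); set C := f (x + h *: eb j).
move=> h1 h2.
have hh : 0 < h * h by rewrite mulr_gt0.
have : `|Dij x - Dji x| * (h * h) <= e * (h * h).
  rewrite -{1}(gtr0_norm hh) -normrM.
  have -> : (Dij x - Dji x) * (h * h) = (A - B - C + f x - h * (h * Dji x)) -
     (A - C - B + f x - h * (h * Dij x)) by ring.
  apply: (le_trans (ler_normB _ _)).
  have -> : e * (h * h) = e / 2 * h * h + e / 2 * h * h by field.
  exact: lerD.
by rewrite ler_pM2r.
Qed.

Lemma pd_cat s1 s2 f : pd (s1 ++ s2) f = pd s1 (pd s2 f).
Proof. by rewrite /pd foldr_cat. Qed.

Lemma Ck_derive k O f s i x : Ck_on k O f -> (size s < k)%N -> O x ->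
  is_derive x (eb i) (pd s f) (pd (i :: s) f x).
Proof. by move=> [h _] sk Ox; apply: derivableP; exact: h. Qed.

Lemma Ck_cont k O f s x : Ck_on k O f -> (size s <= k)%N -> O x ->
  {for x, continuous (pd s f)}.
Proof. by move=> [_ h] sk Ox; exact: h. Qed.

Lemma open_nbhs_in O x : open O -> O x -> nbhs x O.
Proof. by rewrite openE; exact. Qed.

Lemma derive_eq_on O f g x i : open O -> (forall y, O y -> f y = g y) -> O x ->
  derive f x (eb i) = derive g x (eb i).
Proof.
move=> oO fg Ox; apply: near_eq_derive.
by apply: filterS (open_nbhs_in oO Ox) => y Oy; exact: fg.
Qed.

Lemma pd_eq_on O f g s : open O -> (forall y, O y -> f y = g y) ->
  forall x, O x -> pd s f x = pd s g x.
Proof.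
move=> oO fg; elim: s => [|i s IH] x Ox /=; first exact: fg.
exact: (derive_eq_on (O := O)).
Qed.

Lemma pd_swap k O f l i j s x : open O -> Ck_on k O f ->
  (size (l ++ i :: j :: s) <= k)%N -> O x ->
  pd (l ++ i :: j :: s) f x = pd (l ++ j :: i :: s) f x.
Proof.
move=> oO Cf sk Ox.
have e1 : pd (l ++ [:: i, j & s]) f = pd l (pd [:: i, j & s] f) := pd_cat _ _ _.
have e2 : pd (l ++ [:: j, i & s]) f = pd l (pd [:: j, i & s] f) := pd_cat _ _ _.
rewrite e1 e2.
apply: (pd_eq_on l oO _ Ox) => {Ox}x Ox.
rewrite size_cat /= in sk.
have sk2 : ((size s).+2 <= k)%N by rewrite (leq_trans _ sk)// leq_addl.
apply: (@schwarz (pd s f) (pd (i :: s) f) (pd (j :: s) f) (pd [:: i, j & s] f)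
  (pd [:: j, i & s] f) O i j) => //.
- by move=> y Oy; split; [|split; [|split]]; apply: (Ck_derive (k := k) (O := O)) => //=;
     apply: leq_trans sk2.
- exact: (Ck_cont (k := k) (O := O)).
- exact: (Ck_cont (k := k) (O := O)).
Qed.

Lemma pd_front k O f (t1 : seq 'I_n) i (t2 : seq 'I_n) x : open O -> Ck_on k O f ->
  (size (t1 ++ i :: t2) <= k)%N -> O x ->
  pd (t1 ++ i :: t2) f x = pd (i :: t1 ++ t2) f x.
Proof.
move=> oO Cf; elim: t1 x => [//|a t1 IH] x sk Ox.
rewrite (@pd_swap k O f [::] i a (t1 ++ t2) x oO Cf) //; last first.
  by move: sk; rewrite /= !size_cat/= addnS.
apply: (derive_eq_on (O := O)) => // y Oy; apply: IH => //.
exact: ltnW.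
Qed.

Lemma pd_perm k O f s1 s2 x : open O -> Ck_on k O f -> (size s1 <= k)%N ->
  perm_eq s1 s2 -> O x -> pd s1 f x = pd s2 f x.
Proof.
move=> oO Cf; elim: s1 s2 x => [|i s1 IH] s2 x sk p Ox.
  by move: p; rewrite perm_sym => /perm_nilP ->.
have is2 : i \in s2 by rewrite -(perm_mem p) mem_head.
case/splitPr: is2 p => s2a s2b p.
have p' : perm_eq s1 (s2a ++ s2b).
  by rewrite -(perm_cons i); apply: (perm_trans p); rewrite perm_catC/= perm_cons perm_catC.
have sz : size (s2a ++ i :: s2b) = (size s1).+1 by rewrite -(perm_size p).
rewrite (pd_front oO Cf) ?sz//=.
apply: (derive_eq_on (O := O)) => // y Oy; apply: IH => //.
exact: ltnW.
Qed.

Lemma pd_lap k O f s x : open O -> Ck_on k O f -> (size s + 2 <= k)%N -> O x ->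
  pd s (lap f) x = \sum_a pd (s ++ [:: a; a]) f x.
Proof.
move=> oO Cf; elim: s x => [//|i s IH] x sk Ox.
rewrite /= (@derive_eq_on O _ (fun y => \sum_a pd (s ++ [:: a; a]) f y) x i oO) //; last first.
  by move=> y Oy; apply: IH => //; apply: leq_trans sk; rewrite /= addSn.
have H (a : 'I_n) : is_derive x (eb i) (pd (s ++ [:: a; a]) f) (pd (i :: s ++ [:: a; a]) f x).
  have sz : (size (s ++ [:: a; a]) < k)%N by rewrite size_cat.
  exact: (@Ck_derive k O f (s ++ [:: a; a]) i x Cf sz Ox).
by have [_ ->] := isd_sum (index_enum 'I_n) H.
Qed.

End DeriveRules.

(* f vanishes on the boundary of O = {phi < 0} near x0 and its gradient has the limit G
   there; then G is normal. For a tangent vector tau, the path which leaves x0 along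
   tau - eta a, into O, and then exits O along the normal a joins two zeros of f extended by
   zero; this bounds G . tau by a multiple of the arbitrary eta. *)
Section BoundaryGradient.
Variables (R : realType) (n : nat).
Notation V := 'rV[R]_n.
Notation eb := (ebasis R).
Variables (O : set V) (f : V -> R) (Df : 'I_n -> V -> R) (G : 'I_n -> R) (x0 : V).
Variables (phi : V -> R) (Dphi : 'I_n -> V -> R) (r : R).
Hypothesis oO : open O.
Hypothesis Ox0 : ~ O x0.
Hypothesis df : forall y, O y -> forall i, is_derive y (eb i) f (Df i y).
Hypothesis cDf : forall y, O y -> forall i, {for y, continuous (Df i)}.
Hypothesis cT : continuous (fun x => \1_O x * f x).
Hypothesis DfG : forall i e, 0 < e -> \forall y \near x0, O y -> `|Df i y - G i| <= e.
Hypothesis r0 : 0 < r.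
Hypothesis dphi : forall y, `|x0 - y| < r -> forall i, is_derive y (eb i) phi (Dphi i y).
Hypothesis cDphi : forall i, {for x0, continuous (Dphi i)}.
Hypothesis Ophi : forall y, `|x0 - y| < r -> (O y <-> phi y < 0).
Hypothesis phi0 : phi x0 = 0.

Let a : V := \row_i Dphi i x0.
Let T x := \1_O x * f x.

Lemma dTdir y v : O y -> is_derive y v T (dotc (fun i => Df i y) v).
Proof.
move=> Oy; have H := @C1_dir R n O f Df y v oO Oy df (cDf Oy).
apply: (near_eq_is_derive _ H).
by apply: filterS (open_nbhs_in oO Oy) => z Oz; rewrite /T ind1// mul1r.
Qed.

Lemma boundary_eta (tau : V) (eta : R) : 0 < dotc (Dphi^~ x0) a ->
  dotc (Dphi^~ x0) tau = 0 -> 0 < eta -> eta <= 1 ->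
  `|dotc G tau| <= eta * (3 * `|dotc G a| + 1).
Proof.
set A2 := dotc _ a => A20 atau eta0 eta1.
pose K := l1 tau + 3 * l1 a + 1.
have lt0 := l1_ge0 tau; have la0 := l1_ge0 a.
have K0 : 0 < K by rewrite /K; lra.
(* The bound [A2 / 2] lets the linear part of [phi] decide its sign at the points of the path where
   it is needed; the bound 1 serves the final estimate. Then [e] is such that all first-order errors
   together stay below [eta * m]. *)
pose m := Num.min 1 (A2 / 2).
have m0 : 0 < m by rewrite lt_min ltr01 divr_gt0.
have m1 : m <= 1 by rewrite ge_min lexx.
have mA : m <= A2 / 2 by rewrite ge_min lexx orbT.
pose e := eta * m / K.
have e0 : 0 < e by rewrite divr_gt0// mulr_gt0.
have eK : e * K = eta * m by rewrite /e divfK// gt_eqF.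
have [d [d0 dr hd]] : exists d, [/\ 0 < d, d <= r & forall y, `|x0 - y| < d ->
    (forall i, `|Dphi i y - Dphi i x0| <= e) /\ (O y -> forall i, `|Df i y - G i| <= e)].
  have h1 : \forall y \near x0, forall i, `|Dphi i x0 - Dphi i y| <= e.
    apply: (@filter_forall _ _ (fun i y => `|Dphi i x0 - Dphi i y| <= e) (nbhs x0) (nbhs_filter x0)) => i.
    by have /cvg_rowP/(_ _ e0) := @cDphi i.
  have h2 : \forall y \near x0, forall i, O y -> `|Df i y - G i| <= e.
    apply: (@filter_forall _ _ (fun i y => O y -> `|Df i y - G i| <= e) (nbhs x0) (nbhs_filter x0)) => i.
    exact: DfG.
  have [d /= d0 hd] : nbhs_ball x0 ([set y | forall i, `|Dphi i x0 - Dphi i y| <= e] `&`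
      [set y | forall i, O y -> `|Df i y - G i| <= e]).
    by apply/nbhs_ballP; exact: filterI h1 h2.
  exists (Num.min d r); split; first by rewrite lt_min d0.
    by rewrite ge_min lexx orbT.
  move=> y; rewrite lt_min => /andP[yd _].
  have := hd y; rewrite -ball_normE => /(_ yd)[/= H1 H2].
  by split=> [i|Oy i]; [rewrite distrC|exact: H2].
have nt := normr_ge0 tau; have na := normr_ge0 a.
have Q0 : 0 < `|tau| + 3 * `|a| + 1 by lra.
have [t t0 tQ] : exists2 t, 0 < t & t * (`|tau| + 3 * `|a| + 1) < d.
  exists (d / (2 * (`|tau| + 3 * `|a| + 1))); first by rewrite divr_gt0// mulr_gt0.
  by rewrite invfM mulrA divfK ?gt_eqF//; lra.
pose p := tau - eta *: a.
have ap : dotc (Dphi^~ x0) p = - (eta * A2).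
  by rewrite dotcB dotcZ atau sub0r.
have np : `|p| <= `|tau| + `|a|.
  apply: (le_trans (ler_normB _ _)); rewrite normrZ gtr0_norm//.
  by rewrite lerD2l ler_piMl.
have lp : l1 p <= l1 tau + l1 a.
  rewrite /p -scaleNr; apply: (le_trans (l1D _ _)); rewrite l1Z normrN gtr0_norm//.
  by rewrite lerD2l ler_piMl.
have in1 s : 0 <= s <= t -> `|x0 - (x0 + s *: p)| < d.
  move=> /andP[s0 st]; rewrite opprD addrA subrr add0r normrN normrZ ger0_norm//.
  apply: le_lt_trans tQ; apply: (@le_trans _ _ (t * `|p|)); first exact: ler_wpM2r.
  by rewrite ler_wpM2l//; lra.
have in2 s : 0 <= s <= 2 * eta * t -> `|x0 - (x0 + t *: p + s *: a)| < d.
  move=> /andP[s0 st]; rewrite -addrA opprD addrA subrr add0r normrN.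
  apply: le_lt_trans tQ; apply: (le_trans (ler_normD _ _)).
  rewrite !normrZ !ger0_norm ?(ltW t0)//.
  have h1 : s * `|a| <= t * (2 * `|a|).
    rewrite mulrA; apply: ler_wpM2r => //; apply: (le_trans st).
    have h' : eta * (2 * t) <= 2 * t by rewrite ler_piMl// mulr_ge0// ltW.
      lra.
  have h2 : t * `|p| <= t * (`|tau| + `|a|) by apply: ler_wpM2l => //; exact: ltW.
  by lra.
have dp y : `|x0 - y| < d -> `|phi y - dotc (Dphi^~ x0) (y - x0)| <= e * l1 (y - x0).
  move=> yd; have := @box_mean_value R n phi Dphi x0 d e (Dphi^~ x0) y x0 d0.
  rewrite phi0 subr0; apply => //; last by rewrite subrr normr0.
  - by move=> w wd i; apply: dphi; exact: lt_le_trans dr.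
  - by move=> w /hd[].
have Ep : e * (l1 tau + l1 a) <= eta * m.
  by rewrite -eK ler_wpM2l// ?(ltW e0)// /K; lra.
have O1 s : 0 < s -> s <= t -> O (x0 + s *: p).
  move=> s0 st; have sd : `|x0 - (x0 + s *: p)| < d by apply: in1; rewrite ltW.
  apply/Ophi; first exact: lt_le_trans dr.
  have := dp _ sd; rewrite [x0 + _]addrC addrK dotcZ l1Z (gtr0_norm s0) ap => h.
  have h1 : e * (s * l1 p) <= s * (eta * m).
    rewrite mulrCA ler_wpM2l// ?(ltW s0)//; apply: le_trans Ep.
    by rewrite ler_wpM2l// ltW.
  have h2 : s * (eta * m) <= s * (eta * (A2 / 2)) by rewrite !ler_wpM2l// ltW.
  have h3 : 0 < s * (eta * A2) by rewrite !mulr_gt0.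
  move: h; rewrite ler_norml => /andP[_ h].
  have e1 : s * (eta * (A2 / 2)) = s * (eta * A2) / 2 by field.
  by rewrite addrC in h *; lra.
(* To first order [phi] is [- t * eta * A2] at the end of the first leg; moving by [2 * eta * t]
   along [a] changes it to [t * eta * A2], so [z] is outside [O]. *)
pose z := x0 + t *: p + (2 * eta * t) *: a.
have O2 : ~ O z.
  have zd : `|x0 - z| < d by apply: in2; rewrite lexx !mulr_ge0// ltW.
  move/(Ophi (lt_le_trans zd dr)); apply/negP; rewrite -leNgt.
  have := dp _ zd; rewrite /z -addrA [x0 + _]addrC addrK dotcD !dotcZ ap.
  set L := l1 _ => h.
  have hL : e * L <= t * (eta * m).
    apply: (@le_trans _ _ (e * (t * K))); last by rewrite mulrCA eK.
    rewrite ler_wpM2l ?(ltW e0)//; apply: (le_trans (l1D _ _)).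
    rewrite !l1Z !ger0_norm ?mulr_ge0 ?(ltW t0) ?(ltW eta0)//.
    have h1 : t * l1 p <= t * (l1 tau + l1 a) by apply: ler_wpM2l => //; exact: ltW.
    have h2 : 2 * eta * t * l1 a <= t * (2 * l1 a).
      rewrite mulrA; apply: ler_wpM2r => //.
      have h' : eta * (2 * t) <= 2 * t by rewrite ler_piMl// mulr_ge0// ltW.
      lra.
    by rewrite /K; lra.
  have h2 : t * (eta * m) <= t * (eta * (A2 / 2)) by rewrite !ler_wpM2l// ltW.
  have h3 : 0 < t * (eta * A2) by rewrite !mulr_gt0.
  move: h; rewrite ler_norml => /andP[h _].
  have e1 : t * (eta * (A2 / 2)) = t * (eta * A2) / 2 by field.
  have e2 : 2 * eta * t * A2 = 2 * (t * (eta * A2)) by ring.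
  rewrite -/A2 e2 mulrN in h; rewrite addrC in h *; lra.
have S2 : `|T (x0 + t *: p) - t * dotc G p| <= e * l1 p * t.
  pose g s := T (x0 + s *: p) - s * dotc G p.
  have -> : T (x0 + t *: p) - t * dotc G p = g t - g 0.
    by rewrite /g scale0r addr0 mul0r /T (ind0 Ox0) mul0r !subr0.
  rewrite -[X in _ * X]subr0; apply: mvt_norm; first exact: ltW.
    apply: continuous_subspaceT => s.
    suff : {for s, continuous (fun s : R => T (x0 + s *: p) - s * dotc G p)} by [].
    apply: continuousB; last first.
      by apply: continuousM; [exact: cvg_id|exact: cst_continuous].
    apply: (@continuous_comp _ _ _ (fun s : R => x0 + s *: p) T); last exact: cT.
    by apply: cvgD; [exact: cvg_cst|apply: cvgZr_tmp; exact: cvg_id].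
  move=> s /andP[s0 st].
  have Os := O1 s s0 (ltW st).
  have /is_derive_line h1 := dTdir p Os.
  have h2 : is_derive s 1 (fun s : R => s * dotc G p) (dotc G p).
    have : is_derive s 1 (fun s : R => dotc G p *: s) (dotc G p *: 1) by exact: is_deriveZ.
    by rewrite [_ *: 1]mulr1; congr is_derive; apply/funext => s'; rewrite [_ *: _]mulrC.
  have h3 := is_deriveB h1 h2; split; first exact: ex_derive.
  rewrite derive_val.
  have -> : dotc (Df^~ (x0 + s *: p)) p - dotc G p =
     dotc (fun i => Df i (x0 + s *: p) - G i) p.
    by rewrite /dotc -sumrB; apply: eq_bigr => i _; rewrite mulrBl.
  apply: dotc_le; have sd : 0 <= s <= t by rewrite !ltW.
  by case: (hd _ (in1 s sd)) => _; apply.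
(* The second leg is run backwards from the zero at [z]. It may leave and re-enter [O], which
   [lip_from_zero] allows; its length is proportional to [eta]. *)
have S3 : `|T (x0 + t *: p)| <= (`|dotc G a| + e * l1 a) * (2 * eta * t - 0).
  pose g s := T (z + s *: (- a)).
  have gE s : z + s *: (- a) = x0 + t *: p + (2 * eta * t - s) *: a.
    by rewrite /z scalerN scalerBl addrA.
  have -> : T (x0 + t *: p) = g (2 * eta * t).
    by rewrite /g gE subrr scale0r addr0.
  apply: lip_from_zero.
  - by rewrite addr_ge0// mulr_ge0// ltW.
  - move=> s; apply: (@continuous_comp _ _ _ (fun s : R => z + s *: (- a)) T); last exact: cT.
    by apply: cvgD; [exact: cvg_cst|apply: cvgZr_tmp; exact: cvg_id].
  - move=> s /andP[s0 st] gs.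
    have Os : O (z + s *: (- a)).
      by apply: contrapT => nO; move/eqP: gs; apply; rewrite /g /T (ind0 nO) mul0r.
    have /is_derive_line h1 := dTdir (- a) Os.
    split; first exact: ex_derive.
    rewrite derive_val.
    have -> : dotc (Df^~ (z + s *: - a)) (- a) =
       dotc (fun i => Df i (z + s *: - a) - G i) (- a) + dotc G (- a).
      by rewrite /dotc -big_split; apply: eq_bigr => i _ /=; ring.
    apply: (le_trans (ler_normD _ _)); rewrite [leRHS]addrC lerD//.
      have -> : l1 a = l1 (- a) by rewrite -scaleN1r l1Z normrN1 mul1r.
      apply: dotc_le.
      have sd : `|x0 - (z + s *: (- a))| < d.
        by rewrite gE; apply: in2; apply/andP; split; lra.
      by case: (hd _ sd) => _; apply.
    by rewrite -scaleN1r dotcZ normrM normrN1 mul1r.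
  - by rewrite !mulr_ge0// ltW.
  - by rewrite /g scale0r addr0 /T (ind0 O2) mul0r.
have S4 : t * `|dotc G p| <= t * (e * l1 p + 2 * eta * (`|dotc G a| + e * l1 a)).
  rewrite -{1}(gtr0_norm t0) -normrM.
  have := ler_normB (T (x0 + t *: p)) (T (x0 + t *: p) - t * dotc G p).
  rewrite opprB addrC subrK => /le_trans; apply.
  by have := lerD S3 S2; rewrite subr0; lra.
rewrite ler_pM2l// in S4.
have -> : tau = p + eta *: a by rewrite subrK.
rewrite dotcD dotcZ; apply: (le_trans (ler_normD _ _)).
rewrite normrM (gtr0_norm eta0).
have h5 : e * l1 p + 2 * eta * (e * l1 a) <= eta * 1.
  apply: (@le_trans _ _ (eta * m)); last by rewrite ler_wpM2l// ltW.
  rewrite -eK; have -> : 2 * eta * (e * l1 a) = e * (eta * (2 * l1 a)) by ring.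
  rewrite -mulrDr ler_wpM2l ?(ltW e0)//.
  have : eta * (2 * l1 a) <= 2 * l1 a by rewrite ler_piMl// mulr_ge0.
  by rewrite /K; lra.
by lra.
Qed.

Lemma boundary_grad i :
  G i * (\sum_j Dphi j x0 ^+ 2) = (\sum_j G j * Dphi j x0) * Dphi i x0.
Proof.
pose S := \sum_j Dphi j x0 ^+ 2.
have SE : dotc (Dphi^~ x0) a = S by apply: eq_bigr => j _; rewrite mxE expr2.
have GaE : dotc G a = \sum_j G j * Dphi j x0 by apply: eq_bigr => j _; rewrite mxE.
have S0 : 0 <= S by apply: sumr_ge0 => j _; exact: sqr_ge0.
have [Sz|Sn] := eqVneq S 0.
  have -> : Dphi i x0 = 0.
    have h : forall j, true -> Dphi j x0 ^+ 2 = 0.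
      by apply/psumr_eq0P => // j _; exact: sqr_ge0.
    by apply/eqP; rewrite -sqrf_eq0; apply/eqP; exact: h.
  by rewrite -/S Sz !mulr0.
have Sp : 0 < S by rewrite lt_def Sn.
(* The tangential part of the basis vector [i], multiplied by [S] to avoid a division. *)
pose tau : V := \row_j (if j == i then S else 0) - (Dphi i x0) *: a.
have dE (c : 'I_n -> R) : dotc c (\row_j (if j == i then S else 0)) = c i * S.
  rewrite /dotc (bigD1 i)//= mxE eqxx big1 ?addr0// => j ji.
  by rewrite mxE (negbTE ji) mulr0.
have t0 : dotc (Dphi^~ x0) tau = 0 by rewrite dotcB dotcZ SE dE subrr.
suff : dotc G tau = 0.
  rewrite dotcB dotcZ dE GaE => /eqP; rewrite subr_eq0 => /eqP ->.
  by rewrite mulrC.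
apply/eqP; rewrite -normr_le0; apply/ler_addgt0Pl => e e0; rewrite addr0.
pose C := 3 * `|dotc G a| + 1.
have C0 : 0 < C by rewrite /C; have := normr_ge0 (dotc G a); lra.
pose eta := Num.min 1 (e / C).
have h1 : 0 < eta by rewrite lt_min ltr01 divr_gt0.
have h2 : eta <= 1 by rewrite ge_min lexx.
have h3 : eta <= e / C by rewrite ge_min lexx orbT.
have := boundary_eta _ t0 h1 h2; rewrite SE => /(_ Sp) /le_trans; apply.
by rewrite -ler_pdivlMr.
Qed.

End BoundaryGradient.

(** * Limits at the boundary from inside, and the normal direction *)

Section BoundaryLimits.
Variables (R : realType) (n : nat).
Notation V := 'rV[R]_n.
Notation eb := (ebasis R).
Implicit Types (F G f g : V -> R) (O : set V) (x y v : V) (i j k : 'I_n) (l a b : R).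

Definition tends O x F l := F @ within O (nbhs x) --> l.

Lemma tendsP O x F l : tends O x F l <->
  (forall e, 0 < e -> \forall y \near x, O y -> `|F y - l| <= e).
Proof.
have FF : Filter (within O (nbhs x)) by apply: within_filter; exact: nbhs_filter.
split=> [/(@cvgrPdist_le _ _ _ _ FF) h e e0|h].
  apply: (@filterS _ (nbhs x) _ (fun y => O y -> `|l - F y| <= e) _ _ (h e e0)).
  by move=> y; rewrite distrC.
apply/(@cvgrPdist_le _ _ _ _ FF) => e e0.
apply: (@filterS _ (nbhs x) _ (fun y => O y -> `|F y - l| <= e) _ _ (h e e0)).
by move=> y; rewrite /= distrC.
Qed.

Lemma tends_uniq O x F l l' : closure O x -> tends O x F l -> tends O x F l' -> l = l'.
Proof.
move=> cOx h1 h2.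
have PF : ProperFilter (within O (nbhs x)) by exact: within_nbhs_proper.
exact: (cvg_unique (@Rhausdorff R) h1 h2).
Qed.

Lemma tends_cst O x a : tends O x (fun=> a) a.
Proof. by apply/tendsP => e e0; near=> y => _; rewrite subrr normr0 ltW.
Unshelve. all: by end_near. Qed.

Lemma tendsD O x F G a b : tends O x F a -> tends O x G b ->
  tends O x (fun y => F y + G y) (a + b).
Proof. by apply: cvgD; apply: within_filter; exact: nbhs_filter. Qed.

Lemma tendsM O x F G a b : tends O x F a -> tends O x G b ->
  tends O x (fun y => F y * G y) (a * b).
Proof. by apply: cvgM; apply: within_filter; exact: nbhs_filter. Qed.

Lemma tendsZ O x F a b : tends O x F a -> tends O x (fun y => b * F y) (b * a).
Proof. by move=> h; apply: tendsM => //; exact: tends_cst. Qed.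

Lemma tends_sum O x (I : Type) (r : seq I) (F : I -> V -> R) (d : I -> R) :
  (forall m, tends O x (F m) (d m)) ->
  tends O x (fun y => \sum_(m <- r) F m y) (\sum_(m <- r) d m).
Proof.
move=> dF; elim: r => [|m r IH].
  rewrite big_nil (_ : (fun _ => _) = fun=> 0); first exact: tends_cst.
  by apply/funext => y; rewrite big_nil.
rewrite big_cons (_ : (fun _ => _) = (fun y => F m y + \sum_(m <- r) F m y)).
  exact: tendsD.
by apply/funext => y; rewrite big_cons.
Qed.

Lemma tends_eq O x F G l : (forall y, O y -> F y = G y) -> tends O x F l -> tends O x G l.
Proof.
move=> FG /tendsP h; apply/tendsP => e e0; apply: filterS (h e e0) => y hy Oy.
by rewrite -FG//; exact: hy.
Qed.

Lemma tends_cont O x F : {for x, continuous F} -> tends O x F (F x).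
Proof.
move=> /cvg_rowP h; apply/tendsP => e e0; apply: filterS (h e e0) => y hy _.
by rewrite distrC.
Qed.

Lemma enorm_l1 (v : V) : enorm v <= l1 v.
Proof.
rewrite /enorm -[leRHS]ger0_norm ?l1_ge0// -sqrtr_sqr ler_wsqrtr//.
rewrite /l1; elim: (index_enum _) => [|i s IH]; first by rewrite !big_nil expr0n.
rewrite !big_cons sqrrD -[X in X + _ <= _]real_normK ?num_real//.
have h : 0 <= \sum_(j <- s) `|v ord0 j| by apply: sumr_ge0.
have := mulr_ge0 (normr_ge0 (v ord0 i)) h.
by lra.
Qed.

Lemma l1_norm (v : V) : l1 v <= n%:R * `|v|.
Proof.
rewrite /l1; apply: (@le_trans _ _ (\sum_(i < n) `|v|)).
  by apply: ler_sum => i _; exact: coord_norm_le.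
by rewrite sumr_const card_ord mulr_natl.
Qed.

(** The second half is [boundary_grad] for the defining function that [outward_unit_normal] attaches
    to the point, rewritten in terms of its normalized gradient. *)
Lemma bdry_normal O (nu : V -> V) x0 : open O -> outward_unit_normal O nu -> bdry O x0 ->
  \sum_i nu x0 ord0 i ^+ 2 = 1 /\
  forall f (Df : 'I_n -> V -> R) (G : 'I_n -> R),
   (forall y, O y -> forall i, is_derive y (eb i) f (Df i y)) ->
   (forall y, O y -> forall i, {for y, continuous (Df i)}) ->
   (forall y, O y -> {for y, continuous f}) -> vanish O f ->
   (forall i, tends O x0 (Df i) (G i)) ->
   forall i, G i = (\sum_j G j * nu x0 ord0 j) * nu x0 ord0 i.
Proof.
move=> oO hnu bx; have [cx nx] := bx.
have [r [phi [r0 [Cphi [gphi [Ophi nuE]]]]]] := hnu x0 bx.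
pose a i := pd [:: i] phi x0.
(* [eball] is Euclidean while neighbourhoods are those of the sup norm; the two norms differ by a
   factor of at most [n], and [n.+1] is never 0. *)
have inball y : `|x0 - y| < r / n.+1%:R -> eball x0 r y.
  rewrite ltr_pdivlMr ?ltr0n// => xy; rewrite /eball /= .
  apply: (le_lt_trans (enorm_l1 _)); apply: (le_lt_trans (l1_norm _)).
  apply: le_lt_trans xy; rewrite distrC mulrC ler_wpM2l// ler_nat//.
have r'0 : 0 < r / n.+1%:R by rewrite divr_gt0.
have x0in : eball x0 r x0 by apply: inball; rewrite subrr normr0.
have p0 : phi x0 = 0.
  apply/eqP; rewrite eq_le; apply/andP; split; last first.
    by rewrite leNgt; apply/negP => /(Ophi x0 x0in).
  rewrite leNgt; apply/negP => pp.
  have cp : {for x0, continuous phi} by apply: (Ck_cont (s := [::]) Cphi).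
  have h1 : nbhs x0 [set y | `|phi x0 - phi y| <= phi x0 / 2].
    by move/cvg_rowP : cp => /(_ (phi x0 / 2)); apply; rewrite divr_gt0.
  have h2 : nbhs x0 [set y | `|x0 - y| < r / n.+1%:R] by exact: near_norm.
  have [y [Oy [/= y1 y2]]] := cx _ (filterI h1 h2).
  have := (Ophi y (inball y y2)).1 Oy.
  by move: y1; rewrite ler_norml => /andP[]; lra.
pose S := \sum_i a i ^+ 2.
have gE i : grad phi x0 ord0 i = a i by rewrite mxE.
have S0 : 0 < S.
  rewrite lt_def sumr_ge0 ?andbT; last by move=> i _; exact: sqr_ge0.
  apply/eqP => Sz; have /eqP := gphi x0 x0in; apply.
  apply/rowP => i; rewrite gE mxE.
  have h : forall j, true -> a j ^+ 2 = 0.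
    by apply/psumr_eq0P => // j _; exact: sqr_ge0.
  by apply/eqP; rewrite -sqrf_eq0; apply/eqP; exact: h.
have eS : enorm (grad phi x0) = Num.sqrt S.
  by rewrite /enorm; congr Num.sqrt; apply: eq_bigr => i _; rewrite gE.
have nE i : nu x0 ord0 i = (Num.sqrt S)^-1 * a i by rewrite nuE eS !mxE.
have sS : (Num.sqrt S)^-1 * (Num.sqrt S)^-1 = S^-1.
  by rewrite -invfM -expr2 sqr_sqrtr// ltW.
split.
  rewrite (eq_bigr (fun i => S^-1 * a i ^+ 2)).
    by rewrite -mulr_sumr mulVf// gt_eqF.
  by move=> i _; rewrite nE exprMn expr2 sS.
move=> f Df G df cDf cf vf DfG i.
have H := @boundary_grad R n O f Df G x0 phi (fun i => pd [:: i] phi) (r / n.+1%:R)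
  oO nx df cDf (indic_continuous oO cf vf) _ r'0 _ _ _ p0 i.
have {}H : G i * S = (\sum_j G j * a j) * a i.
  apply: H.
  - by move=> j; move/tendsP : (DfG j).
  - by move=> y /inball By j; apply: (Ck_derive (s := [::]) j Cphi).
  - by move=> j; apply: (Ck_cont (s := [:: j]) Cphi).
  - by move=> y /inball; exact: Ophi.
rewrite (eq_bigr (fun j => (Num.sqrt S)^-1 * (G j * a j))); last first.
  by move=> j _; rewrite nE mulrCA.
rewrite -mulr_sumr nE mulrACA sS -H mulrC mulfK// gt_eqF//.
Qed.

End BoundaryLimits.

(* Locked, so that conversion never unfolds iterated derivatives. *)
HB.lock Definition dp (R : realType) (n : nat) (s : seq 'I_n) (f : 'rV[R]_n -> R) :
  'rV[R]_n -> R := pd s f.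

Lemma dpE (R : realType) (n : nat) : @dp R n = @pd R n.
Proof. by apply/funext => s; apply/funext => f; rewrite dp.unlock. Qed.

(** * Boundary values of the derivatives of u up to order three *)

Section Jets.
Variables (R : realType) (n : nat).
Notation V := 'rV[R]_n.
Notation eb := (ebasis R).
Implicit Types (F G f g u : V -> R) (O : set V) (x y v : V) (i j k : 'I_n) (l c : R).

Lemma norm_le_enorm x : `|x| <= enorm x.
Proof.
apply: row_norm_le => [|i]; first exact: sqrtr_ge0.
rewrite /enorm -sqrtr_sqr ler_wsqrtr// (bigD1 i)//= lerDl.
by apply: sumr_ge0 => j _; exact: sqr_ge0.
Qed.

Lemma bset_closure O : bset O -> bset (closure O).
Proof.
move=> [B B0 OB]; exists (B + 1); first by lra.
move=> x cx; have [y [Oy]] := cx _ (near_norm x ltr01).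
move=> /= xy; have := ler_normD (x - y) y; rewrite subrK => h.
by have := OB y Oy; lra.
Qed.

Lemma compact_closure O : bset O -> compact (closure O).
Proof.
move=> /bset_closure[B B0 OB]; apply: bounded_closed_compact; last exact: closed_closure.
exists B; split; first exact: num_real.
by move=> M BM x /OB h; apply: (le_trans h); exact: ltW.
Qed.

Lemma within_closure_bc O F g : bset O ->
  {within closure O, continuous g} -> (forall x, O x -> F x = g x) ->
  exists2 c, 0 <= c & forall x, O x -> `|F x| <= c.
Proof.
move=> bO cg Fg.
have : compact (g @` closure O) by apply: continuous_compact => //; exact: compact_closure.
move=> /compact_bounded[M [_ hM]].
exists (`|M| + 1); first by have := normr_ge0 M; lra.
move=> x Ox; rewrite Fg//; apply: (hM (`|M| + 1)); first by have := ler_norm M; lra.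
by exists x => //; exact: subset_closure.
Qed.

Lemma within_closure_tends O F g x : {within closure O, continuous g} ->
  (forall x, O x -> F x = g x) -> closure O x -> tends O x F (g x).
Proof.
move=> cg Fg cx.
have h : g @ within (closure O) (nbhs x) --> g x.
  by move/subspace_continuousP : cg; exact.
have FF : Filter (within (closure O) (nbhs x)) by apply: within_filter; exact: nbhs_filter.
apply/tendsP => e e0; have H := (@cvgrPdist_le _ _ _ _ FF _ _).1 h e e0.
apply: (@filterS _ (nbhs x) _ (fun y => closure O y -> `|g x - g y| <= e) _ _ H).
move=> y hy Oy; rewrite Fg// distrC; apply: hy; exact: subset_closure.
Qed.

(* What the overdetermined problem says about u: its derivatives extend to the boundary,
   those of order at most 2 vanish there, and those of order 3 are c nu_i nu_j nu_k. *)
Record jet O u c := Jet {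
  jet_dom : odom O;
  jet_d : forall s i x, (size s < 6)%N -> O x ->
    is_derive x (eb i) (dp s u) (dp (i :: s) u x);
  jet_bc : forall s, (size s <= 6)%N -> bc O (dp s u);
  jet_perm : forall s t x, (size s <= 6)%N -> perm_eq s t -> O x -> dp s u x = dp t u x;
  jet_eq : forall x, O x -> \sum_a \sum_b \sum_d dp [:: a; a; b; b; d; d] u x = -1;
  jet_vanish : forall s, (size s <= 2)%N -> vanish O (dp s u);
  jet_bdry : forall x, bdry O x -> exists2 nu : 'I_n -> R, \sum_i nu i ^+ 2 = 1 &
    forall i j k, tends O x (dp [:: i; j; k] u) (c * nu i * nu j * nu k)
}.

(** Symmetry exchanges the roles of [la] and [nu], so contracting with [nu] shows that [la] is
    parallel to [nu]. It is applied when the gradients of the lower derivatives are already known to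
    be normal. *)
Lemma rank_one (nu : 'I_n -> R) (A : 'I_n -> 'I_n -> R) (la : 'I_n -> R) :
  \sum_i nu i ^+ 2 = 1 ->
  (forall i j, A i j = la i * nu j) -> (forall i j, A i j = A j i) ->
  forall i, la i = (\sum_j la j * nu j) * nu i.
Proof.
move=> nu1 Al As i; rewrite -[LHS]mulr1 -nu1 mulr_sumr mulr_suml.
apply: eq_bigr => j _; rewrite expr2 mulrA -Al As Al; ring.
Qed.

(** Ascent in the order of differentiation. Once a derivative vanishes on the boundary, its gradient
    is normal there; with the symmetry of mixed derivatives and [rank_one] only one scalar remains
    unknown. It is the normal derivative of [u] at order one, the limit of [lap u] at order two and
    that of the normal derivative of [lap u] at order three. *)
Lemma make_jet O nu u c : (0 < n)%N -> bounded_domain O ->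
  outward_unit_normal O nu -> Ck_closure 6 O u ->
  (forall x, O x -> lap (lap (lap u)) x = -1) ->
  (forall x, bdry O x -> u x = 0) ->
  (forall x, bdry O x ->
     (fun y => edot (grad u y) (nu x)) @ within O (nbhs x) --> 0) ->
  (forall x, bdry O x -> lap u @ within O (nbhs x) --> 0) ->
  (forall x, bdry O x ->
     (fun y => edot (grad (lap u) y) (nu x)) @ within O (nbhs x) --> c) ->
  jet O u c.
Proof.
move=> n0 [_ [oO [_ [M hM]]]] hnu [Cu [cu ext]] eq6 u0 un0 lu0 lun.
have bO : bset O.
  exists `|M| => // x /hM h; apply: (le_trans (norm_le_enorm x)); apply: (le_trans h).
  exact: ler_norm.
have dO : odom O by [].
have Dd s i x : (size s < 6)%N -> O x -> is_derive x (eb i) (pd s u) (pd (i :: s) u x).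
  exact: Ck_derive.
have Dc s x : (size s <= 6)%N -> O x -> {for x, continuous (pd s u)} by exact: Ck_cont.
have Dbc s : (size s <= 6)%N -> bc O (pd s u).
  move=> s6; split; first by move=> x; exact: Dc.
  by have [g [cg hg]] := ext s s6; exact: within_closure_bc cg hg.
have Dp s t x : (size s <= 6)%N -> perm_eq s t -> O x -> pd s u x = pd t u x.
  by move=> s6 st Ox; exact: (pd_perm oO Cu).
have lap1 s x : (size s <= 4)%N -> O x -> pd s (lap u) x = \sum_a pd (s ++ [:: a; a]) u x.
  by move=> s4 Ox; apply: (pd_lap oO Cu) => //; rewrite addn2 ltnS ltnS.
have lap2 s x : (size s <= 2)%N -> O x ->
    pd s (lap (lap u)) x = \sum_a \sum_b pd (s ++ [:: a; a; b; b]) u x.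
  elim: s x => [|i s IH] x s2 Ox.
    by apply: eq_bigr => a _; rewrite lap1.
  rewrite /= (derive_eq_on (g := fun y => \sum_a \sum_b pd (s ++ [:: a; a; b; b]) u y) i oO _ Ox).
    have H : is_derive x (eb i) (fun y => \sum_a \sum_b pd (s ++ [:: a; a; b; b]) u y)
      (\sum_a \sum_b pd (i :: s ++ [:: a; a; b; b]) u x).
      apply: isd_sum => a; apply: isd_sum => b; apply: Dd => //.
      by rewrite size_cat/= addn4.
    by have [_ ->] := H.
  by move=> y Oy; apply: IH => //; exact: ltnW.
have D6 x : O x -> \sum_a \sum_b \sum_d pd [:: a; a; b; b; d; d] u x = -1.
  by move=> Ox; rewrite -(eq6 x Ox) /lap; apply: eq_bigr => a _; rewrite lap2.
have clO x : bdry O x -> closure O x by case.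
have Dlim s x : (size s <= 6)%N -> bdry O x -> exists l, tends O x (pd s u) l.
  move=> s6 bx; have [g [cg hg]] := ext s s6; exists (g x).
  by apply: within_closure_tends => //; exact: clO.
have v0 : vanish O (pd [::] u).
  move=> x bx; have := @within_closure_tends O u u x cu (fun _ _ => erefl) (clO x bx).
  by rewrite /tends u0.
have normal x (bx : bdry O x) := bdry_normal oO hnu bx.
have prop s x (l : R) (L : 'I_n -> R) : (size s <= 5)%N -> vanish O (pd s u) -> bdry O x ->
    (forall i, tends O x (pd (i :: s) u) (L i)) ->
    forall i, L i = (\sum_j L j * nu x ord0 j) * nu x ord0 i.
  move=> s5 vs bx hL; have [_ /(_ (pd s u) (fun i => pd (i :: s) u) L)] := normal x bx.
  apply => //.
  - by move=> y Oy i; exact: Dd.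
  - by move=> y Oy i; exact: Dc.
  - by move=> y Oy; apply: Dc => //; exact: ltnW.
have v1 i : vanish O (pd [:: i] u).
  move=> x bx.
  pose L j := xget 0 [set l | tends O x (pd [:: j] u) l].
  have hL j : tends O x (pd [:: j] u) (L j).
    by rewrite /L; case: xgetP => [l ->//|h]; have [l /h] := Dlim [:: j] x erefl bx.
  have := @prop [::] x 0 L erefl v0 bx hL.
  have -> : \sum_j L j * nu x ord0 j = 0.
    apply: (tends_uniq (clO x bx) _ (un0 x bx)).
    apply: (@tends_eq _ _ O x (fun y => \sum_j pd [:: j] u y * nu x ord0 j)).
      by move=> y Oy; apply: eq_bigr => j _; rewrite mxE.
    by apply: tends_sum => j; apply: tendsM; [exact: hL|exact: tends_cst].
  by move=> /(_ i) h; move: (hL i); rewrite h mul0r.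
have v2 i j : vanish O (pd [:: i; j] u).
  move=> x bx; have [nu1 _] := normal x bx.
  pose L i j := xget 0 [set l | tends O x (pd [:: i; j] u) l].
  have hL a b : tends O x (pd [:: a; b] u) (L a b).
    by rewrite /L; case: xgetP => [l ->//|h]; have [l /h] := Dlim [:: a; b] x erefl bx.
  pose la b := \sum_a L a b * nu x ord0 a.
  have h1 b a : L a b = la b * nu x ord0 a by exact: (@prop [:: b] x 0 (L^~ b) erefl (v1 b) bx (fun a => hL a b)).
  have Ls a b : L a b = L b a.
    apply: (tends_uniq (clO x bx) (hL a b)).
    apply: (tends_eq _ (hL b a)) => y Oy; apply: Dp => //.
    by rewrite (perm_catC [:: b] [:: a]).
  have h2 := rank_one nu1 (fun a b => h1 a b) (fun a b => Ls b a).
  set m := \sum_j _ in h2.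
  suff m0 : m = 0 by move: (hL i j); rewrite h1 h2 m0 !mul0r.
  apply: (tends_uniq (clO x bx) _ (lu0 x bx)).
  have -> : m = \sum_a L a a.
    rewrite /m; apply: eq_bigr => a _; rewrite h1//.
  by apply: tends_sum => a; exact: hL.
have b3 x : bdry O x -> forall i j k, tends O x (pd [:: i; j; k] u)
    (c * nu x ord0 i * nu x ord0 j * nu x ord0 k).
  move=> bx; have [nu1 _] := normal x bx.
  pose L i j k := xget 0 [set l | tends O x (pd [:: i; j; k] u) l].
  have hL a b d : tends O x (pd [:: a; b; d] u) (L a b d).
    by rewrite /L; case: xgetP => [l ->//|h]; have [l /h] := Dlim [:: a; b; d] x erefl bx.
  pose la b d := \sum_a L a b d * nu x ord0 a.
  have h1 b d a : L a b d = la b d * nu x ord0 a.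
    exact: (@prop [:: b; d] x 0 (fun a => L a b d) erefl (v2 b d) bx (fun a => hL a b d)).
  have Ls1 a b d : L a b d = L b a d.
    apply: (tends_uniq (clO x bx) (hL a b d)).
    apply: (tends_eq _ (hL b a d)) => y Oy; apply: Dp => //.
    by rewrite -[[:: b; a; d]]/([:: b; a] ++ [:: d]) -[[:: a; b; d]]/([:: a; b] ++ [:: d]) perm_cat2r (perm_catC [:: b] [:: a]).
  have Ls2 a b d : L a b d = L a d b.
    apply: (tends_uniq (clO x bx) (hL a b d)).
    apply: (tends_eq _ (hL a d b)) => y Oy; apply: Dp => //.
    by rewrite perm_cons (perm_catC [:: d] [:: b]).
  pose ka d := \sum_j la j d * nu x ord0 j.
  have h2 d b : la b d = ka d * nu x ord0 b.
    exact: (rank_one nu1 (fun b a => h1 b d a) (fun a b => Ls1 b a d)).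
  have las b d : la b d = la d b by apply: eq_bigr => a _; rewrite Ls2.
  have h3 := rank_one nu1 (fun d b => h2 d b) (fun d b => las b d).
  set m := \sum_j _ in h3.
  suff mc : m = c.
    move=> i j k; have := hL i j k; rewrite h1 h2 h3 mc; congr tends; ring.
  apply: (tends_uniq (clO x bx) _ (lun x bx)).
  have -> : m = \sum_i (\sum_a L i a a) * nu x ord0 i.
    rewrite (eq_bigr (fun i => (\sum_a la a a) * nu x ord0 i ^+ 2)).
      rewrite -mulr_sumr nu1 mulr1; apply: eq_bigr => a _; rewrite h2//.
    move=> i _; rewrite expr2 mulrA; congr (_ * _); rewrite mulr_suml.
    by apply: eq_bigr => a _; exact: h1.
  apply: (@tends_eq _ _ O x (fun y => \sum_i (\sum_a pd [:: i; a; a] u y) * nu x ord0 i)).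
    by move=> y Oy; apply: eq_bigr => i _; rewrite mxE lap1.
  by apply: tends_sum => i; apply: tendsM; [apply: tends_sum => a; exact: hL|exact: tends_cst].
split => //; rewrite ?dpE //.
- by move=> [|i [|j [|k s]]] //.
- by move=> x bx; exists (fun i => nu x ord0 i); [case: (normal x bx)|exact: b3].
Qed.

End Jets.

(** * The Pohozaev identity *)

Section Parts.
Variables (R : realType) (n : nat).
Notation V := 'rV[R]_n.
Notation eb := (ebasis R).
Implicit Types (F G f g u : V -> R) (O : set V) (x y v : V) (i j k : 'I_n) (l c : R).

Lemma bc_coord O i : bset O -> bc O (fun x => x ord0 i).
Proof.
move=> [B B0 OB]; split; first by move=> x _; exact: coord_continuous.
by exists B => // x Ox; apply: (le_trans (coord_norm_le x i)); exact: OB.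
Qed.

Lemma vanishM O F G : vanish O F -> bc O G -> vanish O (fun x => F x * G x).
Proof.
move=> vF [_ [M M0 GM]] x bx; apply/vanishP => e e0.
have M1 : 0 < M + 1 by lra.
have /vanishP h := vF x bx.
apply: filterS (h (e / (M + 1)) _) => [y hy Oy|]; last exact: divr_gt0.
rewrite normrM; apply: (@le_trans _ _ (e / (M + 1) * (M + 1))); last by rewrite divfK ?gt_eqF.
by apply: ler_pM => //; [exact: hy|have := GM y Oy; lra].
Qed.

Lemma ibp O k F G F' G' : odom O ->
  (forall x, O x -> is_derive x (eb k) F (F' x)) ->
  (forall x, O x -> is_derive x (eb k) G (G' x)) ->
  bc O F -> bc O F' -> bc O G -> bc O G' -> vanish O F ->
  IO O (fun x => F' x * G x) + IO O (fun x => F x * G' x) = 0.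
Proof.
move=> dO dF dG bF bF' bG bG' vF.
have bFG' : bc O (fun x => F x * G' x) by exact: bcM.
have bF'G : bc O (fun x => F' x * G x) by exact: bcM.
rewrite -IO_D//.
apply: (@derive_zero_int R n O k (fun x => F x * G x)) => //.
- by move=> x Ox; apply: isdM; [exact: dF|exact: dG].
- by case: (bcM bF bG).
- exact: vanishM.
- by case: (bcD bF'G bFG').
Qed.

Section JetIntegrals.
Variables (O : set V) (u : V -> R) (c : R).
Hypothesis J : jet O u c.
Let dO : odom O := jet_dom J.
Let bO : bset O. Proof. by case: dO. Qed.
Notation D s := (dp s u).

(* In the names below, S3_pq and pr_pq pair a derivative of order p with one of order q
   (v for a Laplacian); integration by parts reduces all of them to Eu, the integral of u. *)
Definition pr s t := IO O (fun x => D s x * D t x).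
Definition px i s t := IO O (fun x => x ord0 i * (D s x * D t x)).

(** The derivative is taken off the factor of order at most two after the move, which vanishes on
    the boundary; this is the reason for the bound on [s]. *)
Lemma pr_ibp k s t : (size s <= 2)%N -> (size t <= 5)%N ->
  pr (k :: s) t = - pr s (k :: t).
Proof.
move=> s2 t5; apply/eqP; rewrite -addr_eq0; apply/eqP; apply: (ibp (k := k)) => //.
- by move=> x Ox; apply: (jet_d J) => //; apply: leq_ltn_trans s2 _.
- by move=> x Ox; exact: (jet_d J).
- by apply: (jet_bc J); apply: leq_trans s2 _.
- by apply: (jet_bc J); rewrite /=; apply: leq_trans s2 _.
- by apply: (jet_bc J); exact: ltnW.
- exact: (jet_bc J).
- exact: (jet_vanish J).
Qed.

Lemma pr_perm s t s' t' : (size s <= 6)%N -> (size t <= 6)%N ->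
  perm_eq s s' -> perm_eq t t' -> pr s t = pr s' t'.
Proof.
move=> s6 t6 ss tt; apply: IO_eq => x Ox.
by rewrite (jet_perm J s6 ss Ox) (jet_perm J t6 tt Ox).
Qed.

Lemma px_perm i s t s' t' : (size s <= 6)%N -> (size t <= 6)%N ->
  perm_eq s s' -> perm_eq t t' -> px i s t = px i s' t'.
Proof.
move=> s6 t6 ss tt; apply: IO_eq => x Ox.
by rewrite (jet_perm J s6 ss Ox) (jet_perm J t6 tt Ox).
Qed.

Lemma px_ibp i k s t : (size s <= 2)%N -> (size t <= 5)%N ->
  px i (k :: s) t = - ((k == i)%:R * pr s t) - px i s (k :: t).
Proof.
move=> s2 t5.
have b1 m : (m <= 6)%N -> forall s, size s = m -> bc O (D s).
  by move=> m6 s' E; apply: (jet_bc J); rewrite E.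
have bs : bc O (D s) by apply: (jet_bc J); apply: leq_trans s2 _.
have bks : bc O (D (k :: s)) by apply: (jet_bc J); rewrite /=; apply: leq_trans s2 _.
have bt : bc O (D t) by apply: (jet_bc J); exact: ltnW.
have bkt : bc O (D (k :: t)) by exact: (jet_bc J).
have bi := bc_coord i bO.
have H : IO O (fun x => D (k :: s) x * (x ord0 i * D t x)) +
    IO O (fun x => D s x * ((k == i)%:R * D t x + x ord0 i * D (k :: t) x)) = 0.
  apply: (ibp (k := k)) => //.
  - by move=> x Ox; apply: (jet_d J) => //; apply: leq_ltn_trans s2 _.
  - by move=> x Ox; apply: isdM; [exact: isd_coord|exact: (jet_d J)].
  - exact: bcM.
  - by apply: bcD; [exact: bcZ|exact: bcM].
  - exact: (jet_vanish J).
have -> : px i (k :: s) t = IO O (fun x => D (k :: s) x * (x ord0 i * D t x)).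
  by apply: IO_eq => x _; rewrite mulrCA.
rewrite -opprD.
have -> : (k == i)%:R * pr s t + px i s (k :: t) =
    IO O (fun x => D s x * ((k == i)%:R * D t x + x ord0 i * D (k :: t) x)).
  have b2 : bc O (fun x => D s x * D t x) by exact: bcM.
  rewrite /pr -IO_Z// /px -IO_D//; [|exact: bcZ|by apply: bcM => //; exact: bcM].
  by apply: IO_eq => x _; ring.
by move/eqP: H; rewrite addr_eq0 => /eqP ->.
Qed.

Definition S3 (F : 'I_n -> 'I_n -> 'I_n -> R) := \sum_a \sum_b \sum_d F a b d.

Lemma eq_S3 (F G : 'I_n -> 'I_n -> 'I_n -> R) : (forall a b d, F a b d = G a b d) -> S3 F = S3 G.
Proof. by move=> FG; do 3 (apply: eq_bigr => ? _). Qed.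

Lemma S3N (F : 'I_n -> 'I_n -> 'I_n -> R) : S3 (fun a b d => - F a b d) = - S3 F.
Proof. by rewrite /S3 -sumrN; apply: eq_bigr => a _; rewrite -sumrN; apply: eq_bigr => b _; rewrite sumrN. Qed.

Lemma S3D (F G : 'I_n -> 'I_n -> 'I_n -> R) : S3 (fun a b d => F a b d + G a b d) = S3 F + S3 G.
Proof.
by rewrite /S3 -big_split; apply: eq_bigr => a _; rewrite -big_split; apply: eq_bigr => b _; rewrite big_split.
Qed.

Definition Eu := IO O (D [::]).

Lemma IO_S3 (F : 'I_n -> 'I_n -> 'I_n -> V -> R) :
  (forall a b d, bc O (F a b d)) ->
  IO O (fun x => S3 (fun a b d => F a b d x)) = S3 (fun a b d => IO O (F a b d)).
Proof.
move=> bF; rewrite /S3 IO_sum//; last by move=> a; do 2 (apply: bc_sum => ?).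
apply: eq_bigr => a _; rewrite IO_sum//; last by move=> b; apply: bc_sum.
by apply: eq_bigr => b _; rewrite IO_sum.
Qed.

Lemma S3_eq6 x : O x -> S3 (fun a b d => D [:: a; a; b; b; d; d] x) = -1.
Proof. exact: (jet_eq J). Qed.

Lemma S3mulr (F : 'I_n -> 'I_n -> 'I_n -> R) (a : R) : S3 F * a = S3 (fun b d e => F b d e * a).
Proof.
by rewrite /S3 mulr_suml; apply: eq_bigr => b _; rewrite mulr_suml; apply: eq_bigr => d _; rewrite mulr_suml.
Qed.

Lemma pr0_sum : S3 (fun a b d => pr [::] [:: a; a; b; b; d; d]) = - Eu.
Proof.
rewrite -IO_S3; last by move=> a b d; apply: bcM; exact: (jet_bc J).
rewrite /Eu -IO_N//; last exact: (jet_bc J).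
apply: IO_eq => x Ox; rewrite -[RHS]mulN1r -(S3_eq6 Ox) S3mulr.
by apply: eq_S3 => a b d; rewrite mulrC.
Qed.



Lemma pr_333 a b d : pr [:: a; b; d] [:: a; b; d] = - pr [::] [:: a; a; b; b; d; d].
Proof.
rewrite !pr_ibp//= opprK; congr (- _); apply: pr_perm => //; apply/permP => p /=; lia.
Qed.

Lemma pr_24 a b d : pr [:: a; b] [:: a; b; d; d] = pr [::] [:: a; a; b; b; d; d].
Proof.
rewrite !pr_ibp//= opprK; apply: pr_perm => //; apply/permP => p /=; lia.
Qed.

Lemma pr_15 a b d : pr [:: a] [:: a; b; b; d; d] = - pr [::] [:: a; a; b; b; d; d].
Proof. by rewrite pr_ibp. Qed.

Lemma pr_v4 a b d : pr [:: a; a] [:: b; b; d; d] = pr [::] [:: a; a; b; b; d; d].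
Proof. by rewrite !pr_ibp//= opprK. Qed.

Lemma pr_v33 a b d : pr [:: a; b; b] [:: a; d; d] = - pr [::] [:: a; a; b; b; d; d].
Proof.
rewrite !pr_ibp//= opprK; congr (- _); apply: pr_perm => //; apply/permP => p /=; lia.
Qed.

Lemma S3_333 : S3 (fun a b d => pr [:: a; b; d] [:: a; b; d]) = Eu.
Proof. by rewrite (eq_S3 (G := fun a b d => - pr [::] [:: a; a; b; b; d; d]) pr_333) S3N pr0_sum opprK. Qed.

Lemma S3_24 : S3 (fun a b d => pr [:: a; b] [:: a; b; d; d]) = - Eu.
Proof. by rewrite (eq_S3 (G := fun a b d => pr [::] [:: a; a; b; b; d; d]) pr_24) pr0_sum. Qed.

Lemma S3_15 : S3 (fun a b d => pr [:: a] [:: a; b; b; d; d]) = Eu.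
Proof. by rewrite (eq_S3 (G := fun a b d => - pr [::] [:: a; a; b; b; d; d]) pr_15) S3N pr0_sum opprK. Qed.

Lemma S3_v4 : S3 (fun a b d => pr [:: a; a] [:: b; b; d; d]) = - Eu.
Proof. by rewrite (eq_S3 (G := fun a b d => pr [::] [:: a; a; b; b; d; d]) pr_v4) pr0_sum. Qed.

Lemma S3_v33 : S3 (fun a b d => pr [:: a; b; b] [:: a; d; d]) = Eu.
Proof. by rewrite (eq_S3 (G := fun a b d => - pr [::] [:: a; a; b; b; d; d]) pr_v33) S3N pr0_sum opprK. Qed.

Lemma sum_delta (X : 'I_n -> R) (d : 'I_n) : \sum_i (d == i)%:R * X i = X d.
Proof.
rewrite (bigD1 d)//= eqxx mul1r big1 ?addr0// => i /negbTE id_.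
by rewrite eq_sym id_ mul0r.
Qed.

Lemma sum_S3 (F : 'I_n -> 'I_n -> 'I_n -> 'I_n -> R) :
  \sum_i S3 (F i) = S3 (fun a b d => \sum_i F i a b d).
Proof.
rewrite /S3 exchange_big/=; apply: eq_bigr => a _.
by rewrite exchange_big/=; apply: eq_bigr => b _; rewrite exchange_big.
Qed.

Definition vol := IO O (fun=> 1).

Lemma coord_int i : IO O (fun x => x ord0 i * D [:: i] x) = - Eu.
Proof.
apply/eqP; rewrite -addr_eq0; apply/eqP.
have := @ibp O i (D [::]) (fun x => x ord0 i) (D [:: i]) (fun=> 1) dO.
move=> H; rewrite -[RHS]H.
- by congr (_ + _); apply: IO_eq => x _; rewrite ?mulr1// mulrC.
- by move=> x Ox; exact: (jet_d J).
- by move=> x Ox; have := isd_coord x i i; rewrite eqxx.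
- exact: (jet_bc J).
- exact: (jet_bc J).
- exact: bc_coord.
- exact: bc_cst.
- exact: (jet_vanish J).
Qed.

(** Start of a chain ending with [moment_sum0], the integral of [D^3 u] against its derivative along
    the position vector. Here [lap^3 u = -1] reduces the sum to integrals of [x_i u_i]; each later
    link moves one derivative, and differentiating the coordinate gives a multiple of [Eu]. *)
Lemma moment_sum4 : \sum_i S3 (fun a b d => px i [:: i] [:: a; a; b; b; d; d]) = n%:R * Eu.
Proof.
rewrite (eq_bigr (fun=> Eu)); first by rewrite sumr_const card_ord mulr_natl.
move=> i _; rewrite /px -IO_S3; last first.
  move=> a b d; apply: bcM; first exact: bc_coord.
  by apply: bcM; exact: (jet_bc J).
rewrite -[RHS]opprK -(coord_int i) -IO_N//; last first.
  by apply: bcM; [exact: bc_coord|exact: (jet_bc J)].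
apply: IO_eq => x Ox; rewrite -[RHS]mulN1r -(S3_eq6 Ox) S3mulr.
by apply: eq_S3 => a b d; ring.
Qed.

Lemma sum_deltaS3 (X : 'I_n -> 'I_n -> 'I_n -> 'I_n -> R) (sel : 'I_n -> 'I_n -> 'I_n -> 'I_n) :
  \sum_i S3 (fun a b d => (sel a b d == i)%:R * X i a b d) =
  S3 (fun a b d => X (sel a b d) a b d).
Proof.
rewrite sum_S3; apply: eq_S3 => a b d.
exact: (sum_delta (fun i => X i a b d)).
Qed.

Lemma moment_sum3 : \sum_i S3 (fun a b d => px i [:: i; a] [:: a; b; b; d; d]) = - (n%:R + 1) * Eu.
Proof.
transitivity (\sum_i (- S3 (fun a b d => (a == i)%:R * pr [:: i] [:: a; b; b; d; d])
    - S3 (fun a b d => px i [:: i] [:: a; a; b; b; d; d]))).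
  apply: eq_bigr => i _; rewrite -!S3N -S3D; apply: eq_S3 => a b d.
  by rewrite -px_ibp//; apply: px_perm => //; apply/permP => p /=; lia.
rewrite big_split/= !sumrN moment_sum4 (sum_deltaS3 (fun i a b d => pr [:: i] [:: a; b; b; d; d]) (fun a _ _ => a)).
by rewrite S3_15; ring.
Qed.

(** In this link the derivative in the direction [i] of the coordinate is the one that moves, so the
    extra term comes from every [i], which produces [n] copies of [Eu]. *)
Lemma moment_sum2 : \sum_i S3 (fun a b d => px i [:: a] [:: i; a; b; b; d; d]) = Eu.
Proof.
have : \sum_i S3 (fun a b d => px i [:: i; a] [:: a; b; b; d; d]) =
  \sum_i (- S3 (fun a b d => pr [:: a] [:: a; b; b; d; d])
    - S3 (fun a b d => px i [:: a] [:: i; a; b; b; d; d])).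
  apply: eq_bigr => i _; rewrite -!S3N -S3D; apply: eq_S3 => a b d.
  by rewrite (@px_ibp i i [:: a] [:: a; b; b; d; d])// eqxx mul1r.
rewrite moment_sum3 big_split/= !sumrN S3_15 sumr_const card_ord -mulr_natl.
by move=> h; lra.
Qed.

Lemma moment_sum1 : \sum_i S3 (fun a b d => px i [:: a; b] [:: i; a; b; d; d]) = - 2 * Eu.
Proof.
transitivity (\sum_i (- S3 (fun a b d => (b == i)%:R * pr [:: a] [:: i; a; b; d; d])
    - S3 (fun a b d => px i [:: a] [:: i; a; b; b; d; d]))).
  apply: eq_bigr => i _; rewrite -!S3N -S3D; apply: eq_S3 => a b d.
  rewrite (@px_perm i [:: a] [:: i; a; b; b; d; d] [:: a] [:: b; i; a; b; d; d])//; last first.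
    by apply/permP => p /=; lia.
  by rewrite -px_ibp//; apply: px_perm => //; apply/permP => p /=; lia.
rewrite big_split/= !sumrN moment_sum2 (sum_deltaS3 (fun i a b d => pr [:: a] [:: i; a; b; d; d]) (fun _ b _ => b)).
rewrite (eq_S3 (G := fun a b d => pr [:: a] [:: a; b; b; d; d])) ?S3_15; first by ring.
by move=> a b d; apply: pr_perm => //; apply/permP => p /=; lia.
Qed.

Lemma moment_sum0 : \sum_i S3 (fun a b d => px i [:: a; b; d] [:: i; a; b; d]) = 3 * Eu.
Proof.
transitivity (\sum_i (- S3 (fun a b d => (d == i)%:R * pr [:: a; b] [:: i; a; b; d])
    - S3 (fun a b d => px i [:: a; b] [:: i; a; b; d; d]))).
  apply: eq_bigr => i _; rewrite -!S3N -S3D; apply: eq_S3 => a b d.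
  rewrite (@px_perm i [:: a; b] [:: i; a; b; d; d] [:: a; b] [:: d; i; a; b; d])//; last first.
    by apply/permP => p /=; lia.
  by rewrite -px_ibp//; apply: px_perm => //; apply/permP => p /=; lia.
rewrite big_split/= !sumrN moment_sum1 (sum_deltaS3 (fun i a b d => pr [:: a; b] [:: i; a; b; d]) (fun _ _ d => d)).
rewrite (eq_S3 (G := fun a b d => pr [:: a; b] [:: a; b; d; d])) ?S3_24; first by ring.
by move=> a b d; apply: pr_perm => //; apply/permP => p /=; lia.
Qed.

Definition Q3 x := S3 (fun a b d => D [:: a; b; d] x ^+ 2).

Lemma tends_S3 x (F : 'I_n -> 'I_n -> 'I_n -> V -> R) (L : 'I_n -> 'I_n -> 'I_n -> R) :
  (forall a b d, tends O x (F a b d) (L a b d)) ->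
  tends O x (fun y => S3 (fun a b d => F a b d y)) (S3 L).
Proof.
by move=> h; apply: tends_sum => a; apply: tends_sum => b; apply: tends_sum => d.
Qed.

Lemma Q3_tends x : bdry O x -> tends O x Q3 (c ^+ 2).
Proof.
move=> bx; have [nu nu1 h] := jet_bdry J bx.
have -> : c ^+ 2 = S3 (fun a b d => (c * nu a * nu b * nu d) * (c * nu a * nu b * nu d)).
  rewrite /S3 -[LHS]mulr1 -nu1 mulr_sumr; apply: eq_bigr => a _.
  rewrite -[LHS]mulr1 -[in X in _ * X]nu1 mulr_sumr; apply: eq_bigr => b _.
  rewrite -[LHS]mulr1 -[in X in _ * X]nu1 mulr_sumr; apply: eq_bigr => d _.
  ring.
apply: (@tends_eq _ _ O x (fun y => S3 (fun a b d => D [:: a; b; d] y * D [:: a; b; d] y))).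
  by move=> y _; apply: eq_S3 => a b d; rewrite expr2.
by apply: tends_S3 => a b d; apply: tendsM; exact: h.
Qed.

Lemma isd_S3 x k (F : 'I_n -> 'I_n -> 'I_n -> V -> R) (L : 'I_n -> 'I_n -> 'I_n -> R) :
  (forall a b d, is_derive x (eb k) (F a b d) (L a b d)) ->
  is_derive x (eb k) (fun y => S3 (fun a b d => F a b d y)) (S3 L).
Proof.
by move=> h; apply: isd_sum => a; apply: isd_sum => b; apply: isd_sum => d.
Qed.

Lemma bc_S3 (F : 'I_n -> 'I_n -> 'I_n -> V -> R) :
  (forall a b d, bc O (F a b d)) -> bc O (fun y => S3 (fun a b d => F a b d y)).
Proof. by move=> h; do 3 (apply: bc_sum => ?). Qed.

Lemma S3Z (a : R) (F : 'I_n -> 'I_n -> 'I_n -> R) : S3 (fun b d e => a * F b d e) = a * S3 F.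
Proof. by rewrite mulrC S3mulr; apply: eq_S3 => b d e; rewrite mulrC. Qed.

Lemma IO_Q3 : IO O Q3 = Eu.
Proof.
rewrite -S3_333 /pr -IO_S3; last by move=> a b d; apply: bcM; exact: (jet_bc J).
by apply: IO_eq => x _; apply: eq_S3 => a b d; rewrite expr2.
Qed.

Lemma bc_Q3 : bc O Q3.
Proof.
apply: bc_S3 => a b d; under [X in bc _ X]eq_fun do rewrite expr2.
by apply: bcM; exact: (jet_bc J).
Qed.

(* The sum of the divergences of the fields x_i (|D^3 u|^2 - c^2), x_i u_ijkl u_jk, ...,
   which move three derivatives from one factor to the other. *)
Lemma pohozaev : (n%:R + 6) * Eu = n%:R * c ^+ 2 * vol.
Proof.
(* [|D^3 u|^2] tends to [c ^+ 2] at the boundary; subtracting this constant makes the factor vanish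
   there, so that it can be integrated by parts against the coordinate [i]. *)
have H i : 2 * S3 (fun a b d => px i [:: a; b; d] [:: i; a; b; d]) + (Eu - c ^+ 2 * vol) = 0.
  pose F' x := S3 (fun a b d => 2 * (D [:: a; b; d] x * D [:: i; a; b; d] x)).
  have bF' : bc O F'.
    by apply: bc_S3 => a b d; apply: bcZ; apply: bcM; exact: (jet_bc J).
  have bQ := bc_Q3.
  have := @ibp O i (fun x => Q3 x - c ^+ 2) (fun x => x ord0 i) F' (fun=> 1) dO.
  move=> HH.
  have -> : Eu - c ^+ 2 * vol = IO O (fun x => (Q3 x - c ^+ 2) * 1).
    rewrite -IO_Q3 /vol -IO_Z//; last exact: bc_cst.
    rewrite -IO_B//; last by apply: bcZ; exact: bc_cst.
    by apply: IO_eq => x _; rewrite !mulr1.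
  have -> : 2 * S3 (fun a b d => px i [:: a; b; d] [:: i; a; b; d]) =
      IO O (fun x => F' x * x ord0 i).
    rewrite -S3Z.
    rewrite (eq_S3 (G := fun a b d => IO O (fun x => 2 * (x ord0 i * (D [:: a; b; d] x * D [:: i; a; b; d] x))))); last first.
      move=> a b d; rewrite IO_Z//.
      by apply: bcM; [exact: bc_coord|apply: bcM; exact: (jet_bc J)].
    rewrite -IO_S3; last first.
      move=> a b d; apply: bcZ.
      by apply: bcM; [exact: bc_coord|apply: bcM; exact: (jet_bc J)].
    apply: IO_eq => x _; rewrite /F' S3mulr; apply: eq_S3 => a b d; ring.
  apply: HH.
  - move=> x Ox; suff dQ : is_derive x (eb i) Q3 (F' x).
      by have := isdB dQ (isdC x (eb i) (c ^+ 2)); rewrite subr0.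
    apply: isd_S3 => a b d.
    have H1 := isdM (jet_d J (s := [:: a; b; d]) i isT Ox) (jet_d J (s := [:: a; b; d]) i isT Ox).
    move: H1; under [X in is_derive _ _ X _]eq_fun do rewrite -expr2.
    by congr is_derive; ring.
  - by move=> x Ox; have := isd_coord x i i; rewrite eqxx.
  - by apply: bcB => //; exact: bc_cst.
  - by [].
  - exact: bc_coord.
  - exact: bc_cst.
  - move=> x bx; rewrite -(subrr (c ^+ 2)).
    apply: (tendsD (Q3_tends bx)); exact: tends_cst.
have h : \sum_i (2 * S3 (fun a b d => px i [:: a; b; d] [:: i; a; b; d]) +
    (Eu - c ^+ 2 * vol)) = 0 by apply: big1 => i _; exact: H.
move: h; rewrite big_split/= -mulr_sumr moment_sum0 sumr_const card_ord -mulr_natl => h.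
by apply/eqP; rewrite -subr_eq0; apply/eqP; rewrite -[RHS]h; ring.
Qed.

End JetIntegrals.
End Parts.

(** * The P-function and its weak Laplacian *)

Section Weak.
Variables (R : realType) (n : nat).
Notation V := 'rV[R]_n.
Notation eb := (ebasis R).
Implicit Types (F G f g u : V -> R) (O : set V) (x y v : V) (i j k : 'I_n) (l c : R).

Lemma IO_dct O (F : nat -> V -> R) G (M : R) : odom O -> 0 <= M ->
  (forall m x, O x -> {for x, continuous (F m)} /\ `|F m x| <= M) ->
  (forall x, O x -> F ^~ x @ \oo --> G x) ->
  (fun m => IO O (F m)) @ \oo --> IO O G.
Proof.
move=> [n0 oO [B B0 OB]] M0 hF FG.
rewrite IOE (_ : (fun m => IO O (F m)) = (fun m => Int (fun x => \1_O x * F m x))); last first.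
  by apply/funext => m; rewrite IOE.
apply: (@Int_dct R n M B (fun m x => \1_O x * F m x) (fun x => \1_O x * G x) _ _).2.
  by move=> m; apply: gd_ind => // x Ox; case: (hF m x Ox).
move=> x; case: (EM (O x)) => Ox; last first.
  by rewrite ind0// mul0r (_ : (fun _ => _) = fun=> 0); [exact: cvg_cst|apply/funext => m; rewrite mul0r].
rewrite ind1// mul1r (_ : (fun _ => _) = F^~ x); first exact: FG.
by apply/funext => m; rewrite mul1r.
Qed.

Lemma cdist_ball O x y : ~` O !=set0 -> `|x - y| < cdist O x -> O y.
Proof.
move=> nO xy; apply: contrapT => Oy.
have := cdist_lip x y nO; rewrite (cdist_out Oy) add0r.
by rewrite leNgt xy.
Qed.

(** Functions continuous on [O] are bounded on such an [O'], and small translations of [O'] stay in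
    [O]. *)
Definition inner O' O := odom O' /\ closure O' `<=` O.

Lemma inner_sub O' O : inner O' O -> O' `<=` O.
Proof. by move=> [_ h] x Ox; apply: h; exact: subset_closure. Qed.

Lemma inner_gap O' O : odom O -> inner O' O ->
  exists2 h : R, 0 < h & forall x y, O' x -> `|x - y| < h -> O y.
Proof.
move=> [n0 oO bO] [[_ oO' bO'] cO'].
have nO := bset_compl n0 bO.
have [[z Oz]|nz] := EM (O' !=set0); last first.
  by exists 1 => // x y Ox; exfalso; apply: nz; exists x.
have [|||q qc hq] := @EVT_min_rV R n (cdist O) (closure O').
- by exists z; exact: subset_closure.
- exact: compact_closure.
- by apply: continuous_subspaceT; exact: cdist_continuous.
exists (cdist O q); first by apply: cdist_in => //; apply: cO'; rewrite inE in qc.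
move=> x y Ox xy; apply: (cdist_ball nO (x := x)).
by apply: (lt_le_trans xy); apply: hq; rewrite inE; exact: subset_closure.
Qed.

Section WeakJet.
Variables (O : set V) (u : V -> R) (c : R).
Hypothesis J : jet O u c.
Let dO : odom O := jet_dom J.
Notation D s := (dp s u).

Definition test O' (z : V -> R) (z' : 'I_n -> V -> R) :=
  [/\ forall x k, O' x -> is_derive x (eb k) z (z' k x),
      bc O' z, forall k, bc O' (z' k) & vanish O' z].

(* p has gradient p' and distributional Laplacian lp; only test functions on inner
   subdomains are used, where all data are continuous up to the boundary. *)
Definition weak_lap (p : V -> R) (p' : 'I_n -> V -> R) (lp : V -> R) :=
  [/\ forall k x, O x -> is_derive x (eb k) p (p' k x),
      bc O p, forall k, bc O (p' k), bc O lp &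
      forall O' z z', inner O' O -> test O' z z' ->
        \sum_k IO O' (fun x => z' k x * p' k x) = - IO O' (fun x => z x * lp x)].

Lemma weak_lapZ (a : R) p p' lp : weak_lap p p' lp ->
  weak_lap (fun x => a * p x) (fun k x => a * p' k x) (fun x => a * lp x).
Proof.
move=> [h1 h2 h3 h4 h5]; split.
- by move=> k x Ox; apply: isdZ; exact: h1.
- exact: bcZ.
- by move=> k; exact: bcZ.
- exact: bcZ.
move=> O' z z' iO tz; have := h5 O' z z' iO tz; case: tz => [t1 t2 t3 t4].
have sO := inner_sub iO; have [dO' _] := iO => h.
rewrite (eq_bigr (fun k => a * IO O' (fun x => z' k x * p' k x))).
  rewrite -mulr_sumr h mulrN; congr (- _).
  rewrite -IO_Z//; last by apply: bcM => //; exact: bc_sub h4.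
  by apply: IO_eq => x _; rewrite mulrCA.
move=> k _; rewrite -IO_Z//; last by apply: bcM => //; exact: (bc_sub sO (h3 k)).
by apply: IO_eq => x _; rewrite mulrCA.
Qed.

Lemma weak_lapD p p' lp q q' lq : weak_lap p p' lp -> weak_lap q q' lq ->
  weak_lap (fun x => p x + q x) (fun k x => p' k x + q' k x) (fun x => lp x + lq x).
Proof.
move=> [h1 h2 h3 h4 h5] [g1 g2 g3 g4 g5]; split.
- by move=> k x Ox; apply: isdD; [exact: h1|exact: g1].
- exact: bcD.
- by move=> k; exact: bcD.
- exact: bcD.
move=> O' z z' iO tz; have := h5 O' z z' iO tz; have := g5 O' z z' iO tz.
case: tz => [t1 t2 t3 t4].
have sO := inner_sub iO; have [dO' _] := iO => gg hh.
rewrite (eq_bigr (fun k => IO O' (fun x => z' k x * p' k x) + IO O' (fun x => z' k x * q' k x))).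
  rewrite big_split/= gg hh -opprD -IO_D//.
  - by congr (- _); apply: IO_eq => x _; rewrite mulrDr.
  - by apply: bcM => //; exact: bc_sub h4.
  - by apply: bcM => //; exact: bc_sub g4.
move=> k _; rewrite -IO_D//.
- by apply: IO_eq => x _; rewrite mulrDr.
- by apply: bcM => //; exact: (bc_sub sO (h3 k)).
- by apply: bcM => //; exact: (bc_sub sO (g3 k)).
Qed.

Lemma weak_lap0 : weak_lap (fun=> 0) (fun _ _ => 0) (fun=> 0).
Proof.
split; [by move=> k x _; exact: isdC|exact: bc_cst|by move=> k; exact: bc_cst|exact: bc_cst|].
move=> O' z z' _ _; rewrite big1 ?oppr0//.
  rewrite (IO_eq (G := fun=> 0)) ?IO_0 ?oppr0// => x _; rewrite mulr0//.
by move=> k _; rewrite (IO_eq (G := fun=> 0)) ?IO_0// => x _; rewrite mulr0.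
Qed.

Lemma weak_lap_sum (I : Type) (r : seq I) (p : I -> V -> R) p' lp :
  (forall m, weak_lap (p m) (p' m) (lp m)) ->
  weak_lap (fun x => \sum_(m <- r) p m x) (fun k x => \sum_(m <- r) p' m k x)
    (fun x => \sum_(m <- r) lp m x).
Proof.
move=> h; elim: r => [|m r IH].
  have -> : (fun x => \sum_(m <- [::]) p m x) = fun=> 0 by apply/funext => x; rewrite big_nil.
  have -> : (fun k x => \sum_(m <- [::]) p' m k x) = fun _ _ => 0.
    by apply/funext => k; apply/funext => x; rewrite big_nil.
  have -> : (fun x => \sum_(m <- [::]) lp m x) = fun=> 0 by apply/funext => x; rewrite big_nil.
  exact: weak_lap0.
have := weak_lapD (h m) IH.
have -> : (fun x => \sum_(m <- m :: r) p m x) = (fun x => p m x + \sum_(m <- r) p m x).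
  by apply/funext => x; rewrite big_cons.
have -> : (fun k x => \sum_(m <- m :: r) p' m k x) = (fun k x => p' m k x + \sum_(m <- r) p' m k x).
  by apply/funext => k; apply/funext => x; rewrite big_cons.
have -> // : (fun x => \sum_(m <- m :: r) lp m x) = (fun x => lp m x + \sum_(m <- r) lp m x).
by apply/funext => x; rewrite big_cons.
Qed.

Lemma weak_lap_C2 p p' p'' :
  (forall k x, O x -> is_derive x (eb k) p (p' k x)) ->
  (forall k x, O x -> is_derive x (eb k) (p' k) (p'' k x)) ->
  bc O p -> (forall k, bc O (p' k)) -> (forall k, bc O (p'' k)) ->
  weak_lap p p' (fun x => \sum_k p'' k x).
Proof.
move=> dp dp' bp bp' bp''; split => //; first exact: bc_sum.
move=> O' z z' iO [t1 t2 t3 t4].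
have sO := inner_sub iO; have [dO' _] := iO.
have -> : - IO O' (fun x => z x * \sum_k p'' k x) = \sum_k - IO O' (fun x => z x * p'' k x).
  rewrite sumrN; congr (- _); rewrite -IO_sum//.
    by apply: IO_eq => x _; rewrite mulr_sumr.
  by move=> k; apply: bcM => //; exact: (bc_sub sO (bp'' k)).
apply: eq_bigr => k _; apply/eqP; rewrite -addr_eq0; apply/eqP.
apply: (@ibp R n O' k z (p' k) (z' k) (p'' k) dO') => //.
- by move=> x /sO; exact: dp'.
- exact: (bc_sub sO (bp' k)).
- exact: (bc_sub sO (bp'' k)).
Qed.

Lemma weak_lap_prod s t : (size s <= 4)%N -> (size t <= 4)%N ->
  weak_lap (fun x => D s x * D t x) (fun k x => D (k :: s) x * D t x + D s x * D (k :: t) x)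
   (fun x => \sum_k (D [:: k, k & s] x * D t x + 2 * (D (k :: s) x * D (k :: t) x)
      + D s x * D [:: k, k & t] x)).
Proof.
move=> s4 t4.
have bs : bc O (D s) by apply: (jet_bc J); lia.
have bt : bc O (D t) by apply: (jet_bc J); lia.
have bs1 k : bc O (D (k :: s)) by apply: (jet_bc J) => /=; lia.
have bt1 k : bc O (D (k :: t)) by apply: (jet_bc J) => /=; lia.
have bs2 k : bc O (D [:: k, k & s]) by apply: (jet_bc J) => /=; lia.
have bt2 k : bc O (D [:: k, k & t]) by apply: (jet_bc J) => /=; lia.
apply: weak_lap_C2.
- move=> k x Ox; apply: isdM; apply: (jet_d J) => //; lia.
- move=> k x Ox.
  have h1 : is_derive x (eb k) (D s) (D (k :: s) x) by apply: (jet_d J) => //; lia.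
  have h2 : is_derive x (eb k) (D t) (D (k :: t) x) by apply: (jet_d J) => //; lia.
  have h3 : is_derive x (eb k) (D (k :: s)) (D [:: k, k & s] x) by apply: (jet_d J) => //=; lia.
  have h4 : is_derive x (eb k) (D (k :: t)) (D [:: k, k & t] x) by apply: (jet_d J) => //=; lia.
  have := isdD (isdM h3 h2) (isdM h1 h4); congr is_derive; ring.
- exact: bcM.
- by move=> k; apply: bcD; exact: bcM.
- move=> k; apply: bcD; last exact: bcM.
  by apply: bcD; [exact: bcM|apply: bcZ; exact: bcM].
Qed.

(* The derivative of order s of w = lap (lap u). *)
Definition wd (s : seq 'I_n) x := \sum_a \sum_b dp (s ++ [:: a; a; b; b]) u x.

Lemma wd_d (s : seq 'I_n) k x : (size s <= 1)%N -> O x -> is_derive x (eb k) (wd s) (wd (k :: s) x).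
Proof.
move=> s1 Ox; apply: isd_sum => a; apply: isd_sum => b; apply: (jet_d J) => //.
by rewrite size_cat/= addn4.
Qed.

Lemma wd_bc (s : seq 'I_n) : (size s <= 2)%N -> bc O (wd s).
Proof.
by move=> s2; apply: bc_sum => a; apply: bc_sum => b; apply: (jet_bc J); rewrite size_cat/= addn4.
Qed.

Lemma wd_lap x : O x -> \sum_k wd [:: k; k] x = -1.
Proof. by move=> Ox; rewrite -(jet_eq J Ox); do 3 (apply: eq_bigr => ? _). Qed.

Lemma wd_sym i j x : O x -> wd [:: i; j] x = wd [:: j; i] x.
Proof.
move=> Ox; apply: eq_bigr => a _; apply: eq_bigr => b _; apply: (jet_perm J) => //.
by apply/permP => p /=; lia.
Qed.

(* w is only of class C^2, so the third derivatives of w that an integration by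
   parts would produce are replaced by difference quotients in direction a *)
Lemma hess_w_div0 O' z z' a : inner O' O -> test O' z z' ->
  \sum_k IO O' (fun x => z' k x * wd [:: k; a] x) = 0.
Proof.
move=> iO [t1 t2 t3 t4].
have sO := inner_sub iO; have [dO' _] := iO.
have [h0 h00 gap] := inner_gap dO iO.
have inO x h : O' x -> 0 <= h < h0 -> O (x + h *: eb a).
  move=> Ox /andP[h1 h2]; apply: (gap x) => //.
  rewrite opprD addrA subrr add0r normrN; apply: le_lt_trans h2.
  by apply: (le_trans (norm_eb a h)); rewrite ger0_norm.
(* The sum does not depend on [h], because [lap w = -1] at the translated points too. Hence
   difference quotients of the gradient of [w] integrate to 0 against the gradient of [z]. *)
have shift_id h : 0 <= h < h0 ->
    \sum_k IO O' (fun x => z' k x * wd [:: k] (x + h *: eb a)) = IO O' z.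
  move=> hh.
  have bsh s : (size s <= 2)%N -> bc O' (fun x => wd s (x + h *: eb a)).
    move=> s2; have [w1 [M M0 hM]] := wd_bc s2; split.
      move=> x Ox; apply: (@continuous_comp _ _ _ (fun y : V => y + h *: eb a) (wd s)).
        exact: cont_shift.
      by apply: w1; exact: inO.
    by exists M => // x Ox; apply: hM; exact: inO.
  have -> : IO O' z = - \sum_k IO O' (fun x => z x * wd [:: k; k] (x + h *: eb a)).
    rewrite -IO_sum//; last by move=> k; apply: bcM => //; exact: bsh.
    rewrite -IO_N//; last by apply: bc_sum => k; apply: bcM => //; exact: bsh.
    by apply: IO_eq => x Ox; rewrite -mulr_sumr wd_lap ?mulrN1 ?opprK//; exact: inO.
  rewrite -sumrN; apply: eq_bigr => k _; apply/eqP; rewrite -addr_eq0; apply/eqP.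
  apply: (@ibp R n O' k z (fun x => wd [:: k] (x + h *: eb a)) (z' k)
    (fun x => wd [:: k; k] (x + h *: eb a)) dO') => //.
  - move=> x Ox; apply: isd_shift; apply: wd_d => //; exact: inO.
  - exact: bsh.
  - exact: bsh.
pose hm (m : nat) : R := h0 / 2 * m.+1%:R^-1.
have hm0 m : 0 < hm m by rewrite mulr_gt0 ?invr_gt0// divr_gt0.
have hmlt m : hm m < h0.
  have : hm m <= h0 / 2 by rewrite ler_piMr ?invf_le1 ?ler1n// divr_ge0// ltW.
  lra.
have hmin m : 0 <= hm m < h0 by rewrite hmlt ltW.
have hmc : hm @ \oo --> 0.
  have : hm @ \oo --> h0 / 2 * 0 by apply: cvgM; [exact: cvg_cst|exact: cvg_harmonic].
  by rewrite mulr0.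
pose q m k x := (hm m)^-1 * (wd [:: k] (x + hm m *: eb a) - wd [:: k] x).
have [M M0 hM] : exists2 M : R, 0 <= M & forall k x, O x -> `|wd [:: a; k] x| <= M.
  have h k : exists M : R, 0 <= M /\ forall x, O x -> `|wd [:: a; k] x| <= M.
    by have [_ [M M0 hM]] := @wd_bc [:: a; k] isT; exists M.
  have /choice[Mf hMf] := h.
  exists (\sum_k Mf k); first by apply: sumr_ge0 => k _; case: (hMf k).
  move=> k x Ox; apply: (le_trans ((hMf k).2 x Ox)).
  rewrite (bigD1 k)//= lerDl; apply: sumr_ge0 => k' _; by case: (hMf k').
have qM m k x : O' x -> `|q m k x| <= M.
  move=> Ox; rewrite normrM gtr0_norm ?invr_gt0// ler_pdivrMl//.
  have := @mvt_line R n (wd [:: k]) (eb a) x (wd [:: a; k]) 0 M (hm m) (ltW (hm0 m)).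
  rewrite mulr0 subr0 [_ * M]mulrC; apply => t /andP[ta tb].
  have Ot : O (x + t *: eb a) by apply: inO => //; rewrite ta (le_lt_trans tb).
  by rewrite subr0; split; [exact: wd_d|exact: hM].
have cq m k x : O' x -> {for x, continuous (q m k)}.
  move=> Ox; have [w1 _] := @wd_bc [:: k] isT.
  suff : {for x, continuous (fun y => (hm m)^-1 * (wd [:: k] (y + hm m *: eb a) - wd [:: k] y))} by [].
  apply: continuousM; first exact: cst_continuous.
  apply: continuousB; last by apply: w1; exact: sO.
  apply: (@continuous_comp _ _ _ (fun y : V => y + hm m *: eb a) (wd [:: k])).
    exact: cont_shift.
  by apply: w1; exact: inO.
have bq m k : bc O' (q m k) by split; [exact: cq|exists M => //; exact: qM].
have Iq m : \sum_k IO O' (fun x => z' k x * q m k x) = 0.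
  have H : \sum_k (IO O' (fun x => z' k x * wd [:: k] (x + hm m *: eb a)) -
     IO O' (fun x => z' k x * wd [:: k] (x + 0 *: eb a))) = 0.
    by rewrite sumrB !shift_id ?subrr// lexx.
  apply: (mulfI (x := hm m)); first by rewrite gt_eqF.
  rewrite mulr0 -[RHS]H mulr_sumr; apply: eq_bigr => k _.
  have [w1 [Mw Mw0 hMw]] := @wd_bc [:: k] isT.
  rewrite -IO_B//; last 2 first.
  - apply: bcM => //; split.
      move=> x Ox; apply: (@continuous_comp _ _ _ (fun y : V => y + hm m *: eb a) (wd [:: k])).
        exact: cont_shift.
      by apply: w1; exact: inO.
    by exists Mw => // x Ox; apply: hMw; exact: inO.
  - apply: bcM => //; under [X in bc _ X]eq_fun do rewrite scale0r addr0.
    exact: (bc_sub sO (wd_bc _)).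
  rewrite -IO_Z//; last by apply: bcM.
  apply: IO_eq => x _; rewrite /q scale0r addr0 mulrCA mulVKf ?gt_eqF//.
  by rewrite mulrBr.
have lim k : (fun m => IO O' (fun x => z' k x * q m k x)) @ \oo -->
    IO O' (fun x => z' k x * wd [:: k; a] x).
  have [z1 [Mz Mz0 hMz]] := t3 k.
  apply: (@IO_dct O' (fun m x => z' k x * q m k x) _ (Mz * M)) => //.
  - exact: mulr_ge0.
  - move=> m x Ox; split.
      apply: continuousM; [exact: z1|exact: cq].
    by rewrite normrM; apply: ler_pM => //; [exact: hMz|exact: qM].
  move=> x Ox; apply: cvgM; first exact: cvg_cst.
  have Ox' := sO _ Ox.
  rewrite wd_sym//; have [dd <-] := @wd_d [:: k] a x isT Ox'.
  have /cvgr_dnbhsP/(_ hm) H := dd.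
  have -> : (fun m => q m k x) = (fun m => (hm m)^-1 *: ((wd [:: k] \o shift x) (hm m *: eb a) - wd [:: k] x)).
    by apply/funext => m; rewrite /q /= [_ + x]addrC.
  by apply: H; split=> // m; rewrite gt_eqF.
have lim0 : (fun m => \sum_k IO O' (fun x => z' k x * q m k x)) @ \oo -->
    \sum_k IO O' (fun x => z' k x * wd [:: k; a] x).
  elim: (index_enum _) => [|k r IH].
    by rewrite big_nil (_ : (fun _ => _) = fun=> 0); [exact: cvg_cst|apply/funext => m; rewrite big_nil].
  rewrite big_cons (_ : (fun _ => _) = (fun m => IO O' (fun x => z' k x * q m k x) +
     \sum_(k <- r) IO O' (fun x => z' k x * q m k x))); first exact: cvgD.
  by apply/funext => m; rewrite big_cons.
apply: (cvg_unique (@Rhausdorff R) lim0).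
by rewrite (_ : (fun _ => _) = fun=> 0); [exact: cvg_cst|apply/funext => m; exact: Iq].
Qed.

(** Formally the Laplacian also contains [u_a] times the derivative [a] of [lap w], which is 0 since
    [lap w] is constant. Using [z * u_a] as a test function in [hess_w_div0] gives this without
    third derivatives of [w]. *)
Lemma weak_lap_uw a : weak_lap (fun x => D [:: a] x * wd [:: a] x)
  (fun k x => D [:: k; a] x * wd [:: a] x + D [:: a] x * wd [:: k; a] x)
  (fun x => \sum_k (D [:: k; k; a] x * wd [:: a] x + 2 * (D [:: k; a] x * wd [:: k; a] x))).
Proof.
have b1 s : (size s <= 6)%N -> bc O (D s) by exact: (jet_bc J).
have b2 s : (size s <= 2)%N -> bc O (wd s) by exact: wd_bc.
split.
- by move=> k x Ox; apply: isdM; [exact: (jet_d J)|exact: wd_d].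
- by apply: bcM; [exact: b1|exact: b2].
- by move=> k; apply: bcD; apply: bcM; [exact: b1|exact: b2|exact: b1|exact: b2].
- by apply: bc_sum => k; apply: bcD; [|apply: bcZ]; apply: bcM; [exact: b1|exact: b2|exact: b1|exact: b2].
move=> O' z z' iO tz; have [t1 t2 t3 t4] := tz.
have sO := inner_sub iO; have [dO' _] := iO.
have b1' s : (size s <= 6)%N -> bc O' (D s) by move=> h; apply: bc_sub sO (b1 s h).
have b2' s : (size s <= 2)%N -> bc O' (wd s) by move=> h; apply: bc_sub sO (b2 s h).
have tz2 : test O' (fun x => z x * D [:: a] x) (fun k x => z' k x * D [:: a] x + z x * D [:: k; a] x).
  split.
  - by move=> x k Ox; apply: isdM; [exact: t1|apply: (jet_d J) => //; exact: sO].
  - by apply: bcM => //; exact: b1'.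
  - by move=> k; apply: bcD; apply: bcM => //; exact: b1'.
  - by apply: vanishM => //; exact: b1'.
have H := hess_w_div0 a iO tz2.
have A k : bc O' (fun x => z' k x * (D [:: k; a] x * wd [:: a] x)).
  by apply: bcM => //; apply: bcM; [exact: b1'|exact: b2'].
have B k : bc O' (fun x => z' k x * (D [:: a] x * wd [:: k; a] x)).
  by apply: bcM => //; apply: bcM; [exact: b1'|exact: b2'].
have C k : bc O' (fun x => z x * (D [:: k; a] x * wd [:: k; a] x)).
  by apply: bcM => //; apply: bcM; [exact: b1'|exact: b2'].
have E k : bc O' (fun x => z x * (D [:: k; k; a] x * wd [:: a] x)).
  by apply: bcM => //; apply: bcM; [exact: b1'|exact: b2'].
have P1 k : IO O' (fun x => z' k x * (D [:: k; a] x * wd [:: a] x)) =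
   - IO O' (fun x => z x * (D [:: k; k; a] x * wd [:: a] x))
   - IO O' (fun x => z x * (D [:: k; a] x * wd [:: k; a] x)).
  rewrite -opprD -IO_D//; apply/eqP; rewrite -addr_eq0; apply/eqP.
  rewrite -[RHS](@ibp R n O' k z (fun x => D [:: k; a] x * wd [:: a] x) (z' k)
    (fun x => D [:: k; k; a] x * wd [:: a] x + D [:: k; a] x * wd [:: k; a] x) dO') => //.
  - by congr (_ + _); apply: IO_eq => x _; rewrite mulrDr.
  - move=> x Ox; have Ox' := sO _ Ox; apply: isdM; [exact: (jet_d J)|exact: wd_d].
  - by apply: bcM; [exact: b1'|exact: b2'].
  - by apply: bcD; apply: bcM; [exact: b1'|exact: b2'|exact: b1'|exact: b2'].
have P2 : \sum_k IO O' (fun x => z' k x * (D [:: a] x * wd [:: k; a] x)) =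
   - \sum_k IO O' (fun x => z x * (D [:: k; a] x * wd [:: k; a] x)).
  apply/eqP; rewrite -addr_eq0 -big_split/= -[X in _ == X]H; apply/eqP.
  apply: eq_bigr => k _; rewrite -IO_D//; apply: IO_eq => x _; ring.
transitivity (\sum_k (IO O' (fun x => z' k x * (D [:: k; a] x * wd [:: a] x)) +
    IO O' (fun x => z' k x * (D [:: a] x * wd [:: k; a] x)))).
  by apply: eq_bigr => k _; rewrite -IO_D//; apply: IO_eq => x _; rewrite mulrDr.
rewrite big_split/= P2 (eq_bigr _ (fun k _ => P1 k)) -sumrN -big_split/= -IO_N; last 2 first.
- by [].
- apply: bcM => //; apply: bc_sum => k; apply: bcD; [|apply: bcZ]; apply: bcM; [exact: b1'|exact: b2'|exact: b1'|exact: b2'].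
transitivity (IO O' (fun x => \sum_k (- (z x * (D [:: k; k; a] x * wd [:: a] x)) +
   -2 * (z x * (D [:: k; a] x * wd [:: k; a] x))))); last first.
  by apply: IO_eq => x _; rewrite mulr_sumr -sumrN; apply: eq_bigr => k _; ring.
rewrite IO_sum//; last by move=> k; apply: bcD; [exact: bcN|exact: bcZ].
apply: eq_bigr => k _; rewrite IO_D//; [|exact: bcN|exact: bcZ].
by rewrite IO_N// IO_Z//; ring.
Qed.

End WeakJet.
End Weak.

(** * The trace-free part of a symmetric tensor of order four *)

Section Tensor.
Variables (R : realType) (n : nat).
Notation nn := (n%:R : R).
Notation I := 'I_n.
Implicit Types (Y M : I -> I -> I -> I -> R) (S H : I -> I -> R) (a b d e : I).

Definition dl a b : R := (a == b)%:R.

Lemma dl_sum a (X : I -> R) : \sum_b dl a b * X b = X a.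
Proof. exact: sum_delta. Qed.

Lemma dlC a b : dl a b = dl b a.
Proof. by rewrite /dl eq_sym. Qed.

Lemma dl_suml a (X : I -> R) : \sum_b dl b a * X b = X a.
Proof. by rewrite -[RHS]dl_sum; apply: eq_bigr => b _; rewrite dlC. Qed.

Lemma dl_tr : \sum_a dl a a = nn.
Proof. by rewrite /dl (eq_bigr (fun=> 1)) ?sumr_const ?card_ord// => a _; rewrite eqxx. Qed.

Definition S4 Y := \sum_a \sum_b \sum_d \sum_e Y a b d e.

Lemma eq_S4 Y M : (forall a b d e, Y a b d e = M a b d e) -> S4 Y = S4 M.
Proof. by move=> h; do 4 (apply: eq_bigr => ? _). Qed.

Lemma S4D Y M : S4 (fun a b d e => Y a b d e + M a b d e) = S4 Y + S4 M.
Proof.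
rewrite /S4 -big_split; apply: eq_bigr => a _; rewrite -big_split; apply: eq_bigr => b _.
by rewrite -big_split; apply: eq_bigr => d _; rewrite big_split.
Qed.

Lemma S4Z (t : R) Y : S4 (fun a b d e => t * Y a b d e) = t * S4 Y.
Proof.
rewrite /S4 mulr_sumr; apply: eq_bigr => a _; rewrite mulr_sumr; apply: eq_bigr => b _.
by rewrite mulr_sumr; apply: eq_bigr => d _; rewrite mulr_sumr.
Qed.

Lemma S4_swap12 Y : S4 Y = S4 (fun a b d e => Y b a d e).
Proof. exact: exchange_big. Qed.

Lemma S4_swap23 Y : S4 Y = S4 (fun a b d e => Y a d b e).
Proof. by apply: eq_bigr => a _; exact: exchange_big. Qed.

Lemma S4_swap34 Y : S4 Y = S4 (fun a b d e => Y a b e d).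
Proof. by apply: eq_bigr => a _; apply: eq_bigr => b _; exact: exchange_big. Qed.

Definition sym4 Y := [/\ forall a b d e, Y a b d e = Y b a d e,
  forall a b d e, Y a b d e = Y a d b e & forall a b d e, Y a b d e = Y a b e d].

(** Six times the symmetrization of the tensor product of [dl] and [S], for symmetric [S]. *)
Definition six S a b d e := dl a b * S d e + dl a d * S b e + dl a e * S b d +
  dl b d * S a e + dl b e * S a d + dl d e * S a b.

Lemma six_sym S : (forall a b, S a b = S b a) -> sym4 (six S).
Proof.
move=> sS; split=> a b d e; rewrite /six.
- by rewrite (dlC b a) (sS b a); ring.
- by rewrite (dlC d b) (sS d b); ring.
- by rewrite (dlC e d) (sS e d); ring.
Qed.

Lemma S4_pair Y S H : sym4 Y -> (forall d e, \sum_a Y a a d e = H d e) ->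
  S4 (fun a b d e => Y a b d e * (dl a b * S d e)) = \sum_d \sum_e S d e * H d e.
Proof.
move=> _ tY; rewrite /S4.
transitivity (\sum_a \sum_d \sum_e Y a a d e * S d e).
  apply: eq_bigr => a _; rewrite -[RHS](dl_sum a (fun b => \sum_d \sum_e Y a b d e * S d e)).
  apply: eq_bigr => b _; rewrite mulr_sumr; apply: eq_bigr => d _.
  by rewrite mulr_sumr; apply: eq_bigr => e _; ring.
rewrite exchange_big/=; apply: eq_bigr => d _; rewrite exchange_big/=.
by apply: eq_bigr => e _; rewrite -mulr_suml tY mulrC.
Qed.

Lemma S4_six Y S H : sym4 Y -> (forall d e, \sum_a Y a a d e = H d e) ->
  S4 (fun a b d e => Y a b d e * six S a b d e) = 6 * \sum_d \sum_e S d e * H d e.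
Proof.
move=> sY tY; have [s1 s2 s3] := sY; have P := S4_pair S sY tY.
have P2 : S4 (fun a b d e => Y a b d e * (dl a d * S b e)) = \sum_d \sum_e S d e * H d e.
  by rewrite S4_swap23 -P; apply: eq_S4 => a b d e; rewrite s2.
have P3 : S4 (fun a b d e => Y a b d e * (dl a e * S b d)) = \sum_d \sum_e S d e * H d e.
  by rewrite S4_swap34 -P2; apply: eq_S4 => a b d e; rewrite s3.
have P4 : S4 (fun a b d e => Y a b d e * (dl b d * S a e)) = \sum_d \sum_e S d e * H d e.
  by rewrite S4_swap12 -P2; apply: eq_S4 => a b d e; rewrite s1.
have P5 : S4 (fun a b d e => Y a b d e * (dl b e * S a d)) = \sum_d \sum_e S d e * H d e.
  by rewrite S4_swap12 -P3; apply: eq_S4 => a b d e; rewrite s1.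
have P6 : S4 (fun a b d e => Y a b d e * (dl d e * S a b)) = \sum_d \sum_e S d e * H d e.
  by rewrite S4_swap23 -P5; apply: eq_S4 => a b d e; rewrite s2.
transitivity (S4 (fun a b d e => Y a b d e * (dl a b * S d e)) +
  S4 (fun a b d e => Y a b d e * (dl a d * S b e)) +
  S4 (fun a b d e => Y a b d e * (dl a e * S b d)) +
  S4 (fun a b d e => Y a b d e * (dl b d * S a e)) +
  S4 (fun a b d e => Y a b d e * (dl b e * S a d)) +
  S4 (fun a b d e => Y a b d e * (dl d e * S a b))).
  by rewrite -!S4D; apply: eq_S4 => a b d e; rewrite /six; ring.
by rewrite P P2 P3 P4 P5 P6; ring.
Qed.

Variables (T : I -> I -> I -> I -> R) (H : I -> I -> R) (w : R).
Hypothesis T_sym : sym4 T.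
Hypothesis T_tr : forall d e, \sum_a T a a d e = H d e.
Hypothesis H_tr : \sum_a H a a = w.

(** The solution [S] of the equation that [six S] has the trace [H]. For symmetric [S] this trace is
    [(nn + 4) * S] plus the trace of [S] times [dl]; tracing once more shows that the trace of [S]
    is [w / (2 * (nn + 2))]. *)
Definition Sh a b := (H a b - w / (2 * (nn + 2)) * dl a b) / (nn + 4).
(* The trace-free part of the symmetric tensor T. *)
Definition T0 a b d e := T a b d e - six Sh a b d e.

Let n2 : nn + 2 != 0. Proof. by rewrite gt_eqF// ltr_wpDl. Qed.
Let n4 : nn + 4 != 0. Proof. by rewrite gt_eqF// ltr_wpDl. Qed.

Lemma H_sym a b : H a b = H b a.
Proof. by rewrite -!T_tr; apply: eq_bigr => d _; case: T_sym => _ _ ->. Qed.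

Lemma Sh_sym a b : Sh a b = Sh b a.
Proof. by rewrite /Sh H_sym dlC. Qed.

Lemma Sh_tr : \sum_a Sh a a = w / (2 * (nn + 2)).
Proof.
rewrite /Sh -mulr_suml sumrB H_tr -mulr_sumr dl_tr.
by field; rewrite n4 n2.
Qed.

Lemma six_tr d e : \sum_a six Sh a a d e = H d e.
Proof.
rewrite /six !big_split/= -mulr_suml dl_tr !dl_suml -mulr_sumr Sh_tr (Sh_sym e d).
by rewrite /Sh; field; rewrite n4 n2.
Qed.

Lemma Sh_H : \sum_d \sum_e Sh d e * H d e =
  ((\sum_d \sum_e H d e ^+ 2) - w ^+ 2 / (2 * (nn + 2))) / (nn + 4).
Proof.
transitivity (\sum_d \sum_e (H d e ^+ 2 / (nn + 4)
    - w / (2 * (nn + 2)) / (nn + 4) * (dl d e * H d e))).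
  by apply: eq_bigr => d _; apply: eq_bigr => e _; rewrite /Sh; field; rewrite n4 n2.
rewrite (eq_bigr (fun d => (\sum_e H d e ^+ 2) / (nn + 4) -
    w / (2 * (nn + 2)) / (nn + 4) * H d d)); last first.
  by move=> d _; rewrite sumrB -mulr_suml -mulr_sumr dl_sum.
rewrite sumrB -mulr_suml -mulr_sumr H_tr.
by field; rewrite n4 n2.
Qed.

(** Pythagoras: [T] and [six Sh] have the same trace, so by [S4_six] they have the same scalar
    product with [six Sh], and [T0] is orthogonal to it. *)
Lemma T0_sq : S4 (fun a b d e => T0 a b d e ^+ 2) =
  S4 (fun a b d e => T a b d e ^+ 2) -
  6 / (nn + 4) * ((\sum_d \sum_e H d e ^+ 2) - w ^+ 2 / (2 * (nn + 2))).
Proof.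
have h1 := S4_six Sh T_sym T_tr.
have h2 := S4_six Sh (six_sym Sh_sym) six_tr.
transitivity (S4 (fun a b d e => T a b d e ^+ 2) +
   -2 * S4 (fun a b d e => T a b d e * six Sh a b d e) +
   S4 (fun a b d e => six Sh a b d e * six Sh a b d e)).
  rewrite -S4Z -!S4D; apply: eq_S4 => a b d e; rewrite /T0; ring.
rewrite h1 h2 Sh_H; ring.
Qed.

(** The value of [al] makes [2 * al - 1] equal to [- 12 / (nn + 4)], so that the terms in [H] are
    absorbed by [T0_sq] and only a multiple of [w ^+ 2] is left over. *)
Lemma T0_lap (al be : R) :
  al = (nn - 8) / (2 * (nn + 4)) -> be = - 4^-1 - al ->
  2 * S4 (fun a b d e => T a b d e ^+ 2) + (2 * al - 1) * (\sum_d \sum_e H d e ^+ 2) + be * w ^+ 2 =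
  2 * S4 (fun a b d e => T0 a b d e ^+ 2) - 3 * nn * (nn - 2) / (4 * (nn + 2) * (nn + 4)) * w ^+ 2.
Proof.
move=> -> ->; rewrite T0_sq; field; rewrite n4 n2//.
Qed.

End Tensor.

(** * The P-function and the cancellations in its Laplacian *)

Section PFunction.
Variables (R : realType) (n : nat).
Notation V := 'rV[R]_n.
Notation eb := (ebasis R).
Notation nn := (n%:R : R).
Variables (O : set V) (u : V -> R) (c : R).
Hypothesis J : jet O u c.
Let dO : odom O := jet_dom J.
Notation D s := (dp s u).
Notation wd := (wd u).
Implicit Types (x y : V) (i j k : 'I_n).

(** In [lap P] the product [Dv . Dw] has the coefficient [2^-1 + 2 * al + 2 * be], which determines
    [be]; the coefficient [2 * al - 1] of [|D^2 v|^2] has to be the one in [2 |T0|^2], which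
    determines [al]. *)
Definition al : R := (nn - 8) / (2 * (nn + 4)).
Definition be : R := - 4^-1 - al.
Definition kap : R := 3 * nn * (nn - 2) / (4 * (nn + 2) * (nn + 4)).

(* With v = lap u: hs, v1 and vv are the Hessian of v, its gradient and v itself. *)
Definition hs a b x := \sum_d D [:: a; b; d; d] x.
Definition v1 a x := \sum_d D [:: a; d; d] x.
Definition vv x := \sum_d D [:: d; d] x.

Definition T0x x a b d e :=
  T0 (fun a b d e => D [:: a; b; d; e] x) (fun a b => hs a b x) (wd [::] x) a b d e.
Definition T0sq x := S4 (fun a b d e => T0x x a b d e ^+ 2).

Definition PA x := S3 (fun a b d => D [:: a; b; d] x * D [:: a; b; d] x).
Definition PB x := S3 (fun a b d => D [:: a; b] x * D [:: a; b; d; d] x).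
Definition PX x := \sum_a D [:: a] x * wd [:: a] x.
Definition PV x := S3 (fun a b d => D [:: a; b; b] x * D [:: a; d; d] x).
Definition PW x := S3 (fun a b d => D [:: a; a] x * D [:: b; b; d; d] x).

(* P = |D^3 u|^2 - D^2 u : D^2 v + Du . Dw / 2 + al |Dv|^2 + be v w + be u, where al and be
   are the constants for which lap P = 2 |T0|^2 - kap w^2. *)
Definition P x := PA x + -1 * PB x + 2^-1 * PX x + al * PV x + be * PW x + be * D [::] x.

Lemma dperm s t x : O x -> (size s <= 6)%N -> perm_eq s t -> D s x = D t x.
Proof. by move=> Ox s6 st; exact: (jet_perm J). Qed.

Lemma sum_S3' (F : 'I_n -> 'I_n -> 'I_n -> 'I_n -> R) :
  S3 (fun a b d => \sum_k F k a b d) = S3 (fun k a b => \sum_d F k a b d).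
Proof. by rewrite -(sum_S3 F). Qed.

Lemma weak_S3 (p lp : 'I_n -> 'I_n -> 'I_n -> V -> R) (p' : 'I_n -> 'I_n -> 'I_n -> 'I_n -> V -> R) : (forall a b d, weak_lap O (p a b d) (p' a b d) (lp a b d)) ->
  weak_lap O (fun x => S3 (fun a b d => p a b d x)) (fun k x => S3 (fun a b d => p' a b d k x))
    (fun x => S3 (fun a b d => lp a b d x)).
Proof.
move=> h; apply: weak_lap_sum => a; apply: weak_lap_sum => b; apply: weak_lap_sum => d.
exact: h.
Qed.

(** The invariants that occur in the Laplacians of the pieces of [P]: [T1] is [D^3 u : D^3 v], [Tsq]
    is [|D^4 u|^2], [Hsq] is [|D^2 v|^2], [T2] is [D^2 u : D^2 w] and [T3] is [Dv . Dw]. *)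
Let T1 x := S3 (fun a b d => \sum_k D [:: a; b; d] x * D [:: k; k; a; b; d] x).
Let Tsq x := S4 (fun a b d e => D [:: a; b; d; e] x ^+ 2).
Let Hsq x := \sum_a \sum_b hs a b x ^+ 2.
Let T2 x := \sum_a \sum_k D [:: k; a] x * wd [:: k; a] x.
Let T3 x := \sum_a v1 a x * wd [:: a] x.

Ltac pm := apply/permP => ? /=; lia.

Lemma lapA x : O x ->
  S3 (fun a b d => \sum_k (D [:: k, k & [:: a; b; d]] x * D [:: a; b; d] x +
    2 * (D (k :: [:: a; b; d]) x * D (k :: [:: a; b; d]) x) +
    D [:: a; b; d] x * D [:: k, k & [:: a; b; d]] x)) = 2 * T1 x + 2 * Tsq x.
Proof.
move=> Ox.
have -> : Tsq x = S3 (fun a b d => \sum_k D [:: k; a; b; d] x ^+ 2).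
  by rewrite -(sum_S3 (fun k a b d => D [:: k; a; b; d] x ^+ 2)).
rewrite /T1 -!S3Z -S3D; apply: eq_S3 => a b d.
rewrite !mulr_sumr -big_split/=; apply: eq_bigr => k _; ring.
Qed.

Lemma lapB x : O x ->
  S3 (fun a b d => \sum_k (D [:: k, k & [:: a; b]] x * D [:: a; b; d; d] x +
    2 * (D (k :: [:: a; b]) x * D (k :: [:: a; b; d; d]) x) +
    D [:: a; b] x * D [:: k, k & [:: a; b; d; d]] x)) = Hsq x + 2 * T1 x + T2 x.
Proof.
move=> Ox.
have e1 : S3 (fun a b d => \sum_k D [:: k; k; a; b] x * D [:: a; b; d; d] x) = Hsq x.
  apply: eq_bigr => a _; apply: eq_bigr => b _.
  rewrite expr2 {2}/hs mulr_sumr; apply: eq_bigr => d _.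
  rewrite /hs mulr_suml; apply: eq_bigr => k _; congr (_ * _); apply: dperm => //; pm.
have e2 : S3 (fun a b d => \sum_k D [:: k; a; b] x * D [:: k; a; b; d; d] x) = T1 x.
  rewrite sum_S3'; apply: eq_S3 => a b d; apply: eq_bigr => k _.
  by congr (_ * _); apply: dperm => //; pm.
have e3 : S3 (fun a b d => \sum_k D [:: a; b] x * D [:: k; k; a; b; d; d] x) = T2 x.
  rewrite /T2 exchange_big/=; apply: eq_bigr => a _; apply: eq_bigr => b _.
  rewrite /wd exchange_big mulr_sumr/=; apply: eq_bigr => d _; rewrite mulr_sumr.
  by apply: eq_bigr => k _; congr (_ * _); apply: dperm => //; pm.
rewrite -e1 -e2 -e3 -S3Z -!S3D; apply: eq_S3 => a b d.
by rewrite mulr_sumr -!big_split/=.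
Qed.

Lemma lapX x : O x ->
  \sum_a \sum_k (D [:: k; k; a] x * wd [:: a] x + 2 * (D [:: k; a] x * wd [:: k; a] x)) =
  T3 x + 2 * T2 x.
Proof.
move=> Ox; rewrite /T3 /T2 mulr_sumr -big_split/=; apply: eq_bigr => a _.
rewrite big_split/=; congr (_ + _); last by rewrite mulr_sumr.
rewrite -mulr_suml; congr (_ * _).
by apply: eq_bigr => k _; apply: dperm => //; pm.
Qed.

Lemma lapV x : O x ->
  S3 (fun a b d => \sum_k (D [:: k, k & [:: a; b; b]] x * D [:: a; d; d] x +
    2 * (D (k :: [:: a; b; b]) x * D (k :: [:: a; d; d]) x) +
    D [:: a; b; b] x * D [:: k, k & [:: a; d; d]] x)) = 2 * T3 x + 2 * Hsq x.
Proof.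
move=> Ox.
have e1 : S3 (fun a b d => \sum_k D [:: k; k; a; b; b] x * D [:: a; d; d] x) = T3 x.
  apply: eq_bigr => a _; rewrite mulrC /wd mulr_suml; apply: eq_bigr => b _.
  rewrite exchange_big/= mulr_suml; apply: eq_bigr => k _.
  rewrite /v1 -mulr_sumr; congr (_ * _); apply: dperm => //; pm.
have e2 : S3 (fun a b d => \sum_k D [:: k; a; b; b] x * D [:: k; a; d; d] x) = Hsq x.
  rewrite sum_S3'; apply: eq_bigr => a _; apply: eq_bigr => b _.
  by rewrite expr2 /hs mulr_suml; apply: eq_bigr => d _; rewrite mulr_sumr.
have e3 : S3 (fun a b d => \sum_k D [:: a; b; b] x * D [:: k; k; a; d; d] x) = T3 x.
  apply: eq_bigr => a _; rewrite /v1 mulr_suml; apply: eq_bigr => b _.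
  rewrite /wd exchange_big mulr_sumr/=; apply: eq_bigr => d _; rewrite mulr_sumr.
  by apply: eq_bigr => k _; congr (_ * _); apply: dperm => //; pm.
have -> : 2 * T3 x + 2 * Hsq x = T3 x + 2 * Hsq x + T3 x by ring.
rewrite -{1}e1 -e2 -e3 -S3Z -!S3D; apply: eq_S3 => a b d.
by rewrite mulr_sumr -!big_split/=.
Qed.

Lemma lapW x : O x ->
  S3 (fun a b d => \sum_k (D [:: k, k & [:: a; a]] x * D [:: b; b; d; d] x +
    2 * (D (k :: [:: a; a]) x * D (k :: [:: b; b; d; d]) x) +
    D [:: a; a] x * D [:: k, k & [:: b; b; d; d]] x)) =
  wd [::] x ^+ 2 + 2 * T3 x - vv x.
Proof.
move=> Ox.
have e1 : S3 (fun a b d => \sum_k D [:: k; k; a; a] x * D [:: b; b; d; d] x) = wd [::] x ^+ 2.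
  rewrite expr2 {1}/wd mulr_suml; apply: eq_bigr => a _.
  rewrite /wd mulr_sumr; apply: eq_bigr => b _; rewrite mulr_sumr; apply: eq_bigr => d _.
  rewrite mulr_suml; apply: eq_bigr => k _; congr (_ * _); apply: dperm => //; pm.
have e2 : S3 (fun a b d => \sum_k D [:: k; a; a] x * D [:: k; b; b; d; d] x) = T3 x.
  rewrite sum_S3'; apply: eq_bigr => k _; rewrite /v1 mulr_suml; apply: eq_bigr => a _.
  by rewrite /wd mulr_sumr; apply: eq_bigr => b _; rewrite mulr_sumr.
have e3 : S3 (fun a b d => \sum_k D [:: a; a] x * D [:: k; k; b; b; d; d] x) = - vv x.
  rewrite -mulrN1 /vv mulr_suml; apply: eq_bigr => a _.
  rewrite -(jet_eq J Ox) mulr_sumr; apply: eq_bigr => b _; rewrite mulr_sumr.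
  apply: eq_bigr => d _; rewrite mulr_sumr; apply: eq_bigr => k _.
  by congr (_ * _); apply: dperm => //; pm.
rewrite -e1 -e2 -e3 -S3Z -!S3D; apply: eq_S3 => a b d.
by rewrite mulr_sumr -!big_split/=.
Qed.

Lemma D4_sym x : O x -> sym4 (fun a b d e => D [:: a; b; d; e] x).
Proof. by move=> Ox; split=> a b d e; apply: dperm => //; pm. Qed.

Lemma D4_tr x d e : O x -> \sum_a D [:: a; a; d; e] x = hs d e x.
Proof. by move=> Ox; apply: eq_bigr => a _; apply: dperm => //; pm. Qed.

Lemma hs_tr x : O x -> \sum_a hs a a x = wd [::] x.
Proof. by []. Qed.

Lemma weak_lap_eq p p' lp lp' : (forall x, O x -> lp x = lp' x) ->
  weak_lap O p p' lp -> weak_lap O p p' lp'.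
Proof.
move=> e [h1 h2 h3 h4 h5]; split=> //.
  have [c1 [M M0 hM]] := h4; split; last by exists M => // x Ox; rewrite -e//; exact: hM.
  move=> x Ox; apply: (continuous_near _ (c1 x Ox)).
  by case: dO => _ oO _; apply: filterS (open_nbhs_in oO Ox) => y; exact: e.
move=> O' z z' iO tz; rewrite (h5 O' z z' iO tz); congr (- _); apply: IO_eq => x Ox.
by rewrite e//; exact: (inner_sub iO).
Qed.

Lemma P_weak : exists P', weak_lap O P P' (fun x => 2 * T0sq x - kap * wd [::] x ^+ 2).
Proof.
have wA := weak_S3 (fun a b d => @weak_lap_prod R n O u c J [:: a; b; d] [:: a; b; d] isT isT).
have wB := weak_S3 (fun a b d => @weak_lap_prod R n O u c J [:: a; b] [:: a; b; d; d] isT isT).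
have wX := weak_lap_sum (index_enum 'I_n) (fun a => weak_lap_uw J a).
have wV := weak_S3 (fun a b d => @weak_lap_prod R n O u c J [:: a; b; b] [:: a; d; d] isT isT).
have wW := weak_S3 (fun a b d => @weak_lap_prod R n O u c J [:: a; a] [:: b; b; d; d] isT isT).
have wU : weak_lap O (D [::]) (fun k x => D [:: k] x) (fun x => \sum_k D [:: k; k] x).
  apply: weak_lap_C2.
  - by move=> k x Ox; exact: (jet_d J).
  - by move=> k x Ox; exact: (jet_d J).
  - exact: (jet_bc J).
  - by move=> k; exact: (jet_bc J).
  - by move=> k; exact: (jet_bc J).
have w1 := weak_lapD wA (weak_lapZ (-1) wB).
have w2 := weak_lapD w1 (weak_lapZ 2^-1 wX).
have w3 := weak_lapD w2 (weak_lapZ al wV).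
have w4 := weak_lapD w3 (weak_lapZ be wW).
have w5 := weak_lapD w4 (weak_lapZ be wU).
eexists; apply: weak_lap_eq w5 => x Ox.
(* [T1] and [T2] cancel by the coefficients [-1] and [2^-1], [T3] by the choice of [be], and the
   [- vv] from [lapW] against the Laplacian of the last term [be * u]. *)
rewrite (lapA Ox) (lapB Ox) (lapX Ox) (lapV Ox) (lapW Ox) -/(vv x).
have := @T0_lap R n _ (fun a b => hs a b x) (wd [::] x) (D4_sym Ox) (fun d e => D4_tr d e Ox) (hs_tr Ox) al be erefl erefl.
by rewrite -/(kap) -/(T0sq x) => <-; rewrite -/(Tsq x) -/(Hsq x) /be; field.
Qed.

End PFunction.

(** * Vanishing of the trace-free part of the fourth derivatives *)

Section Energy.
Variables (R : realType) (n : nat).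
Notation V := 'rV[R]_n.
Notation eb := (ebasis R).
Implicit Types (F G z : V -> R) (O : set V) (x y : V) (i j k : 'I_n) (l d : R).

Lemma inner_bc O' O F : inner O' O -> (forall x, O x -> {for x, continuous F}) -> bc O' F.
Proof.
move=> iO cF; have [[_ _ bO'] cO] := iO; split; first by move=> x /(inner_sub iO); exact: cF.
apply: (within_closure_bc bO' (g := F)) => //.
apply/subspace_continuousP => x cx.
apply: (@cvg_trans _ (F @ nbhs x)); last by apply: cF; exact: cO.
by apply: cvg_app; exact: cvg_within.
Qed.

Lemma closure_ge O F x l : closure O x -> {for x, continuous F} ->
  (forall y, O y -> l <= F y) -> l <= F x.
Proof.
move=> cx cF h; rewrite leNgt; apply/negP => Fl.
have /cvg_rowP/(_ ((l - F x) / 2)) := cF.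
have e0 : 0 < (l - F x) / 2 by rewrite divr_gt0// subr_gt0.
move=> /(_ e0) nF; have [y [Oy /=]] := cx _ nF.
by rewrite ler_norml => /andP[h1 h2]; have := h y Oy; lra.
Qed.

Lemma vanish_level O F : (forall x, bdry O x -> {for x, continuous F}) ->
  (forall x, O x -> 0 < F x) -> (forall x, bdry O x -> F x <= 0) -> vanish O F.
Proof.
move=> cF F0 Fb x bx; have F00 : F x = 0.
  apply/eqP; rewrite eq_le Fb//=; case: (bx) => cx _.
  by apply: (closure_ge cx (cF x bx)) => y /F0/ltW.
by have := @tends_cont R n O x F (cF x bx); rewrite /tends F00.
Qed.

(** Since [F] tends to 0 at the boundary, the set where it exceeds [d] stays away from the boundary.
    Maximum principles are run there, with the truncation [F - d] as the test function. *)
Lemma superlevel_inner O F d : odom O -> (forall x, O x -> {for x, continuous F}) ->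
  vanish O F -> 0 < d ->
  inner (O `&` [set x | d < F x]) O /\ vanish (O `&` [set x | d < F x]) (fun x => F x - d).
Proof.
move=> [n0 oO bO] cF vF d0; set O' := O `&` _.
have oO' : open O'.
  rewrite openE => x [Ox Fx]; have e0 : 0 < (F x - d) / 2 by rewrite divr_gt0// subr_gt0.
  have /cvg_rowP/(_ _ e0) nF := cF x Ox.
  have nO := open_nbhs_in oO Ox.
  apply: filterS2 nO nF => y Oy /=; rewrite ler_norml => /andP[h1 h2]; split=> //=.
  by move: Fx => /= Fx; lra.
have cO' : closure O' `<=` O.
  move=> x cx; apply: contrapT => nx.
  have cOx : closure O x by apply: closureS cx => y [].
  have /vanishP/(_ _ d0) h := vF x (conj cOx nx).
  have [y [[Oy /= Fy]] /= hy] := cx _ h.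
  by have := hy Oy; have := ler_norm (F y); lra.
have bO' : bset O' by have [B B0 hB] := bO; exists B => // x [/hB].
split; first by split.
apply: vanish_level.
- move=> x [/cO' Ox _]; apply: continuousB; [exact: cF|exact: cst_continuous].
- by move=> x [_ /=]; rewrite subr_gt0.
- move=> x [/cO' Ox nO]; rewrite subr_le0 leNgt; apply/negP => h; apply: nO.
  by split.
Qed.

(** The gradient of [z] vanishes, so integrating [z] by parts against a coordinate shows that its
    integral is 0, which is impossible for a positive [z] on a nonempty set. *)
Lemma energy_empty O z (z' : 'I_n -> V -> R) : odom O -> test O z z' ->
  (forall x, O x -> 0 < z x) -> \sum_k IO O (fun x => z' k x * z' k x) <= 0 ->
  forall x, ~ O x.
Proof.
move=> dO [t1 t2 t3 t4] z0 E x Ox; have [n0 oO bO] := dO.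
have bz k : bc O (fun x => z' k x * z' k x) by exact: bcM.
have Ik k : 0 <= IO O (fun x => z' k x * z' k x).
  by apply: IO_ge0 => // y _; rewrite -expr2 sqr_ge0.
have E0 : \sum_k IO O (fun x => z' k x * z' k x) = 0.
  by apply/eqP; rewrite eq_le E sumr_ge0.
have zk k y : O y -> z' k y = 0.
  move=> Oy; have /psumr_eq0P h := E0.
  have /(IO_eq0 dO (bz k)) hk := h (fun k _ => Ik k) k isT.
  have : z' k y * z' k y = 0 by apply: hk => // t _; rewrite -expr2 sqr_ge0.
  by move/eqP; rewrite mulf_eq0 orbb => /eqP.
pose k0 := Ordinal n0.
have bx := bc_coord k0 bO.
have H : IO O (fun y => 0 * y ord0 k0) + IO O (fun y => z y * 1) = 0.
  apply: (@ibp R n O k0 z (fun y => y ord0 k0) (fun=> 0) (fun=> 1) dO) => //.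
  - by move=> y Oy; have := t1 y k0 Oy; rewrite zk.
  - by move=> y Oy; have := isd_coord y k0 k0; rewrite eqxx.
  - exact: bc_cst.
  - exact: bc_cst.
have z1 : bc O (fun y => z y * 1) by apply: bcM => //; exact: bc_cst.
have Iz : IO O (fun y => z y * 1) = 0.
  by rewrite -[RHS]H (IO_eq (F := fun y => 0 * y ord0 k0) (G := fun=> 0)) ?IO_0 ?add0r// => y _; rewrite mul0r.
have := IO_eq0 dO z1 _ Iz Ox; rewrite mulr1 => h.
by have := z0 x Ox; rewrite h ?ltxx// => y Oy; rewrite mulr1 ltW// z0.
Qed.

(** Positive exactly inside a Euclidean ball and with constant Laplacian: a localized test function,
    and a barrier for the torsion function. *)
Definition paraboloid (x1 : V) (r : R) x : R := r ^+ 2 - \sum_i (x ord0 i - x1 ord0 i) ^+ 2.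

Lemma paraboloid_d x1 r k x :
  is_derive x (eb k) (paraboloid x1 r) (-2 * (x ord0 k - x1 ord0 k)).
Proof.
have h i : is_derive x (eb k) (fun y : V => (y ord0 i - x1 ord0 i) * (y ord0 i - x1 ord0 i))
    ((k == i)%:R * (2 * (x ord0 i - x1 ord0 i))).
  have h1 := isdB (isd_coord x k i) (isdC x (eb k) (x1 ord0 i)).
  by have := isdM h1 h1; congr is_derive; rewrite subr0; ring.
have H := isdB (isdC x (eb k) (r ^+ 2)) (isd_sum (index_enum 'I_n) h).
move: H; rewrite sum_delta sub0r -mulNr; congr is_derive.
Qed.

Lemma paraboloid_cont x1 r : continuous (paraboloid x1 r).
Proof.
move=> x; suff : {for x, continuous (fun y : V => r ^+ 2 - \sum_i (y ord0 i - x1 ord0 i) ^+ 2)} by [].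
apply: continuousB; first exact: cst_continuous.
have h (s : seq 'I_n) : {for x, continuous (fun y : V => \sum_(i <- s) (y ord0 i - x1 ord0 i) ^+ 2)}.
  elim: s => [|i s IH].
    by rewrite (_ : (fun _ => _) = fun=> 0); [exact: cst_continuous|apply/funext => y; rewrite big_nil].
  rewrite (_ : (fun _ => _) = (fun y : V => (y ord0 i - x1 ord0 i) ^+ 2 +
     \sum_(i <- s) (y ord0 i - x1 ord0 i) ^+ 2)); last by apply/funext => y; rewrite big_cons.
  apply: continuousD => //.
  have h1 : {for x, continuous (fun y : V => y ord0 i - x1 ord0 i)}.
    by apply: continuousB; [exact: coord_continuous|exact: cst_continuous].
  exact: (continuousM h1 h1).
exact: h.
Qed.

Lemma paraboloid_pos x1 r x : 0 < r -> 0 <= paraboloid x1 r x -> `|x - x1| <= r.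
Proof.
move=> r0 h; apply: row_norm_le => [|i]; first exact: ltW.
rewrite -(ler_pXn2r (n := 2))// ?nnegrE ?(ltW r0)// real_normK ?num_real// !mxE.
move: h; rewrite /paraboloid subr_ge0 => h; apply: (le_trans _ h).
rewrite (bigD1 i)//= lerDl; apply: sumr_ge0 => j _; exact: sqr_ge0.
Qed.

End Energy.

(** * Boundary value and integral of P, and the planar case *)

Section PBoundary.
Variables (R : realType) (n : nat).
Notation V := 'rV[R]_n.
Notation eb := (ebasis R).
Notation nn := (n%:R : R).
Variables (O : set V) (u : V -> R) (c : R).
Hypothesis J : jet O u c.
Let dO : odom O := jet_dom J.
Notation D s := (dp s u).
Notation wd := (wd u).
Notation al := (al R n).
Implicit Types (x y : V) (i j k : 'I_n).

Lemma S3_0 : S3 (fun _ _ _ : 'I_n => 0) = 0 :> R.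
Proof. by rewrite /S3 big1// => a _; rewrite big1// => b _; rewrite big1. Qed.

Lemma P_tends x : bdry O x -> tends O x (P u) (c ^+ 2 * (1 + al)).
Proof.
move=> bx; have [nu nu1 h] := jet_bdry J bx.
have tA : tends O x (PA u) (c ^+ 2).
  apply: (tends_eq _ (Q3_tends J bx)) => y _; apply: eq_S3 => a b d; rewrite expr2//.
have tB : tends O x (PB u) 0.
  rewrite -S3_0; apply: tends_S3 => a b d.
  by apply: (vanishM _ _ bx); [exact: (jet_vanish J)|exact: (jet_bc J)].
have tX : tends O x (PX u) 0.
  have -> : 0 = \sum_(a < n) 0 :> R by rewrite big1.
  apply: tends_sum => a.
  by apply: (vanishM _ _ bx); [exact: (jet_vanish J)|exact: (wd_bc J)].
have tV : tends O x (PV u) (c ^+ 2).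
  have -> : c ^+ 2 = S3 (fun a b d => (c * nu a * nu b * nu b) * (c * nu a * nu d * nu d)).
    rewrite /S3 -[LHS]mulr1 -nu1 mulr_sumr; apply: eq_bigr => a _.
    rewrite -[LHS]mulr1 -[in X in _ * X]nu1 mulr_sumr; apply: eq_bigr => b _.
    rewrite -[LHS]mulr1 -[in X in _ * X]nu1 mulr_sumr; apply: eq_bigr => d _.
    ring.
  by apply: tends_S3 => a b d; apply: tendsM; exact: h.
have tW : tends O x (PW u) 0.
  rewrite -S3_0; apply: tends_S3 => a b d.
  by apply: (vanishM _ _ bx); [exact: (jet_vanish J)|exact: (jet_bc J)].
have tU : tends O x (D [::]) 0 by exact: (jet_vanish J).
have := tendsD (tendsD (tendsD (tendsD (tendsD tA (tendsZ (b := -1) tB)) (tendsZ (b := 2^-1) tX)) (tendsZ (b := al) tV))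
  (tendsZ (b := be R n) tW)) (tendsZ (b := be R n) tU).
by congr tends; ring.
Qed.

Lemma bc_pieces : [/\ bc O (PA u), bc O (PB u), bc O (PX u), bc O (PV u) & bc O (PW u)].
Proof.
split.
- by apply: bc_S3 => a b d; apply: bcM; exact: (jet_bc J).
- by apply: bc_S3 => a b d; apply: bcM; exact: (jet_bc J).
- by apply: bc_sum => a; apply: bcM; [exact: (jet_bc J)|exact: (wd_bc J)].
- by apply: bc_S3 => a b d; apply: bcM; exact: (jet_bc J).
- by apply: bc_S3 => a b d; apply: bcM; exact: (jet_bc J).
Qed.

Lemma IO_P : IO O (P u) = (5 / 2 + al) * Eu O u.
Proof.
have [bA bB bX bV bW] := bc_pieces.
have bU : bc O (D [::]) by exact: (jet_bc J).
have bb s t : (size s <= 6)%N -> (size t <= 6)%N -> bc O (fun x => D s x * D t x).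
  by move=> s6 t6; apply: bcM; exact: (jet_bc J).
have IA : IO O (PA u) = Eu O u.
  by rewrite -(S3_333 J) /PA (IO_S3 J)// => a b d; exact: bb.
have IB : IO O (PB u) = - Eu O u.
  by rewrite -(S3_24 J) /PB (IO_S3 J)// => a b d; exact: bb.
have IX : IO O (PX u) = Eu O u.
  rewrite -(S3_15 J) /PX -(IO_S3 J); last by move=> a b d; exact: bb.
  apply: IO_eq => x _; apply: eq_bigr => a _; rewrite mulr_sumr; apply: eq_bigr => b _.
  by rewrite mulr_sumr.
have IV : IO O (PV u) = Eu O u.
  by rewrite -(S3_v33 J) /PV (IO_S3 J)// => a b d; exact: bb.
have IW : IO O (PW u) = - Eu O u.
  by rewrite -(S3_v4 J) /PW (IO_S3 J)// => a b d; exact: bb.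
have b1 := bcD bA (bcZ (-1) bB).
have b2 := bcD b1 (bcZ 2^-1 bX).
have b3 := bcD b2 (bcZ al bV).
have b4 := bcD b3 (bcZ (be R n) bW).
rewrite (IO_D dO b4 (bcZ (be R n) bU)) (IO_D dO b3 (bcZ (be R n) bW)) (IO_D dO b2 (bcZ al bV)).
rewrite (IO_D dO b1 (bcZ 2^-1 bX)) (IO_D dO bA (bcZ (-1) bB)) !IO_Z// IA IB IX IV IW -/(Eu O u).
by field.
Qed.

(* P minus its constant boundary value. *)
Definition Pt x := P u x - c ^+ 2 * (1 + al).

Lemma Pt_vanish : vanish O Pt.
Proof.
move=> x bx; rewrite -(subrr (c ^+ 2 * (1 + al))).
by apply: (tendsD (P_tends bx)); exact: tends_cst.
Qed.

Lemma Pt_weak : exists P', weak_lap O Pt P' (fun x => 2 * T0sq u x - kap R n * wd [::] x ^+ 2).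
Proof.
have [P' hP] := P_weak J.
have hc : weak_lap O (fun=> - (c ^+ 2 * (1 + al))) (fun _ _ => 0) (fun x => \sum_(k < n) 0).
  have b0 (a : R) : bc O (fun=> a) := bc_cst O a.
  by apply: (@weak_lap_C2 R n O _ _ (fun _ _ => 0)) => // k x _; exact: isdC.
have := weak_lapD hP hc.
have -> : (fun x => 2 * T0sq u x - kap R n * wd [::] x ^+ 2 + \sum_(k < n) 0) =
   (fun x => 2 * T0sq u x - kap R n * wd [::] x ^+ 2).
  by apply/funext => x; rewrite big1 ?addr0.
by eexists; eassumption.
Qed.

Lemma IO_Pt : IO O Pt = 3 * nn * (nn - 2) / (2 * (nn + 4) * (nn + 6)) * c ^+ 2 * vol O.
Proof.
have [P' [_ bP _ _ _]] := P_weak J.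
have E : Eu O u = nn * c ^+ 2 * vol O / (nn + 6).
  apply/eqP; rewrite eq_sym -(pohozaev J); apply/eqP; rewrite mulrC mulKf// gt_eqF// ltr_wpDl//.
have IC : IO O (fun=> c ^+ 2 * (1 + al)) = c ^+ 2 * (1 + al) * vol O.
  rewrite /vol -IO_Z//; last exact: bc_cst.
  by apply: IO_eq => x _; rewrite mulr1.
rewrite /Pt IO_B//; last exact: bc_cst.
rewrite IO_P IC E /al; field.
by rewrite !gt_eqF// ltr_wpDl.
Qed.

Lemma T0sq_ge0 x : 0 <= T0sq u x.
Proof. by do 4 (apply: sumr_ge0 => ? _); exact: sqr_ge0. Qed.

Lemma T0sq_bc : bc O (T0sq u).
Proof.
have [P' [_ _ _ h _]] := P_weak J.
have bw : bc O (fun x => wd [::] x * wd [::] x) by apply: bcM; exact: (wd_bc J).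
have := bcZ 2^-1 (bcD h (bcZ (kap R n) bw)); congr bc; apply/funext => x.
by field.
Qed.

(* For n = 2 both kap and the integral of Pt vanish: Pt is subharmonic with boundary value 0,
   hence nonpositive, hence zero. *)
Lemma T0_planar : n = 2 -> forall x, O x -> T0sq u x = 0.
Proof.
move=> n2; have [P' W] := Pt_weak.
have nn2 : nn - 2 = 0 by rewrite n2 subrr.
have k0 : kap R n = 0 by rewrite /kap nn2 mulr0 mul0r.
have IP : IO O Pt = 0 by rewrite IO_Pt nn2 mulr0 !mul0r.
have [W1 W2 W3 W4 W5] := W.
have cPt x : O x -> {for x, continuous Pt} by case: W2 => h _; exact: h.
(* On the set where [Pt > d], the test function [Pt - d] shows that its own energy is minus the
   integral of a nonnegative function, so the set is empty. *)
have Pd d x : 0 < d -> O x -> Pt x <= d.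
  move=> d0 Ox; rewrite leNgt; apply/negP => Pd.
  have [iO vz] := superlevel_inner dO cPt Pt_vanish d0.
  set O' := O `&` _ in iO vz.
  have sO := inner_sub iO; have [dO' _] := iO.
  have tz : test O' (fun x => Pt x - d) P'.
    split => //.
    - move=> y k Oy; have := isdB (W1 k y (sO _ Oy)) (isdC y (eb k) d).
      by rewrite subr0.
    - by apply: bcB; [exact: bc_sub W2|exact: bc_cst].
    - by move=> k; exact: (bc_sub sO (W3 k)).
  apply: (energy_empty dO' tz _ _ (x := x)) => //.
    by move=> y [_ /=]; rewrite subr_gt0.
  rewrite (W5 O' _ _ iO tz) oppr_le0; apply: IO_ge0 => //.
    apply: bcM; last exact: bc_sub W4.
    by apply: bcB; [exact: bc_sub W2|exact: bc_cst].
  move=> y [_ /= hy]; rewrite k0 mul0r subr0; apply: mulr_ge0.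
    by rewrite subr_ge0 ltW.
  by apply: mulr_ge0 => //; exact: T0sq_ge0.
have P0 x : O x -> Pt x <= 0.
  move=> Ox; rewrite leNgt; apply/negP => h.
  have h2 : 0 < Pt x / 2 by rewrite divr_gt0.
  by have := Pd (Pt x / 2) x h2 Ox; lra.
have Pz x : O x -> Pt x = 0.
  move=> Ox; apply/eqP; rewrite -oppr_eq0; apply/eqP.
  apply: (IO_eq0 dO (bcN W2)) => //.
  - by move=> y Oy; rewrite oppr_ge0 P0.
  - by rewrite IO_N// IP oppr0.
have Pz' k x : O x -> P' k x = 0.
  move=> Ox; have [_ oO _] := dO.
  have [_ <-] := W1 k x Ox.
  rewrite (derive_eq_on (g := fun=> 0) k oO _ Ox) ?derive_cst// => y; exact: Pz.
(* The weak Laplacian can be tested on inner sets only. As the gradient [P'] is zero, a paraboloid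
   positive on a small ball around [x1] has integral 0 against [T0sq], which forces
   [T0sq u x1 = 0]. *)
move=> x1 Ox1; have [n0 oO bO] := dO.
have [r0 r00 hr] : exists2 r : R, 0 < r & forall y, `|x1 - y| < r -> O y.
  have /nbhs_ballP[e e0 he] := open_nbhs_in oO Ox1.
  by exists e => // y xy; apply: he; rewrite -ball_normE.
pose r := r0 / 2; have rp : 0 < r by rewrite divr_gt0.
pose O' := O `&` [set x | 0 < paraboloid x1 r x].
have cq := @paraboloid_cont R n x1 r.
have oO' : open O'.
  apply: openI => //; apply: (open_comp (f := paraboloid x1 r) (D := [set t | 0 < t])).
    by move=> y _; exact: cq.
  exact: open_gt.
have cO' : closure O' `<=` O.
  move=> y cy; apply: hr; rewrite distrC; apply: (@le_lt_trans _ _ r); last by rewrite /r; lra.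
  apply: paraboloid_pos => //; apply: (closure_ge cy (cq y)) => t [_ /= h]; exact: ltW.
have bO' : bset O' by have [B B0 hB] := bO; exists B => // x [/hB].
have iO : inner O' O by split.
have sO := inner_sub iO; have [dO' _] := iO.
have bq : bc O' (paraboloid x1 r) by apply: (inner_bc iO) => x _; exact: cq.
have tz : test O' (paraboloid x1 r) (fun k x => -2 * (x ord0 k - x1 ord0 k)).
  split.
  - by move=> x k _; exact: paraboloid_d.
  - exact: bq.
  - by move=> k; apply: bcZ; apply: bcB; [exact: bc_coord|exact: bc_cst].
  - apply: vanish_level => // [x _|x [_ //]|x [cx nx]]; first exact: cq.
    by rewrite leNgt; apply/negP => h; apply: nx; split=> //; exact: cO'.
have H := W5 O' _ _ iO tz.
have H0 : IO O' (fun x => paraboloid x1 r x * (2 * T0sq u x - kap R n * wd [::] x ^+ 2)) = 0.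
  apply/eqP; rewrite -oppr_eq0 -H big1// => k _.
  by rewrite -[RHS](IO_0 O'); apply: IO_eq => x Ox; rewrite Pz' ?mulr0//; exact: sO.
have Ox1' : O' x1.
  split=> //=; rewrite /paraboloid big1 ?subr0 ?exprn_gt0// => i _.
  by rewrite subrr expr0n.
have := IO_eq0 dO' (bcM bq (bc_sub sO W4)) _ H0 Ox1'.
rewrite k0 mul0r subr0 => h.
have /eqP : paraboloid x1 r x1 * (2 * T0sq u x1) = 0.
  apply: h => x [_ /= px]; rewrite mul0r subr0; apply: mulr_ge0; first exact: ltW.
  by apply: mulr_ge0 => //; exact: T0sq_ge0.
rewrite mulf_eq0 (gt_eqF Ox1'.2)/= mulf_eq0 => /orP[|/eqP//].
by rewrite (pnatr_eq0 R 2).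
Qed.

End PBoundary.

(** * Maximum principle, and limits of integrals over growing subdomains *)

Section Comparison.
Variables (R : realType) (n : nat).
Notation V := 'rV[R]_n.
Notation eb := (ebasis R).
Implicit Types (F G z : V -> R) (O : set V) (x y : V) (i j k : 'I_n) (l d : R).

Lemma isdV F x v a : F x != 0 -> is_derive x v F a ->
  is_derive x v (fun y => (F y)^-1) (- (a * (F x)^-1 * (F x)^-1)).
Proof.
move=> F0 [h1 h2]; have dV := derivableV F0 h1.
have := deriveV F0 h1; rewrite h2 => e.
by split => //; rewrite e expr2 invfM -[_ *: _]/(_ * _); ring.
Qed.

Lemma open_superlevel O F d : open O -> (forall x, O x -> {for x, continuous F}) ->
  open (O `&` [set x | d < F x]).
Proof.
move=> oO cF; rewrite openE => x [Ox /= Fx].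
have e0 : 0 < (F x - d) / 2 by rewrite divr_gt0// subr_gt0.
have /cvg_rowP/(_ _ e0) nF := cF x Ox.
apply: filterS2 (open_nbhs_in oO Ox) nF => y Oy /=.
by rewrite ler_norml => /andP[h1 h2]; split=> //=; lra.
Qed.

Lemma max_principle O z (z' z'' : 'I_n -> V -> R) : odom O -> test O z z' ->
  (forall k x, O x -> is_derive x (eb k) (z' k) (z'' k x)) -> (forall k, bc O (z'' k)) ->
  (forall x, O x -> 0 < z x) -> (forall x, O x -> 0 <= \sum_k z'' k x) -> forall x, ~ O x.
Proof.
move=> dO tz dz' bz'' z0 sz; have [t1 t2 t3 t4] := tz.
apply: (energy_empty dO tz z0).
rewrite (eq_bigr (fun k => - IO O (fun x => z x * z'' k x))); last first.
  move=> k _; apply/eqP; rewrite -addr_eq0; apply/eqP.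
  by apply: (@ibp R n O k z (z' k) (z' k) (z'' k) dO) => // x Ox; exact: dz'.
rewrite sumrN oppr_le0 -IO_sum//; last by move=> k; exact: bcM.
apply: IO_ge0 => //; first by apply: bc_sum => k; exact: bcM.
by move=> x Ox; rewrite -mulr_sumr mulr_ge0 ?sz// ltW// z0.
Qed.

Lemma IO_level_dct O (Om : nat -> set V) (F : nat -> V -> R) G (M : R) : odom O ->
  (forall m, inner (Om m) O) -> 0 <= M ->
  (forall m x, Om m x -> {for x, continuous (F m)} /\ `|F m x| <= M) ->
  (forall x, O x -> (\forall m \near \oo, Om m x) /\ F ^~ x @ \oo --> G x) ->
  (fun m => IO (Om m) (F m)) @ \oo --> IO O G.
Proof.
move=> [n0 oO [B B0 OB]] iO M0 hF FG.
rewrite IOE (_ : (fun m => IO (Om m) (F m)) = (fun m => Int (fun x => \1_(Om m) x * F m x))); last first.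
  by apply/funext => m; rewrite IOE.
apply: (@Int_dct R n M B (fun m x => \1_(Om m) x * F m x) (fun x => \1_O x * G x) _ _).2.
  move=> m; have [[_ om _] _] := iO m.
  by apply: gd_ind => // x Ox; [apply: OB; exact: (inner_sub (iO m))|case: (hF m x Ox)|case: (hF m x Ox)].
move=> x; case: (EM (O x)) => Ox; last first.
  rewrite ind0// mul0r (_ : (fun _ => _) = fun=> 0); first exact: cvg_cst.
  by apply/funext => m; rewrite ind0 ?mul0r// => /(inner_sub (iO m)).
have [h1 h2] := FG x Ox; rewrite ind1// mul1r.
apply: cvg_trans h2; apply: near_eq_cvg.
by apply: filterS h1 => m hm; rewrite ind1// mul1r.
Qed.

End Comparison.

(** * The torsion function and its superlevel sets *)

Section Torsion.
Variables (R : realType) (n : nat).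
Notation V := 'rV[R]_n.
Notation eb := (ebasis R).
Notation nn := (n%:R : R).
Variables (O : set V) (u : V -> R) (c : R).
Hypothesis J : jet O u c.
Let dO : odom O := jet_dom J.
Variable gam : V -> R.
Hypothesis tg : torsion_function O gam.
Notation wd := (wd u).
Implicit Types (x y : V) (i j k : 'I_n) (d : R).

Let oO : open O. Proof. by case: dO. Qed.
Let g k := pd [:: k] gam.
Let g2 k := pd [:: k; k] gam.

Lemma gam_cont x : O x -> {for x, continuous gam}.
Proof. by case: tg => Cg _ Ox; exact: (Ck_cont (s := [::]) Cg). Qed.

Lemma gam_d k x : O x -> is_derive x (eb k) gam (g k x).
Proof. by case: tg => Cg _ Ox; exact: (Ck_derive (s := [::]) k Cg). Qed.

Lemma gam_d2 k x : O x -> is_derive x (eb k) (g k) (g2 k x).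
Proof. by case: tg => Cg _ Ox; exact: (Ck_derive (s := [:: k]) k Cg). Qed.

Lemma g_cont k x : O x -> {for x, continuous (g k)}.
Proof. by case: tg => Cg _ Ox; exact: (Ck_cont (s := [:: k]) Cg). Qed.

Lemma g2_cont k x : O x -> {for x, continuous (g2 k)}.
Proof. by case: tg => Cg _ Ox; exact: (Ck_cont (s := [:: k; k]) Cg). Qed.

Arguments gam_d k [x] _.
Arguments gam_d2 k [x] _.
Arguments g_cont k [x] _.
Arguments g2_cont k [x] _.

Lemma g2_sum x : O x -> \sum_k g2 k x = -1.
Proof. by case: tg => _ [_ [h _]] /h <-. Qed.

Lemma gam_vanish : vanish O gam.
Proof.
case: tg => _ [cg [_ g0]] x bx.
have := @within_closure_tends R n O gam gam x cg (fun _ _ => erefl) (proj1 bx).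
by rewrite /tends g0.
Qed.

Lemma gam_bc : bc O gam.
Proof.
split; first exact: gam_cont.
by case: tg => _ [cg _]; case: dO => _ _ bO; exact: (within_closure_bc bO cg).
Qed.

(** If [gam] were negative somewhere, [- gam - d] would be positive on a nonempty inner set, vanish
    on its boundary and have Laplacian 1, against [max_principle]. *)
Lemma gam_ge0 x : O x -> 0 <= gam x.
Proof.
move=> Ox; rewrite leNgt; apply/negP => gx.
pose d := - gam x / 2.
have d0 : 0 < d by rewrite divr_gt0// oppr_gt0.
have cN y : O y -> {for y, continuous (fun y => - gam y)}.
  by move=> Oy; exact: continuousN (gam_cont Oy).
have vN : vanish O (fun y => - gam y).
  by move=> y by_; have := tendsZ (b := -1) (gam_vanish by_); rewrite mulr0; congr tends; apply/funext => t; rewrite mulN1r.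
have [iO vz] := superlevel_inner dO cN vN d0; set O' := O `&` _ in iO vz.
have sO := inner_sub iO; have [dO' _] := iO.
have := @max_principle R n O' (fun y => - gam y - d) (fun k y => - g k y) (fun k y => - g2 k y) dO'.
move=> /(_ _ _ _ _ _ x); apply.
- split => //.
  + move=> y k /sO Oy; have := isdB (isdN (gam_d k Oy)) (isdC y (eb k) d).
    by rewrite subr0.
  + by apply: (inner_bc iO) => y Oy; apply: continuousB; [exact: cN|exact: cst_continuous].
  + by move=> k; apply: (inner_bc iO) => y Oy; exact: continuousN (g_cont k Oy).
- by move=> k y /sO Oy; apply: isdN; exact: gam_d2.
- by move=> k; apply: (inner_bc iO) => y Oy; exact: continuousN (g2_cont k Oy).
- by move=> y [_ /=]; rewrite subr_gt0.
- by move=> y /sO Oy; rewrite sumrN g2_sum// opprK.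
- by split=> //=; rewrite /d; lra.
Qed.

(** The paraboloid over [2 * nn] has Laplacian [-1] as well, so its difference [h] with [gam] is
    harmonic. By [gam_ge0], [h] can be positive only inside the ball, and the maximum principle
    excludes that. *)
Lemma gam_gt0 x : O x -> 0 < gam x.
Proof.
move=> Ox; have [n0 _ bO] := dO.
have n0' : 0 < nn by rewrite ltr0n.
have [r0 r00 hr] : exists2 r : R, 0 < r & forall y, `|x - y| < r -> O y.
  have /nbhs_ballP[e e0 he] := open_nbhs_in oO Ox.
  by exists e => // y xy; apply: he; rewrite -ball_normE.
pose r := r0 / 2; have rp : 0 < r by rewrite divr_gt0.
pose q y := (2 * nn)^-1 * paraboloid x r y.
have n20 : 0 < (2 * nn)^-1 by rewrite invr_gt0 mulr_gt0.
have cq y : {for y, continuous q}.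
  by apply: continuousM; [exact: cst_continuous|exact: paraboloid_cont].
pose h y := q y - gam y.
have ch y : O y -> {for y, continuous h}.
  by move=> /gam_cont; apply: continuousB; exact: cq.
suff : h x <= 0.
  rewrite /h subr_le0; apply: lt_le_trans.
  rewrite mulr_gt0// /paraboloid big1 ?subr0 ?exprn_gt0// => i _.
  by rewrite subrr expr0n.
rewrite leNgt; apply/negP => hx.
pose O' := O `&` [set y | 0 < h y].
have cO' : closure O' `<=` O.
  move=> y cy; apply: hr; rewrite distrC; apply: (@le_lt_trans _ _ r); last by rewrite /r; lra.
  apply: paraboloid_pos => //; apply: (closure_ge cy (@paraboloid_cont R n x r y)) => t [Ot /= ht].
  have := gam_ge0 Ot; move: ht; rewrite /h /q subr_gt0 => h1 h2.
  have : 0 < (2 * nn)^-1 * paraboloid x r t by exact: le_lt_trans h1.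
  by rewrite pmulr_rgt0// => /ltW.
have bO' : bset O' by have [B B0 hB] := bO; exists B => // y [/hB].
have iO : inner O' O by split=> //; split=> //; exact: open_superlevel.
have sO := inner_sub iO; have [dO' _] := iO.
have := @max_principle R n O' h (fun k y => (2 * nn)^-1 * (-2 * (y ord0 k - x ord0 k)) - g k y)
   (fun k y => (2 * nn)^-1 * (-2 * 1) - g2 k y) dO'.
move=> /(_ _ _ _ _ _ x); apply.
- split.
  + by move=> y k /sO Oy; apply: isdB; [apply: isdZ; exact: paraboloid_d|exact: gam_d].
  + by apply: (inner_bc iO) => y Oy; exact: ch.
  + move=> k; apply: bcB; last by apply: (inner_bc iO) => y /(g_cont k).
    by do 2 apply: bcZ; apply: bcB; [exact: bc_coord|exact: bc_cst].
  + apply: vanish_level => [y [/cO' Oy _]|y [_ //]|y [/cO' Oy nO]]; first exact: ch.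
    by rewrite leNgt; apply/negP => hy; apply: nO.
- move=> k y /sO Oy; apply: isdB; last exact: gam_d2.
  apply: isdZ; apply: isdZ.
  have := isdB (isd_coord y k k) (isdC y (eb k) (x ord0 k)).
  by rewrite eqxx subr0.
- move=> k; apply: bcB; last by apply: (inner_bc iO) => y /(g2_cont k).
  exact: bc_cst.
- by move=> y [].
- move=> y /sO Oy; rewrite sumrB g2_sum// sumr_const card_ord -(mulr_natl ((2 * nn)^-1 * (-2 * 1)) n).
  have -> : nn * ((2 * nn)^-1 * (-2 * 1)) = -1 by field; rewrite gt_eqF.
  by rewrite subrr.
- by split.
Qed.

Section Level.
Variable d : R.
Hypothesis d0 : 0 < d.
Let O' := O `&` [set x | d < gam x].
(* ph = (gam - d)^3 / gam^2 on {gam > d} replaces gam as a multiplier, gam being only C^2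
   inside: it is a convex function of gam which vanishes to third order on {gam = d} and
   tends to gam as d -> 0. ph1 and ph2 are its derivatives with respect to gam. *)
Definition lev x := gam x - d.
Definition ig x := (gam x)^-1.
Definition ph x := lev x * lev x * lev x * ig x * ig x.
Definition ph1 x := lev x * lev x * (gam x + 2 * d) * ig x * ig x * ig x.
Definition ph2 x := 6 * d * d * lev x * ig x * ig x * ig x * ig x.
Definition gsq x := \sum_k g k x * g k x.

Lemma lev_inner : inner O' O /\ vanish O' lev.
Proof. exact: (superlevel_inner dO gam_cont gam_vanish d0). Qed.

Lemma ig_cont x : O x -> {for x, continuous ig}.
Proof. by move=> Ox; apply: continuousV; [rewrite gt_eqF// gam_gt0|exact: gam_cont]. Qed.

Lemma lev_cont x : O x -> {for x, continuous lev}.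
Proof. by move=> Ox; apply: continuousB; [exact: gam_cont|exact: cst_continuous]. Qed.

Lemma lev_d k x : O x -> is_derive x (eb k) lev (g k x).
Proof. by move=> Ox; have := isdB (gam_d k Ox) (isdC x (eb k) d); rewrite subr0. Qed.

Lemma ig_d k x : O x -> is_derive x (eb k) ig (- (g k x * ig x * ig x)).
Proof. by move=> Ox; apply: isdV; [rewrite gt_eqF// gam_gt0|exact: gam_d]. Qed.

Lemma ph_d k x : O x -> is_derive x (eb k) ph (ph1 x * g k x).
Proof.
move=> Ox; have g0 : gam x != 0 by rewrite gt_eqF// gam_gt0.
have L := lev_d k Ox; have I := ig_d k Ox.
have := isdM (isdM (isdM (isdM L L) L) I) I; congr is_derive.
by rewrite /ph1 /lev /ig; field.
Qed.

Lemma ph1_d k x : O x -> is_derive x (eb k) ph1 (ph2 x * g k x).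
Proof.
move=> Ox; have g0 : gam x != 0 by rewrite gt_eqF// gam_gt0.
have L := lev_d k Ox; have I := ig_d k Ox.
have A := isdD (gam_d k Ox) (isdC x (eb k) (2 * d)).
have := isdM (isdM (isdM (isdM (isdM L L) A) I) I) I; congr is_derive.
by rewrite /ph2 /lev /ig; field.
Qed.

Lemma cc_ph : [/\ forall x, O x -> {for x, continuous ph},
  forall x, O x -> {for x, continuous ph1} & forall x, O x -> {for x, continuous ph2}].
Proof.
split=> x Ox; have L := lev_cont Ox; have I := ig_cont Ox; have G := gam_cont Ox.
- exact: (continuousM (continuousM (continuousM (continuousM L L) L) I) I).
- have A : {for x, continuous (fun y => gam y + 2 * d)}.
    by apply: continuousD => //; exact: cst_continuous.
  exact: (continuousM (continuousM (continuousM (continuousM (continuousM L L) A) I) I) I).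
- have A : {for x, continuous (fun y => 6 * d * d * lev y)}.
    by apply: continuousM => //; exact: cst_continuous.
  exact: (continuousM (continuousM (continuousM (continuousM A I) I) I) I).
Qed.

Lemma ph_bound x : O' x -> [/\ 0 <= ph x <= gam x, 0 <= ph1 x <= 1 &
  0 <= ph2 x <= 6 * d * d * ig x * ig x * ig x].
Proof.
move=> [Ox /= gd]; have d1 := d0; have g0 : 0 < gam x by exact: lt_trans gd.
have l0 : 0 <= lev x by rewrite /lev; lra.
have i0 : 0 <= ig x by rewrite invr_ge0 ltW.
have gi : gam x * ig x = 1 by rewrite mulfV// gt_eqF.
have lg : lev x <= gam x by rewrite /lev; move: d0; lra.
have li1 : lev x * ig x <= 1 by rewrite -gi ler_wpM2r.
have li0 : 0 <= lev x * ig x by exact: mulr_ge0.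
split; apply/andP; split.
- by rewrite !mulr_ge0.
- have -> : ph x = lev x * ((lev x * ig x) * (lev x * ig x)) by rewrite /ph; ring.
  apply: (@le_trans _ _ (lev x)); last by rewrite /lev; lra.
  by rewrite ler_piMr// mulr_ile1.
- by rewrite !mulr_ge0//; lra.
- have -> : ph1 x = (gam x * ig x) * (gam x * ig x) * (gam x * ig x)
     - (3 * gam x - 2 * d) * d * d * ig x * ig x * ig x by rewrite /ph1 /lev; ring.
  rewrite gi !mulr1 lerBlDr lerDl !mulr_ge0//; lra.
- by rewrite !mulr_ge0//; lra.
- have -> : ph2 x = 6 * d * d * ig x * ig x * ig x * (lev x * ig x) by rewrite /ph2; ring.
  by rewrite ler_piMr// !mulr_ge0//; lra.
Qed.

Let iO : inner O' O. Proof. by case: lev_inner. Qed.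
Let sO := inner_sub iO.
Let dO' : odom O'. Proof. by case: iO. Qed.
Let bci F : (forall x, O x -> {for x, continuous F}) -> bc O' F.
Proof. exact: inner_bc. Qed.

(** The gradient of [ph] is [ph1] times that of [gam], and the divergence of this field is
    [ph2 * gsq - ph1] because [lap gam = -1]. Integrating the field by parts against [Pt], and using
    [ph] as a test function in the weak Laplacian, gives the first identity; integrating it against
    the constant 1 gives the second. *)
Lemma level_identity : IO O' (fun x => ph x * (2 * T0sq u x - kap R n * wd [::] x ^+ 2)) +
  IO O' (fun x => ph1 x * Pt u c x) = IO O' (fun x => ph2 x * gsq x * Pt u c x) /\
  IO O' (fun x => ph2 x * gsq x) = IO O' ph1.
Proof.
have [P' [W1 W2 W3 W4 W5]] := Pt_weak J.
have [_ vl] := lev_inner; have [c1 c2 c3] := cc_ph.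
have bph := bci c1; have bph1 := bci c2; have bph2 := bci c3.
have bg k := bci (g_cont k); have bg2 k := bci (g2_cont k).
have bL := bci lev_cont; have bI := bci ig_cont; have bG := bci gam_cont.
have bP : bc O' (Pt u c) by exact: (bc_sub sO W2).
have bP' k : bc O' (P' k) by exact: (bc_sub sO (W3 k)).
have b1 (a : R) : bc O' (fun=> a) := bc_cst O' a.
have vph : vanish O' ph.
  have -> : ph = (fun x => lev x * (lev x * lev x * ig x * ig x)).
    by apply/funext => x; rewrite /ph; ring.
  by apply: vanishM => //; exact: bcM (bcM (bcM bL bL) bI) bI.
pose z' k x := ph1 x * g k x.
pose z2 k x := ph2 x * g k x * g k x + ph1 x * g2 k x.
have bz' k : bc O' (z' k) by exact: bcM.
have bz2 k : bc O' (z2 k).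
  exact: bcD (bcM (bcM bph2 (bg k)) (bg k)) (bcM bph1 (bg2 k)).
have vz' k : vanish O' (z' k).
  have -> : z' k = (fun x => lev x * (lev x * (gam x + 2 * d) * ig x * ig x * ig x * g k x)).
    by apply/funext => x; rewrite /z' /ph1; ring.
  by apply: vanishM => //; exact: bcM (bcM (bcM (bcM (bcM bL (bcD bG (b1 _))) bI) bI) bI) (bg k).
have tz : test O' ph z' by split => // x k /sO; exact: ph_d.
have dz' k x : O' x -> is_derive x (eb k) (z' k) (z2 k x).
  by move=> /sO Ox; apply: isdM; [exact: ph1_d|exact: gam_d2].
have bgs : bc O' gsq by apply: bc_sum => k; exact: bcM.
have z2s x : O' x -> \sum_k z2 k x = ph2 x * gsq x - ph1 x.
  move=> /sO Ox; rewrite /z2 big_split/= -mulr_sumr g2_sum// mulrN1; congr (_ - _).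
  by rewrite mulr_sumr; apply: eq_bigr => k _; rewrite mulrA.
have H1 := W5 O' ph z' iO tz.
have H2 k : IO O' (fun x => z2 k x * Pt u c x) + IO O' (fun x => z' k x * P' k x) = 0.
  by apply: (@ibp R n O' k (z' k) (Pt u c) (z2 k) (P' k) dO') => // x Ox; apply: W1; exact: sO.
have H3 k : IO O' (fun x => z2 k x * 1) + IO O' (fun x => z' k x * 0) = 0.
  by apply: (@ibp R n O' k (z' k) (fun=> 1) (z2 k) (fun=> 0) dO') => // x Ox; exact: isdC.
have S3' : \sum_k IO O' (z2 k) = 0.
  apply: big1 => k _; rewrite -[RHS](H3 k).
  rewrite (IO_eq (F := fun x => z' k x * 0) (G := fun=> 0)) ?IO_0 ?addr0; last by move=> x _; rewrite mulr0.
  by apply: IO_eq => x _; rewrite mulr1.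
have S2 : \sum_k IO O' (fun x => z2 k x * Pt u c x) =
    IO O' (fun x => ph x * (2 * T0sq u x - kap R n * wd [::] x ^+ 2)).
  apply/eqP; rewrite -subr_eq0 -H1 -big_split/=; apply/eqP; apply: big1 => k _; exact: H2.
have bppp : bc O' (fun x => ph2 x * gsq x) by exact: bcM.
split.
  rewrite -S2 -IO_sum//; last by move=> k; exact: bcM.
  rewrite -IO_D//; [|by apply: bc_sum => k; exact: bcM|exact: bcM].
  by apply: IO_eq => x Ox; rewrite -mulr_suml z2s//; ring.
apply/eqP; rewrite -subr_eq0 -IO_B//; apply/eqP; rewrite -[RHS]S3' -IO_sum//.
by apply: IO_eq => x Ox; rewrite z2s.
Qed.

Lemma IO_sub_le F : bc O F -> (forall x, O x -> 0 <= F x) -> IO O' F <= IO O F.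
Proof.
move=> bF F0; have [c1 [B1 g1]] := bc_gd dO bF.
have [c2 [B2 g2']] := bc_gd dO' (bc_sub sO bF).
rewrite !IOE; apply: (Int_le g2' g1) => x.
case: (EM (O' x)) => Ox; first by rewrite !ind1//; exact: sO.
rewrite (ind0 Ox) mul0r; case: (EM (O x)) => Ox'; first by rewrite ind1// mul1r F0.
by rewrite ind0// mul0r.
Qed.

(* ph2 |D gam|^2 has mass at most |O|; where it is not controlled by gam >= tau, |Pt| is
   at most eps. *)
Lemma level_error eps tau G M : 0 < eps -> 0 < tau -> 0 <= G -> 0 <= M ->
  (forall x, O x -> `|Pt u c x| <= M) ->
  (forall x, O x -> eps < `|Pt u c x| -> tau <= gam x /\ gsq x <= G) ->
  `|IO O' (fun x => ph2 x * gsq x * Pt u c x)| <=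
    eps * vol O + 6 * d * d * tau^-1 * tau^-1 * tau^-1 * G * M * vol O.
Proof.
move=> e0 t0 G0 M0 hM hK.
have [P' [W1 W2 W3 W4 W5]] := Pt_weak J.
have [c1 c2 c3] := cc_ph.
have bph1 := bci c2; have bph2 := bci c3.
have bg k := bci (g_cont k).
have bP : bc O' (Pt u c) by exact: (bc_sub sO W2).
have bgs : bc O' gsq by apply: bc_sum => k; exact: bcM.
have b2g : bc O' (fun x => ph2 x * gsq x) by exact: bcM.
set C := 6 * d * d * tau^-1 * tau^-1 * tau^-1 * G * M.
have C0 : 0 <= C by rewrite /C !mulr_ge0// ?invr_ge0 ltW.
have b1 : bc O' (fun=> 1) := bc_cst O' 1.
have gs0 x : 0 <= gsq x by apply: sumr_ge0 => k _; rewrite -expr2 sqr_ge0.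
have pt x : O' x -> `|ph2 x * gsq x * Pt u c x| <= eps * (ph2 x * gsq x) + C * 1.
  move=> Ox; have Ox' := sO Ox; have [_ _ /andP[p0 p1]] := ph_bound Ox.
  rewrite normrM (ger0_norm (mulr_ge0 p0 (gs0 x))) mulr1.
  have [h|h] := leP `|Pt u c x| eps.
    rewrite mulrC; apply: (@le_trans _ _ (eps * (ph2 x * gsq x))); last by rewrite lerDl.
    by rewrite ler_wpM2r// mulr_ge0.
  have [h1 h2] := hK x Ox' h.
  apply: (@le_trans _ _ C); last by rewrite lerDr (mulr_ge0 (ltW e0) (mulr_ge0 p0 (gs0 x))).
  have gi0 : 0 <= ig x by rewrite invr_ge0 gam_ge0.
  have git : ig x <= tau^-1 by rewrite lef_pV2 ?posrE ?gam_gt0.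
  have ti0 : 0 <= tau^-1 by rewrite invr_ge0 ltW.
  have dd : 0 <= 6 * d * d by rewrite !mulr_ge0// ltW.
  have m1 := ler_pM dd gi0 (lexx _) git.
  have m2 := ler_pM (mulr_ge0 dd gi0) gi0 m1 git.
  have m3 := ler_pM (mulr_ge0 (mulr_ge0 dd gi0) gi0) gi0 m2 git.
  have m4 := ler_pM p0 (gs0 x) (le_trans p1 m3) h2.
  exact: (ler_pM (mulr_ge0 p0 (gs0 x)) (normr_ge0 _) m4 (hM x Ox')).
have bnd : IO O' (fun x => eps * (ph2 x * gsq x) + C * 1) <= eps * vol O + C * vol O.
  rewrite IO_D//; [|exact: bcZ|exact: bcZ]; rewrite !IO_Z//.
  have [_ ->] := level_identity.
  have v1 : IO O' (fun=> 1) <= vol O by apply: IO_sub_le => //; exact: bc_cst.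
  apply: lerD; apply: ler_wpM2l => //; first exact: ltW.
  apply: le_trans v1; apply: IO_le => // x Ox; by have [_ /andP[]] := ph_bound Ox.
have bRHS : bc O' (fun x => eps * (ph2 x * gsq x) + C * 1) by apply: bcD; exact: bcZ.
have bL : bc O' (fun x => ph2 x * gsq x * Pt u c x) by exact: bcM.
apply: le_trans bnd; rewrite ler_norml; apply/andP; split; last first.
  by apply: IO_le => // x Ox; apply: le_trans (pt x Ox); exact: ler_norm.
rewrite lerNl -IO_N//; apply: IO_le => //; first exact: bcN.
by move=> x Ox; apply: le_trans (pt x Ox); rewrite -normrN; exact: ler_norm.
Qed.

End Level.

End Torsion.

(** * Green's formula for P and the torsion function *)

Section TorsionLimit.
Variables (R : realType) (n : nat).
Notation V := 'rV[R]_n.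
Notation nn := (n%:R : R).
Variables (O : set V) (u : V -> R) (c : R).
Hypothesis J : jet O u c.
Let dO : odom O := jet_dom J.
Variable gam : V -> R.
Hypothesis tg : torsion_function O gam.
Let LP x := 2 * T0sq u x - kap R n * wd u [::] x ^+ 2.
Let d (m : nat) : R := harmonic m.
Let Om m := O `&` [set x | d m < gam x].

Let d_gt0 m : 0 < d m. Proof. exact: harmonic_gt0. Qed.
Let d_cvg : d @ \oo --> 0. Proof. exact: cvg_harmonic. Qed.

Let Om_inner m : inner (Om m) O.
Proof. by case: (lev_inner J tg (d_gt0 m)). Qed.

Let Om_near x : O x -> \forall m \near \oo, Om m x.
Proof.
move=> Ox; have g0 := gam_gt0 J tg Ox.
by apply: filterS (cvgr_lt _ d_cvg _ g0) => m hm.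
Qed.

Lemma level_error_cvg0 :
  (fun m => IO (Om m) (fun x => ph2 gam (d m) x * gsq gam x * Pt u c x)) @ \oo --> 0.
Proof.
have [P' [_ bP _ _ _]] := Pt_weak J.
have [cP [M M0 hM]] := bP.
have v0 : 0 <= vol O by apply: IO_ge0 => //; exact: bc_cst.
have cgs x : O x -> {for x, continuous (gsq gam)}.
  move=> Ox; have h (s : seq 'I_n) : {for x, continuous (fun y : V => \sum_(k <- s) pd [:: k] gam y * pd [:: k] gam y)}.
    elim: s => [|i s IH].
      by rewrite (_ : (fun _ => _) = fun=> 0); [exact: cst_continuous|apply/funext => y; rewrite big_nil].
    rewrite (_ : (fun _ => _) = (fun y : V => pd [:: i] gam y * pd [:: i] gam y +
       \sum_(k <- s) pd [:: k] gam y * pd [:: k] gam y)); last by apply/funext => y; rewrite big_cons.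
    by apply: continuousD => //; have h1 := @g_cont R n O gam tg i x Ox; exact: (continuousM h1 h1).
  exact: h.
have vP2 : vanish O (fun x => Pt u c x * Pt u c x) by apply: vanishM => //; exact: Pt_vanish.
have cP2 x : O x -> {for x, continuous (fun x => Pt u c x * Pt u c x)}.
  by move=> Ox; have h1 := cP x Ox; exact: (continuousM h1 h1).
apply/cvgrPdist_le => e e0; pose eps := e / (2 * (vol O + 1)).
have v1 : 0 < 2 * (vol O + 1) by rewrite mulr_gt0// ltr_wpDl.
have eps0 : 0 < eps by rewrite divr_gt0.
(* The set where [|Pt| > eps] is written with squares. As [Pt] vanishes at the boundary it is an
   inner set, on which [gam] has a positive lower bound [tau] and [gsq] an upper bound [G]. *)
have [iK _] := superlevel_inner dO cP2 vP2 (mulr_gt0 eps0 eps0).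
set K := O `&` _ in iK.
have [_ [G G0 hG]] := inner_bc iK cgs.
have [_ [I I0 hI]] := inner_bc iK (@ig_cont R n O u c J gam tg).
pose tau := (I + 1)^-1; have I1 : 0 < I + 1 by rewrite ltr_wpDl.
have t0 : 0 < tau by rewrite invr_gt0.
have hK x : O x -> eps < `|Pt u c x| -> tau <= gam x /\ gsq gam x <= G.
  move=> Ox hx; have Kx : K x.
    split=> //=; rewrite -(ger0_norm (_ : 0 <= Pt u c x * Pt u c x)); last by rewrite -expr2 sqr_ge0.
    by rewrite normrM ltr_pM// ltW.
  split; last by apply: le_trans (hG x Kx); exact: ler_norm.
  have g0 := gam_gt0 J tg Ox; rewrite -[gam x]invrK /tau lef_pV2 ?posrE ?invr_gt0//.
  by apply: (le_trans (ler_norm _)); apply: (le_trans (hI x Kx)); rewrite lerDl.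
have bnd m := @level_error R n O u c J gam tg (d m) (d_gt0 m) eps tau G M eps0 t0 G0 M0 hM hK.
set f := fun m => eps * vol O + 6 * d m * d m * tau^-1 * tau^-1 * tau^-1 * G * M * vol O.
have ef : eps * vol O < e.
  rewrite /eps mulrAC ltr_pdivrMr// ltr_pM2l//; lra.
have cf : f @ \oo --> eps * vol O.
  have -> : f = (fun m => eps * vol O + d m * d m * (6 * tau^-1 * tau^-1 * tau^-1 * G * M * vol O)).
    by apply/funext => m; rewrite /f; ring.
  rewrite -[X in _ --> X]addr0 -[X in _ --> _ + X](mul0r (6 * tau^-1 * tau^-1 * tau^-1 * G * M * vol O)).
  apply: cvgD; first exact: cvg_cst.
  by apply: cvgM; [rewrite -[X in _ --> X](mul0r 0); exact: cvgM|exact: cvg_cst].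
apply: filterS (cvgr_lt _ cf _ ef) => m hm.
by rewrite sub0r normrN; apply: (le_trans (bnd m)); exact: ltW.
Qed.

Lemma ph_bnd m x : Om m x -> [/\ `|ph gam (d m) x| <= gam x & `|ph1 gam (d m) x| <= 1].
Proof.
by move=> h; have [/andP[a0 a1] /andP[b0 b1] _] := ph_bound (d_gt0 m) h; rewrite !ger0_norm.
Qed.

(** Both [gam] and [Pt] vanish on the boundary, so the Laplacian can pass from [Pt] to [gam], where
    it is [-1]. This is the limit of [level_identity], in which [ph] tends to [gam] and [ph1] to
    1. *)
Lemma torsion_identity : IO O (fun x => gam x * LP x) = - IO O (Pt u c).
Proof.
have [P' [_ bP _ bL _]] := Pt_weak J.
have [cP [M M0 hM]] := bP; have [cL [M' M'0 hM']] := bL.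
have [cg [B B0 hB]] := gam_bc J tg.
have A : (fun m => IO (Om m) (fun x => ph gam (d m) x * LP x)) @ \oo --> IO O (fun x => gam x * LP x).
  apply: (@IO_level_dct R n O Om (fun m x => ph gam (d m) x * LP x) _ (B * M') dO Om_inner).
  - exact: mulr_ge0.
  - move=> m x Omx; have [Ox _] := Omx; have [h1 _] := ph_bnd Omx; split.
      have [c1 _ _] := cc_ph J tg (d m).
      by have h2 := c1 x Ox; have h3 := cL x Ox; exact: (continuousM h2 h3).
    rewrite normrM ler_pM//; last exact: hM'.
    by apply: (le_trans h1); apply: le_trans (hB x Ox); exact: ler_norm.
  - move=> x Ox; split; first exact: Om_near.
    have g0 : gam x != 0 by rewrite gt_eqF// (gam_gt0 J tg Ox).
    apply: cvgM; last exact: cvg_cst.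
    have -> : gam x = (gam x - 0) * (gam x - 0) * (gam x - 0) * (gam x)^-1 * (gam x)^-1 by field.
    have h : (fun m => gam x - d m) @ \oo --> gam x - 0 by apply: cvgB => //; exact: cvg_cst.
    by apply: cvgM; [apply: cvgM; [apply: cvgM; [exact: cvgM|]|exact: cvg_cst]|exact: cvg_cst].
have C : (fun m => IO (Om m) (fun x => ph1 gam (d m) x * Pt u c x)) @ \oo --> IO O (Pt u c).
  apply: (@IO_level_dct R n O Om (fun m x => ph1 gam (d m) x * Pt u c x) _ M dO Om_inner) => //.
  - move=> m x Omx; have [Ox _] := Omx; have [_ h1] := ph_bnd Omx; split.
      have [_ c1 _] := cc_ph J tg (d m).
      by have h2 := c1 x Ox; have h3 := cP x Ox; exact: (continuousM h2 h3).
    by rewrite normrM -[M]mul1r ler_pM//; exact: hM.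
  - move=> x Ox; split; first exact: Om_near.
    have g0 : gam x != 0 by rewrite gt_eqF// (gam_gt0 J tg Ox).
    rewrite -[X in _ --> X]mul1r; apply: cvgM; last exact: cvg_cst.
    have -> : 1 = (gam x - 0) * (gam x - 0) * (gam x + 2 * 0) * (gam x)^-1 * (gam x)^-1 * (gam x)^-1 by field.
    have h : (fun m => gam x - d m) @ \oo --> gam x - 0 by apply: cvgB => //; exact: cvg_cst.
    have h' : (fun m => gam x + 2 * d m) @ \oo --> gam x + 2 * 0.
      by apply: cvgD; [exact: cvg_cst|apply: cvgM => //; exact: cvg_cst].
    apply: cvgM; last exact: cvg_cst.
    apply: cvgM; last exact: cvg_cst.
    apply: cvgM; last exact: cvg_cst.
    by apply: cvgM => //; exact: cvgM.
have E : (fun m => IO (Om m) (fun x => ph gam (d m) x * LP x)) +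
   (fun m => IO (Om m) (fun x => ph1 gam (d m) x * Pt u c x)) =
   (fun m => IO (Om m) (fun x => ph2 gam (d m) x * gsq gam x * Pt u c x)).
  by apply/funext => m; have [<- _] := level_identity J tg (d_gt0 m).
have S : (fun m => IO (Om m) (fun x => ph2 gam (d m) x * gsq gam x * Pt u c x)) @ \oo -->
    IO O (fun x => gam x * LP x) + IO O (Pt u c).
  by rewrite -E; exact: (cvgD A C).
apply/eqP; rewrite -addr_eq0; apply/eqP.
rewrite -[RHS](cvg_lim (@Rhausdorff R) level_error_cvg0).
by apply/esym; exact: (cvg_lim (@Rhausdorff R) S).
Qed.

Lemma lap_lap_wd x : Ck_on 6 O u -> O x -> lap (lap u) x = wd u [::] x.
Proof.
move=> Cu Ox; have [_ oO _] := dO; apply: eq_bigr => a _.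
by rewrite (pd_lap (s := [:: a; a]) oO Cu)//; apply: eq_bigr => b _; rewrite dpE.
Qed.

Lemma T0_torsion : (3 <= n)%N -> Ck_on 6 O u ->
  (rv_integral (fun x => (\1_O x * (lap (lap u) x ^+ 2 * gam x))%:E)
     <= ((2 * (nn + 2) * c ^+ 2) / (nn + 6))%:E * volume O)%E ->
  forall x, O x -> T0sq u x = 0.
Proof.
move=> n3 Cu.
have [P' [_ bP _ bL _]] := Pt_weak J.
have bg := gam_bc J tg; have bT := T0sq_bc J.
have bw := wd_bc J (s := [::]) isT.
have bwg : bc O (fun x => wd u [::] x ^+ 2 * gam x).
  have -> : (fun x => wd u [::] x ^+ 2 * gam x) = (fun x => (wd u [::] x * wd u [::] x) * gam x).
    by apply/funext => x; rewrite expr2.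
  by apply: bcM => //; exact: bcM.
have -> : (fun x => (\1_O x * (lap (lap u) x ^+ 2 * gam x))%:E) =
          (fun x => (\1_O x * (wd u [::] x ^+ 2 * gam x))%:E).
  apply/funext => x; case: (EM (O x)) => Ox; last by rewrite ind0// !mul0r.
  by rewrite lap_lap_wd.
have [c1 [B1 g1]] := bc_gd dO bwg.
have [c2 [B2 g2]] := bc_gd dO (bc_cst O 1).
have -> : volume O = (vol O)%:E.
  rewrite /vol IOE -(rv_integral_Int g2) /volume; congr rv_integral.
  by apply/funext => x; rewrite mulr1.
rewrite (rv_integral_Int g1) -IOE -EFinM lee_fin => H.
have bTg : bc O (fun x => gam x * T0sq u x) by exact: bcM.
have I1 : IO O (fun x => gam x * LP x) = 2 * IO O (fun x => gam x * T0sq u x) -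
    kap R n * IO O (fun x => wd u [::] x ^+ 2 * gam x).
  rewrite -!IO_Z// -IO_B//; [|exact: bcZ|exact: bcZ].
  by apply: IO_eq => x _; rewrite /LP; ring.
have n3' : 3 <= nn by rewrite (ler_nat R 3).
have k0 : 0 <= kap R n.
  by rewrite /kap; apply: divr_ge0; rewrite !mulr_ge0//; lra.
have := torsion_identity; rewrite I1 (IO_Pt J) => ID.
have H2 := ler_wpM2l k0 H.
(* The bound of the hypothesis times [kap] is the integral of [Pt], so the inequality and
   [torsion_identity] leave [2 * IO O (gam * T0sq)] at most 0. *)
have E : kap R n * (2 * (nn + 2) * c ^+ 2 / (nn + 6) * vol O) =
   3 * nn * (nn - 2) / (2 * (nn + 4) * (nn + 6)) * c ^+ 2 * vol O.
  rewrite /kap; field.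
  by apply/and3P; split; rewrite gt_eqF//; lra.
have Z : IO O (fun x => gam x * T0sq u x) = 0.
  apply/eqP; rewrite eq_le; apply/andP; split; first by move: H2 ID; rewrite E; lra.
  by apply: IO_ge0 => // x Ox; rewrite mulr_ge0 ?T0sq_ge0// (gam_ge0 J tg Ox).
move=> x Ox; have := IO_eq0 dO bTg _ Z Ox => h.
have /eqP := h (fun y Oy => mulr_ge0 (gam_ge0 J tg Oy) (T0sq_ge0 u y)).
by rewrite mulf_eq0 (gt_eqF (gam_gt0 J tg Ox))/= => /eqP.
Qed.

End TorsionLimit.

(** * Integration of the rigid equations *)

Section Rigidity.
Variables (R : realType) (n : nat).
Notation V := 'rV[R]_n.
Notation eb := (ebasis R).
Notation nn := (n%:R : R).
Notation dl := (dl R).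
Implicit Types (F G : V -> R) (O : set V) (x y : V) (a b d e k : 'I_n).

Lemma is_derive_eq_on O F G x k (r t : R) : open O -> (forall y, O y -> F y = G y) -> O x ->
  is_derive x (eb k) F r -> is_derive x (eb k) G t -> r = t.
Proof. by move=> oO FG Ox [_ <-] [_ <-]; exact: (derive_eq_on (O := O)). Qed.

Lemma constant_of_grad0 O F : open O -> connected O ->
  (forall x k, O x -> is_derive x (eb k) F 0) -> forall x y, O x -> O y -> F x = F y.
Proof.
move=> oO cO dF x y Ox Oy.
have loc z : O z -> \forall t \near z, O t /\ F t = F z.
  move=> Oz; have /nbhs_ballP[r /= r0 hr] := open_nbhs_in oO Oz.
  have hr' t : `|z - t| < r -> O t by move=> zt; apply: hr; rewrite -ball_normE.
  apply/nbhs_ballP; exists r => // t; rewrite -ball_normE /= => zt; split; first exact: hr'.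
  have := @box_mean_value R n F (fun _ _ => 0) z r 0 (fun=> 0) t z r0.
  rewrite mul0r => h.
  have {}h : `|F t - F z - dotc (fun=> 0) (t - z)| <= 0.
    by apply: h => // [w /hr' Ow i|w _ i|]; [exact: dF|rewrite subrr normr0|rewrite subrr normr0].
  apply/eqP; rewrite -subr_eq0 -normr_le0; apply: le_trans h.
  by rewrite /dotc big1 ?subr0// => i _; rewrite mul0r.
have oE (T : R -> Prop) : open [set z | O z /\ T (F z)].
  rewrite openE => z [Oz Tz]; apply: filterS (loc z Oz) => t [Ot Ft]; split=> //.
  by rewrite Ft.
have E : [set z | O z /\ F z = F x] = O.
  apply: cO; first by exists x.
    by exists [set z | O z /\ F z = F x]; [exact: (oE (fun t => t = F x))|apply/seteqP; split=> z /=; tauto].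
  exists (~` [set z | O z /\ F z <> F x]); first by rewrite closedC; exact: (oE (fun t => t <> F x)).
  apply/seteqP; split=> z /=; first by move=> [Oz Fz]; split=> // -[].
  by move=> [Oz nz]; split=> //; apply: contrapT => h; apply: nz.
have [_ ->] : [set z | O z /\ F z = F x] y by rewrite E.
by [].
Qed.

Variables (O : set V) (u : V -> R) (c : R).
Hypothesis J : jet O u c.
Hypothesis T0z : forall x, O x -> T0sq u x = 0.
Let dO : odom O := jet_dom J.
Let oO : open O. Proof. by case: dO. Qed.
Notation D s := (dp s u).
Notation wd := (wd u).
Notation hs := (hs u).

Let n1 : nn + 1 != 0. Proof. by rewrite gt_eqF// ltr_wpDl. Qed.
Let n2 : nn + 2 != 0. Proof. by rewrite gt_eqF// ltr_wpDl. Qed.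
Let n4 : nn + 4 != 0. Proof. by rewrite gt_eqF// ltr_wpDl. Qed.
Let n0 : nn != 0. Proof. by case: dO => h _ _; rewrite pnatr_eq0 -lt0n. Qed.

(** The tensor [Sh] of the fourth derivatives, as a function of the point and in a form that is
    differentiated termwise; [Sx1] is its derivative in the direction [k]. *)
Definition Sx a b x := (nn + 4)^-1 * (hs a b x - (2 * (nn + 2))^-1 * wd [::] x * dl a b).
Definition Sx1 k a b x := (nn + 4)^-1 * (\sum_d D [:: k; a; b; d; d] x - (2 * (nn + 2))^-1 * wd [:: k] x * dl a b).

Ltac pm := apply/permP => ? /=; lia.

Lemma D4_six a b d e x : O x -> D [:: a; b; d; e] x = six (fun p q => Sx p q x) a b d e.
Proof.
move=> Ox; have Z : T0x u x a b d e = 0.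
  apply/eqP; rewrite -sqrf_eq0; have := T0z Ox; rewrite /T0sq /S4 => H.
  have s2 p q r s : 0 <= T0x u x p q r s ^+ 2 by exact: sqr_ge0.
  have /psumr_eq0P h1 := H; have {}h1 := h1 _ a isT.
  have /psumr_eq0P h2 := h1 (fun _ _ => sumr_ge0 _ (fun _ _ => sumr_ge0 _ (fun _ _ => sumr_ge0 _ (fun _ _ => s2 _ _ _ _)))).
  have {}h2 := h2 (fun _ _ => sumr_ge0 _ (fun _ _ => sumr_ge0 _ (fun _ _ => s2 _ _ _ _))) b isT.
  have /psumr_eq0P h3 := h2.
  have {}h3 := h3 (fun _ _ => sumr_ge0 _ (fun _ _ => s2 _ _ _ _)) d isT.
  have /psumr_eq0P h4 := h3.
  by apply/eqP; apply: h4.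
move/eqP: Z; rewrite /T0x /T0 subr_eq0 => /eqP ->.
by rewrite /six /Sh /Sx; field; rewrite ?n4 ?n2.
Qed.

Lemma hs_d a b k x : O x -> is_derive x (eb k) (hs a b) (\sum_d D [:: k; a; b; d; d] x).
Proof. by move=> Ox; apply: isd_sum => d; exact: (jet_d J). Qed.

Lemma Sx_d a b k x : O x -> is_derive x (eb k) (Sx a b) (Sx1 k a b x).
Proof.
move=> Ox; apply: isdZ; apply: isdB; first exact: hs_d.
have := isdM (isdZ ((2 * (nn + 2))^-1) (wd_d J (s := [::]) k isT Ox)) (isdC x (eb k) (dl a b)).
by rewrite mulr0 addr0.
Qed.

Lemma D5_six k a b d e x : O x ->
  D [:: k; a; b; d; e] x = six (fun p q => Sx1 k p q x) a b d e.
Proof.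
move=> Ox; apply: (is_derive_eq_on (O := O) (k := k) oO _ Ox (jet_d J (s := [:: a; b; d; e]) k isT Ox)).
  by move=> y; exact: D4_six.
have Z p q (t : R) : is_derive x (eb k) (fun y => t * Sx p q y) (t * Sx1 k p q x).
  by apply: isdZ; exact: Sx_d.
by do !apply: isdD.
Qed.

(** Full symmetry of the fifth derivatives says more than that of the fourth: the trace defining
    [D^3 v] may also pair the new index with one of the four old ones. Inserting [D5_six] in that
    contraction gives a linear equation for [D^3 v] in terms of [Dw]. *)
Lemma h3_explicit a b k x : O x -> \sum_d D [:: k; a; b; d; d] x =
  (nn + 2)^-1 * (dl a b * wd [:: k] x + dl a k * wd [:: b] x + dl b k * wd [:: a] x).
Proof.
move=> Ox; set h3 := fun k a b => \sum_d D [:: k; a; b; d; d] x.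
rewrite -[LHS]/(h3 k a b).
have h3s1 p q r : h3 p q r = h3 q p r by apply: eq_bigr => d _; apply: (jet_perm J) => //; pm.
have h3s2 p q r : h3 p q r = h3 p r q by apply: eq_bigr => d _; apply: (jet_perm J) => //; pm.
have h3t p : \sum_q h3 q q p = wd [:: p] x.
  by apply: eq_bigr => q _; apply: eq_bigr => d _; apply: (jet_perm J) => //; pm.
have dS p : \sum_q Sx1 q q p x = (nn + 4)^-1 * (wd [:: p] x - (2 * (nn + 2))^-1 * wd [:: p] x).
  rewrite /Sx1 -mulr_sumr; congr (_ * _); rewrite sumrB h3t; congr (_ - _).
  rewrite -[RHS](dl_suml p (fun q => (2 * (nn + 2))^-1 * wd [:: q] x)).
  by apply: eq_bigr => q _; rewrite mulrC.
have T : h3 k a b = \sum_e D [:: e; k; a; b; e] x.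
  by apply: eq_bigr => e _; apply: (jet_perm J) => //; pm.
have {}T : h3 k a b = dl k a * (\sum_e Sx1 e b e x) + dl k b * (\sum_e Sx1 e a e x) + Sx1 k a b x +
   dl a b * (\sum_e Sx1 e k e x) + Sx1 a k b x + Sx1 b k a x.
  rewrite T -(dl_sum k (fun e => Sx1 e a b x)) -(dl_sum a (fun e => Sx1 e k b x)) -(dl_sum b (fun e => Sx1 e k a x)).
  rewrite !mulr_sumr -!big_split/=; apply: eq_bigr => e _.
  by rewrite D5_six// /six; ring.
have sS p : \sum_e Sx1 e p e x = \sum_e Sx1 e e p x.
  by apply: eq_bigr => e _; rewrite /Sx1 -/(h3 e p e) -/(h3 e e p) h3s2 dlC.
move: T; rewrite !sS !dS /Sx1 -/(h3 k a b) -/(h3 a k b) -/(h3 b k a).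
rewrite (h3s1 a k b) (h3s1 b k a) (h3s2 k b a) (dlC R k a) (dlC R k b).
set h := h3 k a b => T.
(* Three of the terms in [T] contain [h] with the factor [(nn + 4)^-1]; moving them to the left
   leaves [(nn + 1) / (nn + 4)]. *)
have T2 : (nn + 1) * h = (nn + 1) * ((nn + 2)^-1 * (dl a b * wd [:: k] x + dl a k * wd [:: b] x + dl b k * wd [:: a] x)).
  apply: (mulfI (_ : (nn + 4)^-1 != 0)); first by rewrite invr_eq0.
  have -> : (nn + 4)^-1 * ((nn + 1) * h) = h - 3 * (nn + 4)^-1 * h by field.
  by rewrite {1}T; field; rewrite n4 n2.
exact: (mulfI n1 T2).
Qed.

(** Differentiating [h3_explicit] once more and tracing gives [(nn + 2)] times the Hessian of [w] as
    twice that Hessian plus [lap w] times [dl], and [lap w = -1]. *)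
Lemma wd2_explicit a b x : O x -> wd [:: a; b] x = - (nn^-1 * dl a b).
Proof.
move=> Ox.
have h4 e p q k : \sum_d D [:: e; k; p; q; d; d] x =
   (nn + 2)^-1 * (dl p q * wd [:: e; k] x + dl p k * wd [:: e; q] x + dl q k * wd [:: e; p] x).
  have L : is_derive x (eb e) (fun y => \sum_d D [:: k; p; q; d; d] y) (\sum_d D [:: e; k; p; q; d; d] x).
    by apply: isd_sum => d; exact: (jet_d J).
  have Z p1 q1 r1 : is_derive x (eb e) (fun y => dl p1 q1 * wd [:: r1] y) (dl p1 q1 * wd [:: e; r1] x).
    by apply: isdZ; exact: (wd_d J).
  have M : is_derive x (eb e) (fun y => (nn + 2)^-1 * (dl p q * wd [:: k] y + dl p k * wd [:: q] y + dl q k * wd [:: p] y))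
     ((nn + 2)^-1 * (dl p q * wd [:: e; k] x + dl p k * wd [:: e; q] x + dl q k * wd [:: e; p] x)).
    by apply: isdZ; do !apply: isdD.
  by apply: (is_derive_eq_on (O := O) oO _ Ox L M) => y Oy; exact: h3_explicit.
have S : \sum_e \sum_d D [:: e; e; a; b; d; d] x = wd [:: a; b] x.
  by apply: eq_bigr => e _; apply: eq_bigr => d _; apply: (jet_perm J) => //; pm.
move: S; rewrite (eq_bigr _ (fun e _ => h4 e a b e)) -mulr_sumr !big_split/= -mulr_sumr (wd_lap J Ox).
rewrite (dl_sum a (fun e => wd [:: e; b] x)) (dl_sum b (fun e => wd [:: e; a] x)) (wd_sym J b a Ox) => S.
apply: (mulfI n0); have -> : nn * wd [:: a; b] x = (nn + 2) * wd [:: a; b] x - 2 * wd [:: a; b] x by ring.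
by rewrite -{1}S; field; rewrite n2 n0.
Qed.

End Rigidity.

(** * Vanishing of rotational derivatives, and Euler equations along rays *)

Section Radial.
Variables (R : realType) (n : nat).
Notation V := 'rV[R]_n.
Notation eb := (ebasis R).
Notation nn := (n%:R : R).
Notation dl := (dl R).
Implicit Types (F G : V -> R) (x y : V) (a b d e k l : 'I_n).
Variables (O : set V) (u : V -> R) (c : R).
Hypothesis J : jet O u c.
Hypothesis T0z : forall x, O x -> T0sq u x = 0.
Hypothesis cO : connected O.
Let dO : odom O := jet_dom J.
Let oO : open O. Proof. by case: dO. Qed.
Let bO : bset O. Proof. by case: dO. Qed.
Notation D s := (dp s u).
Notation wd := (wd u).
Notation hs := (hs u).
Notation v1 := (v1 u).
Notation vv := (vv u).

Let n0 : nn != 0. Proof. by case: dO => h _ _; rewrite pnatr_eq0 -lt0n. Qed.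

Ltac pm := apply/permP => ? /=; lia.

(** The gradient of [w] is affine with slope [- nn^-1]; [x0] is its zero, computed from one point of
    [O], and may a priori lie outside [O]. *)
Lemma wd1_explicit : O !=set0 ->
  exists x0 : V, forall x b, O x -> wd [:: b] x = - (nn^-1 * (x ord0 b - x0 ord0 b)).
Proof.
move=> [p Op]; exists (\row_b (p ord0 b + nn * wd [:: b] p)) => x b Ox.
have H z k : O z -> is_derive z (eb k) (fun y => wd [:: b] y + nn^-1 * y ord0 b) 0.
  move=> Oz; have := isdD (wd_d J (s := [:: b]) k isT Oz) (isdZ nn^-1 (isd_coord z k b)).
  by rewrite (wd2_explicit J T0z k b Oz) /dl addNr.
have /= := constant_of_grad0 oO cO H Ox Op; rewrite mxE => E.
have -> : wd [:: b] x = wd [:: b] x + nn^-1 * x ord0 b - nn^-1 * x ord0 b by ring.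
by rewrite E; field.
Qed.

Variable x0 : V.
Hypothesis W1 : forall x b, O x -> wd [:: b] x = - (nn^-1 * (x ord0 b - x0 ord0 b)).

Definition yc a x : R := x ord0 a - x0 ord0 a.
Definition rho x : R := \sum_a yc a x * yc a x.

Lemma yc_d a k x : is_derive x (eb k) (yc a) (dl k a).
Proof. by have := isdB (isd_coord x k a) (isdC x (eb k) (x0 ord0 a)); rewrite subr0. Qed.

Lemma rho_d k x : is_derive x (eb k) rho (2 * yc k x).
Proof.
have := isd_sum (index_enum 'I_n) (fun a => isdM (yc_d a k x) (yc_d a k x)).
congr is_derive; rewrite big_split/= (dl_sum k (fun a => yc a x)).
rewrite (eq_bigr (fun a => dl k a * yc a x)) ?(dl_sum k (fun a => yc a x)); last by move=> a _; rewrite mulrC.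
by ring.
Qed.

Lemma yc_bc a : bc O (yc a).
Proof. by apply: bcB; [exact: bc_coord|exact: bc_cst]. Qed.

Lemma yc_contract x b k l (p q r s : R) :
  \sum_a yc a x * (p * dl b a + q * dl k a + r * dl l a + s * yc a x) =
  p * yc b x + q * yc k x + r * yc l x + s * rho x.
Proof.
rewrite /rho -(dl_sum b (fun a => yc a x)) -(dl_sum k (fun a => yc a x)) -(dl_sum l (fun a => yc a x)).
by rewrite !mulr_sumr -!big_split/=; apply: eq_bigr => a _; ring.
Qed.

(** Differentiate the rotational identity for the pair [a], [b] in the direction [a] and sum over
    [a]. When [G] is a gradient, the right side contains a Laplacian that is already known. *)
Lemma euler_of_radial (G : 'I_n -> V -> R) (G1 : 'I_n -> 'I_n -> V -> R) :
  (forall x b k, O x -> is_derive x (eb k) (G b) (G1 k b x)) ->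
  (forall x a b, O x -> yc a x * G b x = yc b x * G a x) ->
  forall x b, O x -> (nn - 1) * G b x + \sum_a yc a x * G1 a b x = yc b x * \sum_a G1 a a x.
Proof.
move=> dG sG x b Ox.
have E a : dl a a * G b x + yc a x * G1 a b x = dl a b * G a x + yc b x * G1 a a x.
  apply: (is_derive_eq_on (O := O) oO _ Ox (isdM (yc_d a a x) (dG x b a Ox)) (isdM (yc_d b a x) (dG x a a Ox))).
  by move=> y Oy; exact: sG.
have : \sum_a (dl a a * G b x + yc a x * G1 a b x) = \sum_a (dl a b * G a x + yc b x * G1 a a x).
  by apply: eq_bigr => a _; exact: E.
rewrite !big_split/= -mulr_suml dl_tr (dl_suml b (fun a => G a x)) -mulr_sumr => H.
by rewrite -[RHS](addKr (G b x)) -H; ring.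
Qed.

(** The derivative of the position vector contributes one more copy of [G1], so each differentiation
    raises the coefficient by one. *)
Lemma euler_d (m : R) G (G1 : 'I_n -> V -> R) (G2 : 'I_n -> 'I_n -> V -> R) K (K1 : 'I_n -> V -> R) :
  (forall x k, O x -> is_derive x (eb k) G (G1 k x)) ->
  (forall x a k, O x -> is_derive x (eb k) (G1 a) (G2 k a x)) ->
  (forall x k, O x -> is_derive x (eb k) K (K1 k x)) ->
  (forall x, O x -> m * G x + \sum_a yc a x * G1 a x = K x) ->
  forall x k, O x -> (m + 1) * G1 k x + \sum_a yc a x * G2 k a x = K1 k x.
Proof.
move=> dG dG1 dK E x k Ox.
have L : is_derive x (eb k) (fun y => m * G y + \sum_a yc a y * G1 a y)
   (m * G1 k x + \sum_a (dl k a * G1 a x + yc a x * G2 k a x)).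
  apply: isdD; first by apply: isdZ; exact: dG.
  by apply: isd_sum => a; apply: isdM; [exact: yc_d|exact: dG1].
rewrite -(is_derive_eq_on oO E Ox L (dK x k Ox)) big_split/= (dl_sum k (fun a => G1 a x)).
by ring.
Qed.

Section Rotation.
Variables a b : 'I_n.
Let f x := yc a x * D [:: b] x - yc b x * D [:: a] x.
Let f1 k x := dl k a * D [:: b] x + yc a x * D [:: k; b] x - (dl k b * D [:: a] x + yc b x * D [:: k; a] x).
Let f2 k x := 0 * D [:: b] x + dl k a * D [:: k; b] x + (dl k a * D [:: k; b] x + yc a x * D [:: k; k; b] x)
  - (0 * D [:: a] x + dl k b * D [:: k; a] x + (dl k b * D [:: k; a] x + yc b x * D [:: k; k; a] x)).
Let h x := yc a x * v1 b x - yc b x * v1 a x.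
Let h1 k x := dl k a * v1 b x + yc a x * hs k b x - (dl k b * v1 a x + yc b x * hs k a x).
Let h2 k x := 0 * v1 b x + dl k a * hs k b x + (dl k a * hs k b x + yc a x * \sum_d D [:: k; k; b; d; d] x)
  - (0 * v1 a x + dl k b * hs k a x + (dl k b * hs k a x + yc b x * \sum_d D [:: k; k; a; d; d] x)).

Let jd s k x : (size s < 6)%N -> O x -> is_derive x (eb k) (D s) (D (k :: s) x).
Proof. exact: (jet_d J). Qed.
Let jb s : (size s <= 6)%N -> bc O (D s).
Proof. exact: (jet_bc J). Qed.

Lemma v1_d e k x : O x -> is_derive x (eb k) (v1 e) (hs k e x).
Proof. by move=> Ox; apply: isd_sum => d; exact: jd. Qed.

(* f = (y_a d_b - y_b d_a) u has vanishing bilaplacian and vanishing Cauchy data. *)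
Lemma rotation_vanish : (forall x, O x -> h x = 0) /\ (forall x, O x -> f x = 0).
Proof.
have by_ := yc_bc; have b_0 := bc_cst O (0 : R).
have bv e : bc O (v1 e) by apply: bc_sum => d; exact: jb.
have bh e e' : bc O (hs e e') by apply: bc_sum => d; exact: jb.
have bh3 k e : bc O (fun x => \sum_d D [:: k; k; e; d; d] x) by apply: bc_sum => d; exact: jb.
have bF : bc O f by apply: bcB; apply: bcM => //; exact: jb.
have bF1 k : bc O (f1 k) by apply: bcB; apply: bcD; [apply: bcZ|apply: bcM => //|apply: bcZ|apply: bcM => //]; exact: jb.
have bF2 k : bc O (f2 k).
  have Q e e' : bc O (fun x => 0 * D [:: e] x + dl k e' * D [:: k; e] x + (dl k e' * D [:: k; e] x + yc e' x * D [:: k; k; e] x)).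
    by apply: bcD; apply: bcD; [apply: bcZ|apply: bcZ|apply: bcZ|apply: bcM => //]; exact: jb.
  by apply: bcB; exact: Q.
have bH : bc O h by apply: bcB; exact: bcM.
have bH1 k : bc O (h1 k) by apply: bcB; apply: bcD; [exact: bcZ|exact: bcM|exact: bcZ|exact: bcM].
have bH2 k : bc O (h2 k).
  have Q e e' : bc O (fun x => 0 * v1 e x + dl k e' * hs k e x + (dl k e' * hs k e x + yc e' x * \sum_d D [:: k; k; e; d; d] x)).
    by apply: bcD; apply: bcD; [exact: bcZ|exact: bcZ|exact: bcZ|exact: bcM].
  by apply: bcB; exact: Q.
have dF k x : O x -> is_derive x (eb k) f (f1 k x).
  by move=> Ox; apply: isdB; apply: isdM; (try exact: yc_d); exact: jd.
have dF1 k x : O x -> is_derive x (eb k) (f1 k) (f2 k x).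
  move=> Ox; have Q e e' : is_derive x (eb k) (fun x => dl k e' * D [:: e] x + yc e' x * D [:: k; e] x)
      (0 * D [:: e] x + dl k e' * D [:: k; e] x + (dl k e' * D [:: k; e] x + yc e' x * D [:: k; k; e] x)).
    by apply: isdD; apply: isdM; (try exact: isdC); (try exact: yc_d); exact: jd.
  by apply: isdB; exact: Q.
have dH k x : O x -> is_derive x (eb k) h (h1 k x).
  by move=> Ox; apply: isdB; apply: isdM; (try exact: yc_d); exact: v1_d.
have dH1 k x : O x -> is_derive x (eb k) (h1 k) (h2 k x).
  move=> Ox; have Q e e' : is_derive x (eb k) (fun x => dl k e' * v1 e x + yc e' x * hs k e x)
      (0 * v1 e x + dl k e' * hs k e x + (dl k e' * hs k e x + yc e' x * \sum_d D [:: k; k; e; d; d] x)).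
    apply: isdD; apply: isdM; (try exact: isdC); (try exact: yc_d); (try exact: v1_d).
    by apply: isd_sum => d; exact: jd.
  by apply: isdB; exact: Q.
have vB F G : vanish O F -> vanish O G -> vanish O (fun x => F x - G x).
  move=> vF vG x bx; have := tendsD (vF x bx) (tendsZ (b := -1) (vG x bx)).
  by rewrite mulr0 addr0; apply: tends_eq => y _; rewrite mulN1r.
have vD F G : vanish O F -> vanish O G -> vanish O (fun x => F x + G x).
  by move=> vF vG x bx; have := tendsD (vF x bx) (vG x bx); rewrite addr0.
have vM F G : bc O F -> vanish O G -> vanish O (fun x => F x * G x).
  by move=> bF0 vG x bx; apply: (tends_eq _ (vanishM vG bF0 bx)) => y _; rewrite mulrC.
have jv s : (size s <= 2)%N -> vanish O (D s) by exact: (jet_vanish J).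
have vF : vanish O f by apply: vB; apply: vM => //; exact: jv.
have vF1 k : vanish O (f1 k).
  have Q e e' : vanish O (fun x => dl k e' * D [:: e] x + yc e' x * D [:: k; e] x).
    by apply: vD; apply: vM; (try exact: jv) => //; exact: bc_cst.
  by apply: vB; exact: Q.
have SF x : O x -> \sum_k f2 k x = h x.
  move=> Ox; have s1 e : \sum_k D [:: k; k; e] x = v1 e x.
    by apply: eq_bigr => k _; apply: (jet_perm J) => //; pm.
  rewrite /f2 /h -!s1 !mulr_sumr.
  transitivity (\sum_k (2 * (dl a k * D [:: k; b] x)) - \sum_k (2 * (dl b k * D [:: k; a] x)) +
     (\sum_k yc a x * D [:: k; k; b] x - \sum_k yc b x * D [:: k; k; a] x)).
    rewrite -!sumrB -big_split/=; apply: eq_bigr => k _; rewrite (dlC R a k) (dlC R b k); ring.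
  rewrite -!mulr_sumr (dl_sum a (fun k => D [:: k; b] x)) (dl_sum b (fun k => D [:: k; a] x)).
  by rewrite (jet_perm J (s := [:: b; a]) (t := [:: a; b]))//; [ring|pm].
have SH x : O x -> \sum_k h2 k x = 0.
  move=> Ox; have s1 e : \sum_k \sum_d D [:: k; k; e; d; d] x = wd [:: e] x.
    by apply: eq_bigr => k _; apply: eq_bigr => d _; apply: (jet_perm J) => //; pm.
  transitivity (\sum_k (2 * (dl a k * hs k b x)) - \sum_k (2 * (dl b k * hs k a x)) +
     (yc a x * (\sum_k \sum_d D [:: k; k; b; d; d] x) - yc b x * (\sum_k \sum_d D [:: k; k; a; d; d] x))).
    rewrite !mulr_sumr -!sumrB -big_split/=; apply: eq_bigr => k _; rewrite /h2 (dlC R a k) (dlC R b k); ring.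
  rewrite -!mulr_sumr (dl_sum a (fun k => hs k b x)) (dl_sum b (fun k => hs k a x)) !s1 !W1//.
  have -> : hs b a x = hs a b x by apply: eq_bigr => d _; apply: (jet_perm J) => //; pm.
  by rewrite /yc; ring.
(* Both [f] and its derivatives [f1] vanish on the boundary, so the Laplacian passes from [f] to [h]
   with no boundary condition on [h]. As [h] is the Laplacian of [f] and is harmonic, the integral
   of [h * h] is 0. *)
have i1 k : IO O (fun x => f2 k x * h x) = IO O (fun x => f x * h2 k x).
  have e1 := ibp (O := O) (k := k) dO (dF1 k) (dH k) (bF1 k) (bF2 k) bH (bH1 k) (vF1 k).
  have e2 := ibp (O := O) (k := k) dO (dF k) (dH1 k) bF (bF1 k) (bH1 k) (bH2 k) vF.
  by move: e1; rewrite addrC -{1}e2 => /addrI.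
have hh : IO O (fun x => h x * h x) = 0.
  transitivity (\sum_k IO O (fun x => f2 k x * h x)).
    rewrite -IO_sum//; last by move=> k; exact: bcM.
    by apply: IO_eq => x Ox; rewrite -mulr_suml SF.
  rewrite (eq_bigr _ (fun k _ => i1 k)) -IO_sum//; last by move=> k; exact: bcM.
  by rewrite -[RHS](IO_0 O); apply: IO_eq => x Ox; rewrite -mulr_sumr SH// mulr0.
have h_0 x : O x -> h x = 0.
  have hp y : 0 <= h y * h y by rewrite -expr2 sqr_ge0.
  move=> Ox; have /eqP := IO_eq0 dO (bcM bH bH) (fun y _ => hp y) hh Ox.
  by rewrite mulf_eq0 orbb => /eqP.
split=> //.
(* Now [f] is harmonic with zero boundary limit, so its energy vanishes. *)
have f1_0 k x : O x -> f1 k x = 0.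
  have i2 q : IO O (fun x => f1 q x * f1 q x) = - IO O (fun x => f x * f2 q x).
    apply/eqP; rewrite -addr_eq0; apply/eqP.
    exact: (ibp (O := O) (k := q) dO (dF q) (dF1 q) bF (bF1 q) (bF1 q) (bF2 q) vF).
  have S0 : \sum_q IO O (fun x => f1 q x * f1 q x) = 0.
    rewrite (eq_bigr _ (fun q _ => i2 q)) sumrN -IO_sum//; last by move=> q; exact: bcM.
    rewrite (IO_eq (G := fun=> 0)) ?IO_0 ?oppr0// => y Oy.
    by rewrite -mulr_sumr SF// h_0// mulr0.
  have bff q : bc O (fun x => f1 q x * f1 q x) by exact: bcM.
  have f0 q y : 0 <= f1 q y * f1 q y by rewrite -expr2 sqr_ge0.
  move=> Ox; have /psumr_eq0P S1 := S0.
  have {}S1 := S1 (fun q _ => IO_ge0 dO (bff q) (fun y _ => f0 q y)) k isT.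
  have /eqP := IO_eq0 dO (bff k) (fun y _ => f0 k y) S1 Ox.
  by rewrite mulf_eq0 orbb => /eqP.
(* With zero derivative and zero boundary limit, [f * f] has integral 0 by parts against a
   coordinate; [a] only supplies the index of that coordinate. *)
move=> x Ox; pose k0 := a.
have bX := bc_coord k0 bO.
have dff y : O y -> is_derive y (eb k0) (fun y => f y * f y) 0.
  by move=> Oy; have := isdM (dF k0 y Oy) (dF k0 y Oy); rewrite f1_0// mul0r mulr0 addr0.
have dX y : O y -> is_derive y (eb k0) (fun y => y ord0 k0) 1.
  by move=> Oy; have := isd_coord y k0 k0; rewrite eqxx.
have vff : vanish O (fun y => f y * f y) by exact: vanishM.
have := ibp dO dff dX (bcM bF bF) b_0 bX (bc_cst O 1) vff.
rewrite (IO_eq (F := fun y => 0 * y ord0 k0) (G := fun=> 0)) ?IO_0 ?add0r; last by move=> y _; rewrite mul0r.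
have bff1 : bc O (fun y => f y * f y * 1) by apply: bcM; [exact: bcM|exact: bc_cst].
have fp y : 0 <= f y * f y * 1 by rewrite mulr1 -expr2 sqr_ge0.
move=> I0; have /eqP := IO_eq0 dO bff1 (fun y _ => fp y) I0 Ox.
by rewrite mulr1 mulf_eq0 orbb => /eqP.
Qed.

End Rotation.

End Radial.

(** * Descent from the fourth derivatives of u to u itself *)

Section Explicit.
Variables (R : realType) (n : nat).
Notation V := 'rV[R]_n.
Notation eb := (ebasis R).
Notation nn := (n%:R : R).
Notation dl := (dl R).
Implicit Types (F G : V -> R) (x y : V) (a b d e k l : 'I_n).
Variables (O : set V) (u : V -> R) (c : R).
Hypothesis J : jet O u c.
Hypothesis T0z : forall x, O x -> T0sq u x = 0.
Hypothesis cO : connected O.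
Hypothesis n_ge2 : (2 <= n)%N.
Let dO : odom O := jet_dom J.
Let oO : open O. Proof. by case: dO. Qed.
Notation D s := (dp s u).
Notation wd := (wd u).
Notation hs := (hs u).
Notation v1 := (v1 u).
Notation vv := (vv u).
Variable x0 : V.
Hypothesis W1 : forall x b, O x -> wd [:: b] x = - (nn^-1 * (x ord0 b - x0 ord0 b)).
Notation yc := (yc x0).
Notation rho := (rho x0).
Variable p : V.
Hypothesis Op : O p.

Let nm1 : nn - 1 != 0. Proof. by rewrite subr_eq0 (eqr_nat R n 1); apply/eqP; lia. Qed.
Let n1 : nn + 1 != 0. Proof. by rewrite gt_eqF// ltr_wpDl. Qed.
Let n2 : nn + 2 != 0. Proof. by rewrite gt_eqF// ltr_wpDl. Qed.
Let n4 : nn + 4 != 0. Proof. by rewrite gt_eqF// ltr_wpDl. Qed.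
Let n0 : nn != 0. Proof. by case: dO => h _ _; rewrite pnatr_eq0 -lt0n. Qed.

Ltac pm := apply/permP => ? /=; lia.

Let N := nn * (nn + 2) * (nn + 4).
(** [A], and below it [B], are the constant terms of [w] and [vv] as polynomials in [rho], read off
    at the base point [p]. *)
Let A := wd [::] p + (2 * nn)^-1 * rho p.
Let V1 x := A / nn - rho x / (2 * nn * (nn + 2)).
Let vpoly x := (A / (2 * nn)) * rho x + - (8 * nn * (nn + 2))^-1 * (rho x * rho x).
Let B := vv p - vpoly p.
(** If [u] is a function [U] of [rho], then [U2] is [2 U'], [U3] is [4 U''], and [- N^-1] is
    [8 U''']. *)
Let U3 x := A / (nn * (nn + 2)) - rho x / (2 * N).
Let U2 x := B / nn + A / (2 * nn * (nn + 2)) * rho x - (8 * N)^-1 * rho x ^+ 2.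

Let wy b x : O x -> wd [:: b] x = - (nn^-1 * yc b x).
Proof. exact: W1. Qed.

Lemma w_explicit x : O x -> wd [::] x = A - rho x / (2 * nn).
Proof.
move=> Ox.
have H z k : O z -> is_derive z (eb k) (fun y => wd [::] y + (2 * nn)^-1 * rho y) 0.
  move=> Oz; have := isdD (wd_d J (s := [::]) k isT Oz) (isdZ (2 * nn)^-1 (rho_d x0 k z)).
  by rewrite wy//; congr is_derive; field.
have E := constant_of_grad0 oO cO H Ox Op.
by rewrite -[LHS](addrK ((2 * nn)^-1 * rho x)) E -/A; congr (_ - _); rewrite mulrC.
Qed.

Lemma radial_v x a b : O x -> yc a x * v1 b x = yc b x * v1 a x.
Proof.
by move=> Ox; have [h _] := rotation_vanish J W1 a b; apply/eqP; rewrite -subr_eq0; apply/eqP/h.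
Qed.

Lemma radial_u x a b : O x -> yc a x * D [:: b] x = yc b x * D [:: a] x.
Proof.
by move=> Ox; have [_ h] := rotation_vanish J W1 a b; apply/eqP; rewrite -subr_eq0; apply/eqP/h.
Qed.

Lemma euler_v x b : O x -> (nn - 1) * v1 b x + \sum_a yc a x * hs a b x = yc b x * wd [::] x.
Proof.
move=> Ox.
apply: (euler_of_radial J (x0 := x0) (G := v1) (G1 := hs) _ _ b Ox) => [z e k|z e k] Oz.
  exact: (v1_d J).
exact: radial_v.
Qed.

(** The differentiated Euler equation for [v1] contains [D^3 v] only contracted with the position
    vector, which [h3_explicit] evaluates; the Hessian of [v] follows algebraically. The lower
    derivatives are obtained in the same way, each from the one above. *)
Lemma hs_explicit x k b : O x ->
  hs k b x = V1 x * dl k b - (nn * (nn + 2))^-1 * (yc k x * yc b x).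
Proof.
move=> Ox.
have H := @euler_d R n O u c J x0 (nn - 1) (v1 b) (fun a => hs a b)
  (fun k a x => \sum_d D [:: k; a; b; d; d] x) (fun x => yc b x * wd [::] x)
  (fun k x => dl k b * wd [::] x + yc b x * wd [:: k] x).
have {H} := H (fun x k => v1_d J b k (x := x)) (fun x a k => hs_d J a b k (x := x)) _ (fun x => @euler_v x b) x k Ox.
have S : \sum_a yc a x * (\sum_d D [:: k; a; b; d; d] x) =
   - (nn * (nn + 2))^-1 * (2 * (yc k x * yc b x) + dl k b * rho x).
  transitivity (\sum_a yc a x * (- (nn * (nn + 2))^-1 * yc k x * dl b a + - (nn * (nn + 2))^-1 * yc b x * dl k a
     + 0 * dl k a + - (nn * (nn + 2))^-1 * dl k b * yc a x)).
    apply: eq_bigr => a _; rewrite (h3_explicit J T0z a b k Ox) !wy//.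
    by rewrite (dlC R a b) (dlC R a k) (dlC R b k); field; rewrite n0 n2.
  by rewrite yc_contract; ring.
rewrite S w_explicit// wy// => H.
have {}H := H (fun z q Oz => isdM (yc_d x0 b q z) (wd_d J (s := [::]) q isT Oz)).
apply: (mulfI n0).
have -> : nn * hs k b x = (nn - 1 + 1) * hs k b x +
   - (nn * (nn + 2))^-1 * (2 * (yc k x * yc b x) + dl k b * rho x) +
   (nn * (nn + 2))^-1 * (2 * (yc k x * yc b x) + dl k b * rho x) by ring.
by rewrite H /V1; field; rewrite n0 n2.
Qed.

(** The undifferentiated Euler equation has the coefficient [nn - 1]; dividing by it is possible
    since the dimension is at least two. *)
Lemma v1_explicit x b : O x -> v1 b x = yc b x * V1 x.
Proof.
move=> Ox; have := euler_v b Ox.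
have -> : \sum_a yc a x * hs a b x = V1 x * yc b x - (nn * (nn + 2))^-1 * yc b x * rho x.
  transitivity (\sum_a yc a x * (V1 x * dl b a + 0 * dl b a + 0 * dl b a + - (nn * (nn + 2))^-1 * yc b x * yc a x)).
    by apply: eq_bigr => a _; rewrite hs_explicit// (dlC R a b); ring.
  by rewrite yc_contract; ring.
rewrite w_explicit// => H; apply: (mulfI nm1).
have -> : (nn - 1) * v1 b x = (nn - 1) * v1 b x + (V1 x * yc b x - (nn * (nn + 2))^-1 * yc b x * rho x)
   - (V1 x * yc b x - (nn * (nn + 2))^-1 * yc b x * rho x) by ring.
by rewrite H /V1; field; rewrite n0 n2.
Qed.

Lemma vv_explicit x : O x -> vv x = B + vpoly x.
Proof.
move=> Ox.
have H z k : O z -> is_derive z (eb k) (fun y => vv y - vpoly y) 0.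
  move=> Oz; have dv : is_derive z (eb k) vv (v1 k z) by apply: isd_sum => d; exact: (jet_d J).
  have r := rho_d x0 k z.
  have := isdB dv (isdD (isdZ (A / (2 * nn)) r) (isdZ (- (8 * nn * (nn + 2))^-1) (isdM r r))).
  by rewrite v1_explicit//; congr is_derive; rewrite /V1; field; rewrite n0 n2.
by rewrite -[LHS](subrK (vpoly x)) (constant_of_grad0 oO cO H Ox Op).
Qed.

Lemma Sx_explicit x k b : O x -> Sx u k b x =
  (A / (2 * nn * (nn + 2)) - rho x / (4 * N)) * dl k b - N^-1 * (yc k x * yc b x).
Proof.
move=> Ox; rewrite /Sx hs_explicit// w_explicit// /V1 /N.
by field; rewrite n0 n2 n4.
Qed.

Lemma euler_u1 x b : O x -> (nn - 1) * D [:: b] x + \sum_a yc a x * D [:: a; b] x = yc b x * vv x.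
Proof.
move=> Ox.
apply: (euler_of_radial J (x0 := x0) (G := fun b => D [:: b]) (G1 := fun k b => D [:: k; b]) _ _ b Ox) => [z e k|z e k] Oz.
  exact: (jet_d J).
exact: radial_u.
Qed.

Lemma vv_d k x : O x -> is_derive x (eb k) vv (v1 k x).
Proof. by move=> Ox; apply: isd_sum => d; exact: (jet_d J). Qed.

Lemma euler_u2 x k b : O x ->
  nn * D [:: k; b] x + \sum_a yc a x * D [:: a; k; b] x = dl k b * vv x + yc b x * v1 k x.
Proof.
move=> Ox.
have H := @euler_d R n O u c J x0 (nn - 1) (D [:: b]) (fun a => D [:: a; b])
  (fun k a x => D [:: k; a; b] x) (fun x => yc b x * vv x)
  (fun k x => dl k b * vv x + yc b x * v1 k x).
have {H} <- : (nn - 1 + 1) * D [:: k; b] x + \sum_a yc a x * D [:: k; a; b] x = dl k b * vv x + yc b x * v1 k x.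
  apply: H => // [z q Oz|z a q Oz|z q Oz|z Oz].
  - exact: (jet_d J).
  - exact: (jet_d J).
  - by apply: isdM; [exact: yc_d|exact: vv_d].
  - exact: euler_u1.
rewrite subrK; congr (_ + _); apply: eq_bigr => a _; congr (_ * _).
by apply: (jet_perm J) => //; pm.
Qed.

Lemma euler_u3 x l k b : O x ->
  (nn + 1) * D [:: l; k; b] x + \sum_a yc a x * D [:: l; a; k; b] x =
  dl k b * v1 l x + (dl l b * v1 k x + yc b x * hs l k x).
Proof.
move=> Ox.
have H := @euler_d R n O u c J x0 nn (D [:: k; b]) (fun a => D [:: a; k; b])
  (fun l a x => D [:: l; a; k; b] x) (fun x => dl k b * vv x + yc b x * v1 k x)
  (fun l x => dl k b * v1 l x + (dl l b * v1 k x + yc b x * hs l k x)).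
apply: H => // [z q Oz|z a q Oz|z q Oz|z Oz].
- exact: (jet_d J).
- exact: (jet_d J).
- by apply: isdD; [apply: isdZ; exact: vv_d|apply: isdM; [exact: yc_d|exact: (v1_d J)]].
- exact: euler_u2.
Qed.

(** The contraction of the fourth derivatives with the position vector is explicit by [D4_six] and
    [Sx_explicit], and the Euler equation [euler_u3] is solved for the third derivatives. *)
Lemma D3_explicit x l k b : O x -> D [:: l; k; b] x =
  U3 x * (dl l k * yc b x + dl l b * yc k x + dl k b * yc l x) - N^-1 * (yc l x * yc k x * yc b x).
Proof.
move=> Ox; have := euler_u3 l k b Ox.
pose s0 := A / (2 * nn * (nn + 2)) - rho x / (4 * N); pose s1 := - N^-1.
have -> : \sum_a yc a x * D [:: l; a; k; b] x =
   (2 * s0 + s1 * rho x) * (dl l k * yc b x + dl l b * yc k x + dl k b * yc l x) + 3 * s1 * (yc l x * yc k x * yc b x).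
  transitivity (\sum_a yc a x * ((2 * (s0 * dl l k) + s1 * (yc l x * yc k x)) * dl b a +
     (2 * (s0 * dl l b) + s1 * (yc l x * yc b x)) * dl k a +
     (2 * (s0 * dl k b) + s1 * (yc k x * yc b x)) * dl l a +
     s1 * (dl l k * yc b x + dl l b * yc k x + dl k b * yc l x) * yc a x)).
    apply: eq_bigr => a _; rewrite (D4_six T0z l a k b Ox) /six !Sx_explicit// -/s0.
    by rewrite (dlC R a b) (dlC R a k) /s1; ring.
  by rewrite yc_contract; ring.
rewrite !v1_explicit// hs_explicit// => H; apply: (mulfI n1).
rewrite (canRL (addrK _) H) /V1 /U3 /s0 /s1 /N.
by field; rewrite n0 n2 n4.
Qed.

Lemma D2_explicit x k b : O x -> D [:: k; b] x = U2 x * dl k b + U3 x * (yc k x * yc b x).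
Proof.
move=> Ox; have := euler_u2 k b Ox.
have -> : \sum_a yc a x * D [:: a; k; b] x =
   U3 x * (2 * (yc k x * yc b x) + dl k b * rho x) - N^-1 * (yc k x * yc b x) * rho x.
  transitivity (\sum_a yc a x * (U3 x * yc k x * dl b a + U3 x * yc b x * dl k a + 0 * dl k a +
     (U3 x * dl k b - N^-1 * (yc k x * yc b x)) * yc a x)).
    by apply: eq_bigr => a _; rewrite D3_explicit// (dlC R a b) (dlC R a k); ring.
  by rewrite yc_contract; ring.
rewrite v1_explicit// vv_explicit// => H; apply: (mulfI n0).
rewrite (canRL (addrK _) H) /V1 /U3 /U2 /vpoly /N.
by field; rewrite n0 n2 n4.
Qed.

Lemma D1_explicit x b : O x -> D [:: b] x = yc b x * U2 x.
Proof.
move=> Ox; have := euler_u1 b Ox.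
have -> : \sum_a yc a x * D [:: a; b] x = U2 x * yc b x + U3 x * yc b x * rho x.
  transitivity (\sum_a yc a x * (U2 x * dl b a + 0 * dl b a + 0 * dl b a + U3 x * yc b x * yc a x)).
    by apply: eq_bigr => a _; rewrite D2_explicit// (dlC R a b); ring.
  by rewrite yc_contract; ring.
rewrite vv_explicit// => H; apply: (mulfI nm1).
rewrite (canRL (addrK _) H) /U3 /U2 /vpoly /N.
by field; rewrite n0 n2 n4.
Qed.

Let upoly x := B / (2 * nn) * rho x + A / (8 * nn * (nn + 2)) * (rho x * rho x) +
  - (48 * N)^-1 * (rho x * rho x * rho x).

Lemma D0_explicit x : O x -> D [::] x = D [::] p - upoly p + upoly x.
Proof.
move=> Ox.
have H z k : O z -> is_derive z (eb k) (fun y => D [::] y - upoly y) 0.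
  move=> Oz; have r := rho_d x0 k z.
  have := isdB (jet_d J (s := [::]) k isT Oz) (isdD (isdD (isdZ (B / (2 * nn)) r)
    (isdZ (A / (8 * nn * (nn + 2))) (isdM r r))) (isdZ (- (48 * N)^-1) (isdM (isdM r r) r))).
  by rewrite D1_explicit//; congr is_derive; rewrite /U2 /N; field; rewrite n0 n2 n4.
by rewrite -[LHS](subrK (upoly x)) (constant_of_grad0 oO cO H Ox Op).
Qed.

Lemma explicit_solution : exists A0 B0 C0 : R, forall x, O x ->
  [/\ D [::] x = C0 + B0 / (2 * nn) * rho x + A0 / (8 * nn * (nn + 2)) * rho x ^+ 2 - (48 * N)^-1 * rho x ^+ 3,
      forall b, D [:: b] x = yc b x *
        (B0 / nn + A0 / (2 * nn * (nn + 2)) * rho x - (8 * N)^-1 * rho x ^+ 2),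
      forall k b, D [:: k; b] x =
        (B0 / nn + A0 / (2 * nn * (nn + 2)) * rho x - (8 * N)^-1 * rho x ^+ 2) * dl k b +
        (A0 / (nn * (nn + 2)) - rho x / (2 * N)) * (yc k x * yc b x) &
      forall l k b, D [:: l; k; b] x =
        (A0 / (nn * (nn + 2)) - rho x / (2 * N)) * (dl l k * yc b x + dl l b * yc k x + dl k b * yc l x)
        - N^-1 * (yc l x * yc k x * yc b x)].
Proof.
exists A, B, (D [::] p - upoly p) => x Ox; split.
- by rewrite D0_explicit// /upoly; ring.
- by move=> b; exact: D1_explicit.
- by move=> k b; exact: D2_explicit.
- by move=> l k b; exact: D3_explicit.
Qed.

End Explicit.

(** * Geometry of the squared distance to the centre *)

Section RhoGeometry.
Variables (R : realType) (n : nat).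
Notation V := 'rV[R]_n.
Implicit Types (x y z p q : V) (a b k : 'I_n) (O : set V).
Variable x0 : V.
Notation yc := (yc x0).
Notation rho := (rho x0).

Lemma rho_ge0 x : 0 <= rho x.
Proof. by apply: sumr_ge0 => a _; rewrite -expr2 sqr_ge0. Qed.

Lemma rho_eq0 x : (forall b, yc b x = 0) -> rho x = 0.
Proof. by move=> h; apply: big1 => b _; rewrite h mul0r. Qed.

Lemma rho_cont : continuous rho.
Proof.
have -> : rho = (fun x => - paraboloid x0 0 x).
  apply/funext => x; rewrite /paraboloid expr0n/= sub0r opprK; apply: eq_bigr => a _.
  by rewrite -expr2.
by move=> x; apply: continuousN; exact: paraboloid_cont.
Qed.

Lemma rho_enorm x : enorm (x - x0) ^+ 2 = rho x.
Proof.
rewrite sqr_sqrtr; last by apply: sumr_ge0 => a _; exact: sqr_ge0.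
by apply: eq_bigr => a _; rewrite !mxE expr2.
Qed.

Lemma eball_rho (r : R) x : 0 < r -> eball x0 r x <-> rho x < r ^+ 2.
Proof.
move=> r0; rewrite /eball /= -rho_enorm ltr_pXn2r// ?nnegrE ?sqrtr_ge0//.
exact: ltW.
Qed.

Lemma open_not_max O x k : open O -> O x -> exists2 t, O t & rho x < rho t.
Proof.
move=> oO Ox; have /nbhs_ballP[r /= r0 hr] := open_nbhs_in oO Ox.
(* The sign makes the cross term in [rho (x + h e_k)] nonnegative, so that [h * h] is a strict
   gain. *)
pose h : R := if 0 <= yc k x then r / 2 else - (r / 2).
have h2 : 0 < r / 2 by rewrite divr_gt0.
have hy : 0 <= h * yc k x.
  rewrite /h; case: (leP 0 (yc k x)) => yk; first by rewrite mulr_ge0// ltW.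
  by rewrite mulNr oppr_ge0 pmulr_rle0// ltW.
have hh : h * h = (r / 2) * (r / 2) by rewrite /h; case: ifP; rewrite ?mulrNN.
have nh : `|h| = r / 2.
  by rewrite /h; case: ifP => _; rewrite ?normrN gtr0_norm.
exists (x + h *: ebasis R k).
  apply: hr; rewrite -ball_normE /= opprD addrA subrr sub0r normrN.
  by apply: (le_lt_trans (norm_eb k h)); rewrite nh; lra.
have yE a : yc a (x + h *: ebasis R k) = yc a x + h * (a == k)%:R.
  by rewrite /yc !mxE eqxx/=; ring.
rewrite /rho (bigD1 k)//= [ltRHS](bigD1 k)//= yE eqxx mulr1.
rewrite [X in _ < _ + X](eq_bigr (fun a => yc a x * yc a x)); last first.
  by move=> a /negbTE ak; rewrite yE ak mulr0 addr0.
rewrite ltrD2r; have : 0 < h * h by rewrite hh mulr_gt0.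
move: hy; nra.
Qed.

(** The farthest boundary point from the centre: it will give the radius, and since it differs from
    the centre the boundary conditions at it determine the polynomial. *)
Lemma rho_max O k : open O -> O !=set0 -> bset O ->
  exists z, [/\ bdry O z, 0 < rho z & forall x, O x -> rho x < rho z].
Proof.
move=> oO [p Op] bO.
have c0 : closure O !=set0 by exists p; exact: subset_closure.
have cr : {within closure O, continuous rho} by apply: continuous_subspaceT; exact: rho_cont.
have [z /set_mem cz hz] := EVT_max_rV c0 (compact_closure bO) cr.
have lt x : O x -> rho x < rho z.
  move=> Ox; have [t Ot xt] := open_not_max k oO Ox; apply: (lt_le_trans xt).
  by apply: hz; apply/mem_set; exact: subset_closure.
exists z; split=> //; last exact: le_lt_trans (rho_ge0 p) (lt p Op).
by split=> // Oz; have := lt z Oz; rewrite ltxx.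
Qed.

Lemma rho_convex p q (s t : R) : 0 <= t <= 1 -> rho p < s -> rho q < s ->
  rho (p + t *: (q - p)) < s.
Proof.
move=> /andP[t0 t1] ps qs.
have : rho (p + t *: (q - p)) <= (1 - t) * rho p + t * rho q.
  rewrite /rho !mulr_sumr -big_split/=; apply: ler_sum => a _.
  have -> : yc a (p + t *: (q - p)) = (1 - t) * yc a p + t * yc a q.
    by rewrite /yc !mxE; ring.
  have : 0 <= t * (1 - t) * (yc a p - yc a q) ^+ 2.
    by rewrite mulr_ge0 ?sqr_ge0// mulr_ge0// subr_ge0.
  move=> h; rewrite -subr_ge0; apply: le_trans h _; rewrite le_eqVlt; apply/orP; left; apply/eqP.
  by ring.
move/le_lt_trans; apply.
have [->|tn0] := eqVneq t 0; first by rewrite subr0 mul1r mul0r addr0.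
have tp : 0 < t by rewrite lt_def tn0.
have e : s = (1 - t) * s + t * s by ring.
rewrite [ltRHS]e; apply: ler_ltD; last by rewrite ltr_pM2l.
by apply: ler_wpM2l; [rewrite subr_ge0|exact: ltW].
Qed.

(** The segment from [p] to [q] stays in the convex set where [rho < s], so it meets no boundary
    point of [O]; being connected, it stays in [O]. *)
Lemma sublevel_fill O (s : R) p q : open O -> O p ->
  (forall x, bdry O x -> s <= rho x) -> rho p < s -> rho q < s -> O q.
Proof.
move=> oO Op hb ps qs.
pose g (t : R) : V := p + t *: (q - p).
have cg t : {for t, continuous g}.
  suff : {for t, continuous (fun t : R => p + t *: (q - p))} by [].
  by apply: continuousD; [exact: cst_continuous|apply: cvgZr_tmp; exact: cvg_id].
have E : `[0, 1]%classic `&` (g @^-1` O) = `[0, 1]%classic.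
  apply: (@segment_connected R 0 1).
  - exists 0; split; first by rewrite /= in_itv/= lexx ler01.
    by rewrite /g /= scale0r addr0.
  - exists (g @^-1` O) => //; apply: open_comp => // t _; exact: cg.
  - exists (~` (g @^-1` (~` closure O))).
      rewrite closedC; apply: open_comp; first by move=> t _; exact: cg.
      by rewrite openC; exact: closed_closure.
    apply/seteqP; split=> t /= [t01 h]; split=> //; first by move=> nc; apply: nc; exact: subset_closure.
    apply: contrapT => nO; have bt : bdry O (g t) by split=> //; apply: contrapT.
    have : rho (g t) < s by apply: rho_convex => //; move: t01; rewrite in_itv.
    by rewrite ltNge hb.
have : (`[0, 1]%classic `&` (g @^-1` O)) 1 by rewrite E /= in_itv/= lexx ler01.
by move=> [_ /=]; rewrite /g scale1r addrC subrK.
Qed.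

End RhoGeometry.

(** * Determination of the polynomial and of the domain *)

Section Ball.
Variables (R : realType) (n : nat).
Notation V := 'rV[R]_n.
Notation nn := (n%:R : R).
Notation dl := (dl R).
Implicit Types (x y : V) (a b d k l : 'I_n).

Lemma powR_cubeK (t : R) : 0 <= t -> powR (t ^+ 3) 3^-1 = t.
Proof.
move=> t0; rewrite -powR_mulrn// -powRrM mulfV ?powRr1//.
Qed.

Variables (O : set V) (u : V -> R) (c : R).
Hypothesis J : jet O u c.
Hypothesis T0z : forall x, O x -> T0sq u x = 0.
Hypothesis cO : connected O.
Hypothesis n_ge2 : (2 <= n)%N.
Hypothesis O0 : O !=set0.
Let dO : odom O := jet_dom J.
Notation D s := (dp s u).
Let n2 : nn + 2 != 0. Proof. by rewrite gt_eqF// ltr_wpDl. Qed.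
Let n4 : nn + 4 != 0. Proof. by rewrite gt_eqF// ltr_wpDl. Qed.
Let n0 : nn != 0. Proof. by rewrite pnatr_eq0; lia. Qed.
Let N : R := nn * (nn + 2) * (nn + 4).
Let N0 : 0 < N. Proof. by rewrite !mulr_gt0// ?ltr_wpDl// ltr0n; lia. Qed.

(* At a boundary point other than x0, u and its derivatives up to order 2 vanish, so that u,
   a cubic polynomial of rho, has there a triple root in rho. *)
Lemma ball_solution : exists (x0 : V) (s : R), [/\ 0 < s, c ^+ 2 = s ^+ 3 / N ^+ 2,
  forall x, O x <-> rho x0 x < s &
  forall x, O x -> u x = (s - rho x0 x) ^+ 3 / (48 * N)].
Proof.
have [_ oO bO] := dO.
have [x0 W1] := wd1_explicit J T0z cO O0; have [p Op] := O0.
have [A [B [C0 H]]] := explicit_solution J T0z cO n_ge2 W1 Op.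
exists x0; have k0 : 'I_n by exists 0%N; lia.
have [z [bz z0 hz]] := rho_max x0 k0 oO O0 bO.
set s := rho x0 z in z0 hz; exists s.
pose q0 x := C0 + B / (2 * nn) * rho x0 x + A / (8 * nn * (nn + 2)) * rho x0 x ^+ 2 - (48 * N)^-1 * rho x0 x ^+ 3.
pose q1 x := B / nn + A / (2 * nn * (nn + 2)) * rho x0 x - (8 * N)^-1 * rho x0 x ^+ 2.
pose q2 x := A / (nn * (nn + 2)) - rho x0 x / (2 * N).
have tr x : tends O x (rho x0) (rho x0 x) by apply: tends_cont; exact: rho_cont.
have ty b x : tends O x (yc x0 b) (yc x0 b x).
  apply: tends_cont; suff : {for x, continuous (fun x : V => x ord0 b - x0 ord0 b)} by [].
  by apply: continuousB; [exact: coord_continuous|exact: cst_continuous].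
have tc (t : R) x : tends O x (fun=> t) t by exact: tends_cst.
have tB F G x (t r : R) : tends O x F t -> tends O x G r -> tends O x (fun y => F y - G y) (t - r).
  move=> h1 h2; have := tendsD h1 (tendsZ (b := -1) h2); rewrite mulN1r.
  by apply: tends_eq => y _; rewrite mulN1r.
have tq0 x : tends O x q0 (q0 x).
  apply: tB; last by apply: tendsZ; do 3 apply: tendsM => //.
  by apply: tendsD; [apply: tendsD => //; exact: tendsZ|apply: tendsZ; apply: tendsM].
have tq1 x : tends O x q1 (q1 x).
  apply: tB; last by apply: tendsZ; apply: tendsM.
  by apply: tendsD => //; exact: tendsZ.
have tq2 x : tends O x q2 (q2 x) by apply: tB => //; exact: tendsM.
have b0 x : bdry O x -> q0 x = 0.
  move=> bx; have [cx _] := bx; apply: (tends_uniq cx (tq0 x)).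
  by apply: (tends_eq _ (jet_vanish J (s := [::]) isT bx)) => y Oy; have [-> _ _ _] := H y Oy.
have b1 x b : bdry O x -> yc x0 b x * q1 x = 0.
  move=> bx; have [cx _] := bx; apply: (tends_uniq cx (tendsM (ty b x) (tq1 x))).
  by apply: (tends_eq _ (jet_vanish J (s := [:: b]) isT bx)) => y Oy; have [_ h _ _] := H y Oy; exact: h.
have b2 x k b : bdry O x -> q1 x * dl k b + q2 x * (yc x0 k x * yc x0 b x) = 0.
  move=> bx; have [cx _] := bx.
  apply: (tends_uniq cx (tendsD (tendsM (tq1 x) (tc (dl k b) x)) (tendsM (tq2 x) (tendsM (ty k x) (ty b x))))).
  by apply: (tends_eq _ (jet_vanish J (s := [:: k; b]) isT bx)) => y Oy; have [_ _ h _] := H y Oy; exact: h.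
(* Away from the centre some coordinate of the position vector is nonzero: [Du = 0] then gives
   [q1 = 0], and a diagonal entry of [D^2 u = 0] gives [q2 = 0]. *)
have q12 x : bdry O x -> rho x0 x != 0 -> q1 x = 0 /\ q2 x = 0.
  move=> bx r0; have [b yb] : exists b, yc x0 b x != 0.
    apply: contrapT => nb; move/eqP: r0; apply; apply: rho_eq0 => b.
    by apply/eqP; rewrite -[_ == _]negbK; apply/negP => yb; apply: nb; exists b.
  have q10 : q1 x = 0 by have /eqP := b1 x b bx; rewrite mulf_eq0 (negbTE yb)/= => /eqP.
  split=> //; have /eqP := b2 x b b bx; rewrite q10 mul0r add0r !mulf_eq0 !(negbTE yb) !orbF.
  by move/eqP.
have [q1z q2z] := q12 z bz (lt0r_neq0 z0); have q0z := b0 z bz.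
have nN : N != 0 by rewrite gt_eqF.
have Nn : nn * (nn + 2) = N / (nn + 4) by rewrite /N mulfK.
(* The conditions [q2 = 0], [q1 = 0] and [q0 = 0] at [z] form a triangular system for [A], [B] and
   [C0]. *)
have eA : A = nn * (nn + 2) * s / (2 * N).
  have -> : A = (nn * (nn + 2)) * (q2 z + s / (2 * N)) by rewrite /q2 -/s; field; rewrite n0 n2 nN.
  by rewrite q2z add0r mulrA.
have eB : B = - (nn * s ^+ 2 / (8 * N)).
  have -> : B = nn * (q1 z - (A / (2 * nn * (nn + 2)) * s - (8 * N)^-1 * s ^+ 2)).
    by rewrite /q1 -/s; field; rewrite n0 n2 nN.
  by rewrite q1z eA; field; rewrite n0 n2 nN.
have eC : C0 = s ^+ 3 / (48 * N).
  have -> : C0 = q0 z - (B / (2 * nn) * s + A / (8 * nn * (nn + 2)) * s ^+ 2 - (48 * N)^-1 * s ^+ 3).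
    by rewrite /q0 -/s; ring.
  by rewrite q0z eA eB; field; rewrite n0 n2 nN.
(* The centre is no boundary point, since [q0] would be [s ^+ 3 / (48 * N)] there; at any other
   boundary point [q2 = 0], which is affine in [rho] with the root [s]. *)
have bs x : bdry O x -> rho x0 x = s.
  move=> bx; have [r0|r0] := eqVneq (rho x0 x) 0.
    have := b0 x bx; rewrite /q0 r0 eC => /eqP.
    have -> : s ^+ 3 / (48 * N) + B / (2 * nn) * 0 + A / (8 * nn * (nn + 2)) * 0 ^+ 2 - (48 * N)^-1 * 0 ^+ 3 = s ^+ 3 / (48 * N).
      by ring.
    by rewrite gt_eqF// divr_gt0 ?exprn_gt0// mulr_gt0.
  have [_ q2x] := q12 x bx r0.
  have -> : rho x0 x = 2 * N * (s / (2 * N) - q2 x) by rewrite /q2 eA; field; rewrite n0 n2 nN.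
  by rewrite q2x subr0; field.
split=> //.
- have [cz _] := bz; have [nu nu1 hnu] := jet_bdry J bz.
  (* Third derivatives at [z] in two ways: [c] times the cube of [nu], and [- N^-1] times the cube
     of the position vector. Comparing squared norms, index by index, yields [c ^+ 2] and loses the
     sign of [c]. *)
  have y3 l k b : c * nu l * nu k * nu b = - (N^-1 * (yc x0 l z * yc x0 k z * yc x0 b z)).
    have T : tends O z (D [:: l; k; b]) (q2 z * (dl l k * yc x0 b z + dl l b * yc x0 k z + dl k b * yc x0 l z)
      - N^-1 * (yc x0 l z * yc x0 k z * yc x0 b z)).
      apply: (tends_eq (F := fun x => q2 x * (dl l k * yc x0 b x + dl l b * yc x0 k x + dl k b * yc x0 l x)
          - N^-1 * (yc x0 l x * yc x0 k x * yc x0 b x))).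
        by move=> y Oy; have [_ _ _ ->] := H y Oy.
      apply: tB; last by apply: tendsZ; apply: tendsM => //; exact: tendsM.
      by apply: tendsM => //; apply: tendsD; [apply: tendsD|]; exact: tendsZ.
    by rewrite (tends_uniq cz (hnu l k b) T) q2z mul0r sub0r.
  have e3 l k b : c ^+ 2 * nu l ^+ 2 * nu k ^+ 2 * nu b ^+ 2 =
     (yc x0 l z ^+ 2 * yc x0 k z ^+ 2) / N ^+ 2 * (yc x0 b z * yc x0 b z).
    have -> : c ^+ 2 * nu l ^+ 2 * nu k ^+ 2 * nu b ^+ 2 = (c * nu l * nu k * nu b) ^+ 2 by ring.
    by rewrite y3; field.
  have e2 l k : c ^+ 2 * nu l ^+ 2 * nu k ^+ 2 = yc x0 l z ^+ 2 / N ^+ 2 * s * (yc x0 k z * yc x0 k z).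
    rewrite -[LHS]mulr1 -nu1 mulr_sumr (eq_bigr _ (fun b _ => e3 l k b)) -mulr_sumr -/(rho x0 z) -/s.
    by field.
  have e1 l : c ^+ 2 * nu l ^+ 2 = s ^+ 2 / N ^+ 2 * (yc x0 l z * yc x0 l z).
    rewrite -[LHS]mulr1 -nu1 mulr_sumr (eq_bigr _ (fun k _ => e2 l k)) -mulr_sumr -/(rho x0 z) -/s.
    by field.
  rewrite -[LHS]mulr1 -nu1 mulr_sumr (eq_bigr _ (fun l _ => e1 l)) -mulr_sumr -/(rho x0 z) -/s.
  by field.
- move=> x; split; first exact: hz.
  move=> xs; apply: (@sublevel_fill R n x0 O s p x) => //; last exact: hz.
  by move=> y /bs ->.
- move=> x Ox; have [h _ _ _] := H x Ox; move: h; rewrite dpE /= => ->.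
  by rewrite eA eB eC /N; field; rewrite n0 n2 n4.
Qed.

End Ball.

Unset Implicit Arguments.

Theorem theorem2 (R : realType) (n : nat) (Omega : set 'rV[R]_n)
    (nu : 'rV[R]_n -> 'rV[R]_n) (u : 'rV[R]_n -> R) (c : R) :
  (2 <= n)%N ->
  bounded_domain Omega ->
  (exists eps : R, 0 < eps < 1 /\ Ckalpha_boundary 6 eps Omega) ->
  outward_unit_normal Omega nu ->
  Ck_closure 6 Omega u ->
  (forall x, Omega x -> lap (lap (lap u)) x = -1) ->
  (forall x, bdry Omega x -> u x = 0) ->
  (forall x, bdry Omega x ->
     (fun y => edot (grad u y) (nu x)) @ within Omega (nbhs x) --> 0) ->
  (forall x, bdry Omega x -> lap u @ within Omega (nbhs x) --> 0) ->
  (forall x, bdry Omega x ->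
     (fun y => edot (grad (lap u) y) (nu x)) @ within Omega (nbhs x) --> c) ->
  ((3 <= n)%N -> exists gamma : 'rV[R]_n -> R, torsion_function Omega gamma /\
     (rv_integral (fun x => (\1_Omega x * (lap (lap u) x ^+ 2 * gamma x))%:E)
      <= ((2 * (n%:R + 2) * c ^+ 2) / (n%:R + 6))%:E * volume Omega)%E) ->
  let N := n%:R * (n%:R + 2) * (n%:R + 4) : R in
  exists x0 : 'rV[R]_n,
    Omega = eball x0 (powR (`|c| * N) (3^-1)) /\
    forall x, Omega x ->
      let r := enorm (x - x0) in
      u x = - (48 * N)^-1 * r ^+ 6
            + powR (c ^+ 2 / N) (3^-1) * r ^+ 4 / 16
            - powR (c ^+ 4 * N) (3^-1) * r ^+ 2 / 16
            + c ^+ 2 * N / 48.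
Proof.
move=> n2 bdO _ hnu Cu eq6 u0 un0 lu0 lun hg N.
have npos : (0 < n)%N by lia.
have [On0 [oO [cO _]]] := bdO.
have J := make_jet npos bdO hnu Cu eq6 u0 un0 lu0 lun.
have T0z x : Omega x -> T0sq u x = 0.
  move: n2; rewrite leq_eqVlt => /orP[/eqP n2|n3]; first exact: (T0_planar J (esym n2)).
  have [gamma [tg Hg]] := hg n3.
  exact: (T0_torsion J tg n3 (proj1 Cu) Hg).
have [x0 [s [s0 cs hO hu]]] := ball_solution J T0z cO n2 On0.
have N0 : 0 < N by rewrite /N !mulr_gt0// ?ltr_wpDl// ltr0n.
have nN : N != 0 by rewrite gt_eqF.
rewrite -/N in cs hu.
(* [s] is the squared radius and [c ^+ 2 = s ^+ 3 / N ^+ 2], so the three cube roots of the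
   statement are those of the cubes of [a], [s / N] and [s ^+ 2 / N]. *)
pose a := Num.sqrt s; have a0 : 0 < a by rewrite sqrtr_gt0.
have as2 : a ^+ 2 = s by rewrite sqr_sqrtr// ltW.
have ca : `|c| * N = a ^+ 3.
  apply/eqP; rewrite -(eqrXn2 (n := 2))// ?mulr_ge0 ?exprn_ge0// ?ltW//.
  by rewrite exprMn real_normK ?num_real// cs -exprM mulnC exprM as2 divfK ?expf_neq0.
have p1 : powR (`|c| * N) 3^-1 = a by rewrite ca powR_cubeK// ltW.
have p2 : powR (c ^+ 2 / N) 3^-1 = s / N.
  have -> : c ^+ 2 / N = (s / N) ^+ 3 by rewrite cs; field.
  by rewrite powR_cubeK// divr_ge0// ltW.
have p3 : powR (c ^+ 4 * N) 3^-1 = s ^+ 2 / N.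
  have -> : c ^+ 4 * N = (s ^+ 2 / N) ^+ 3 by rewrite (exprM c 2 2) cs; field.
  by rewrite powR_cubeK// divr_ge0 ?exprn_ge0// ltW.
exists x0; rewrite p1; split.
  apply/seteqP; split=> x; first by move=> /hO h; apply/eball_rho; rewrite ?as2.
  by move=> /eball_rho h; apply/hO; rewrite -as2; exact: h.
move=> x Ox r; rewrite p2 p3 hu//.
have -> : r ^+ 6 = rho x0 x ^+ 3 by rewrite (exprM r 2 3) rho_enorm.
have -> : r ^+ 4 = rho x0 x ^+ 2 by rewrite (exprM r 2 2) rho_enorm.
have -> : r ^+ 2 = rho x0 x by exact: rho_enorm.
by rewrite cs; field.
Qed.
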